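(* Assume $\mathbb E[a_1]=0$, $\mathbb E[a_1^2]=1$ and $\mathbb E[a_1^4]<\infty$, and let $X$ be uniform on $[0,2\pi]$. Set \[ C(a_1):=81\sqrt{13+|\mathbb E[a_1^3]|}+8\sqrt{\mathbb E[a_1^4]}+\sqrt 2+8\,\mathbb E[|a_1|^3]+24\,\mathbb E[|a_1|]. \] If $G$ is $\sigma(X)$-measurable and $G\sim\mathcal N(0,1)$ under $\mathbb P_X$, then for every $n\ge1$, \[ \mathbb E\big[d^X_{\mathcal C^3}(f_n(X),G)\big]\le \frac{C(a_1)}{\sqrt n}. \]
   Context: On a probability space $(\Omega,\mathcal F,\mathbb P)$ let $(a_k)_{k\ge1}$ and $(b_k)_{k\ge1}$ be random variables such that all the $a_k,b_k$ are mutually independent with the common distribution of $a_1$. For $n\ge1$ and $t\in\mathbb R$ let $f_n(t)=\frac{1}{\sqrt n}\sum_{k=1}^n \big(a_k\cos(kt)+b_k\sin(kt)\big)$. The random variable $X$ with values in $[0,2\pi]$ is independent of all the coefficients; concretely one works on $\Omega\times[0,2\pi]$ with $\mathbb P\otimes\mathbb P_X$, $X$ being the identity on $[0,2\pi]$. $\mathbb E$ denotes expectation with respect to $\mathbb P$ and $\mathbb E_X,\mathbb P_X$ expectation/probability with respect to $X$ only (coefficients fixed). For $U,V$ measurable w.r.t. $\mathcal F\otimes\mathcal B([0,2\pi])$, $d^X_{\mathcal C^3}(U,V):=\sup\{\mathbb E_X[\phi(U)-\phi(V)]:\ \phi\in\mathcal C^3(\mathbb R),\ \|\phi^{(k)}\|_\infty\le1,\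 0\le k\le3\}$, an $\mathcal F$-measurable random variable. *)

(* Defs.v *)
From HB Require Import structures.
From mathcomp Require Import all_boot all_order all_algebra.
From mathcomp Require Import all_classical all_reals all_analysis.
Set Implicit Arguments. Unset Strict Implicit. Unset Printing Implicit Defensive.
Import Order.TTheory GRing.Theory Num.Theory.
Import numFieldNormedType.Exports.
Local Open Scope classical_set_scope.
Local Open Scope ring_scope.

Section defs.
Context (R : realType) (d : measure_display) (T : measurableType d).

Definition mutually_independent {I : eqType} (P : probability T R)
  (Y : I -> T -> R) : Prop :=
  forall (J : seq I) (B : I -> set R), uniq J -> (forall i, measurable (B i)) ->
    P (\bigcap_(i in [set` J]) (Y i @^-1` B i)) =
    (\prod_(i <- J) P (Y i @^-1` B i))%E.

Definition ab_family (a b : nat -> T -> R) : bool * nat -> T -> R :=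
  fun p => if p.1 then a p.2 else b p.2.

(* f_n(omega, t) = n^{-1/2} sum_{k=1}^n (a_k cos(kt) + b_k sin(kt));
   here [a k] stands for a_{k+1}. *)
Definition fn (a b : nat -> T -> R) (n : nat) (w : T) (t : R) : R :=
  (Num.sqrt n%:R)^-1 *
  \sum_(k < n) (a k w * cos (k.+1%:R * t) + b k w * sin (k.+1%:R * t)).

End defs.

Section defsR.
Context (R : realType).

Definition C3_unit (phi : R -> R) : Prop :=
  (forall k, (k <= 2)%N -> forall x, derivable (derive1n k phi) x 1) /\
  continuous (derive1n 3 phi) /\
  (forall k, (k <= 3)%N -> forall x, `|derive1n k phi x| <= 1).

Definition EX (h : R -> R) : \bar R :=
  (((2 * pi)^-1)%R%:E * \int[lebesgue_measure]_(x in `[0%R, (2 * pi)%R]) (h x)%:E)%E.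

Definition dXC3 (U V : R -> R) : \bar R :=
  ereal_sup [set (EX (phi \o U) - EX (phi \o V))%E | phi in C3_unit].

End defsR.

(* Main.v *)
Require Import Defs.
From HB Require Import structures.
From mathcomp Require Import all_boot all_order all_algebra.
From mathcomp Require Import all_classical all_reals all_analysis.
From mathcomp Require Import measurable_realfun ring lra.
Set Implicit Arguments. Unset Strict Implicit. Unset Printing Implicit Defensive.
Import Order.TTheory GRing.Theory Num.Theory.
Import numFieldNormedType.Exports.
Local Open Scope classical_set_scope.
Local Open Scope ring_scope.

(* Write d for the distance. For fixed coefficients, E_X phi(f_n) - E phi(N)
   is split as [E_X phi(f_n) - E E_X phi(f_n)] + [E E_X phi(f_n) - E phi(N)].
   For each fixed X = x the variable f_n(x) is a sum of 2n independent terms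
   with coefficients of size at most n^(-1/2) and squares summing to 1, so
   Lindeberg's replacement method bounds the second bracket by
   (E|a_1|^3 + 2) / (6 sqrt n), uniformly in phi.
   For the first bracket, a C^3 test function is represented as
   phi(y) = int G(s - y) (1 - d/ds)^3 phi(s) ds with G(u) = u^2 e^(-u) / 2 for
   u >= 0, the source being bounded by 8. The supremum over phi is therefore
   controlled by the single quantity int w(s) D(s)^2 ds, where
   D(s) = E_X G(s - f_n) - E E_X G(s - f_n) and w(s) = 1 + (s - 1/2)^2.
   Its mean is bounded by the Efron-Stein inequality: setting one coefficient
   to 0 changes E_X G(s - f_n) by a linear term, whose squares are summed by
   Bessel's inequality for the orthogonal functions cos(kx), sin(kx), plus a
   Taylor remainder controlled by the fourth moment. This gives
   (E a_1^4 / 4 + 10) / n when E a_1^4 <= n / 16; otherwise the theorem is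
   trivial since d <= 2. *)

(** * Bounded measurable functions *)

(** The worst test function depends on the coefficients, so bounds for one fixed [phi] cannot simply
    be averaged. The weighted square of D no longer contains [phi], and being a mean of squares it
    fits the Efron-Stein inequality. A kernel of order three spends exactly the three derivatives of
    [phi]; its own second derivative is square integrable with a single jump at 0, which is what a
    first-order expansion with an L2 remainder consumes. The weight has an integrable inverse, the
    price of passing from L2 to L1 on the whole line, and its growth is paid by second moments of
    f_n. Constants: with K = E a_1^4 / 4 + 10, optimizing the Cauchy-Schwarz step yields 16 sqrt(K /
    n), and 16 sqrt(1/4) = 8 is the factor of sqrt(E a_1^4) in the theorem. That same term exceeds 2
    sqrt n as soon as E a_1^4 > n / 16, which is where the threshold of the case split comes
    from. *)

Section bounded_measurable.
Context (R : realType).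

(** Test functions, kernels and waves all lie in this class. It is stable under algebra and partial
    integration, so real-valued integrals can be manipulated without integrability side conditions.
    Unbounded quantities, such as coefficients and weights, are mostly treated as nonnegative
    extended integrals instead. *)
Definition bmf d (T : measurableType d) (f : T -> R) :=
  measurable_fun setT f /\ exists M : R, forall x, `|f x| <= M.

Section algebra.
Context d (T : measurableType d).
Implicit Types f g : T -> R.

Lemma bmf_measurable f : bmf f -> measurable_fun setT f.
Proof. by case. Qed.

Lemma bmf_cst (c : R) : bmf (fun _ : T => c).
Proof. by split=> //; exists `|c|. Qed.

Lemma bmfD f g : bmf f -> bmf g -> bmf (fun x => f x + g x).
Proof.
move=> [mf [M Mf]] [mg [N Ng]]; split; first exact: measurable_funD.
by exists (M + N) => x; rewrite (le_trans (ler_normD _ _))// lerD.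
Qed.

Lemma bmfM f g : bmf f -> bmf g -> bmf (fun x => f x * g x).
Proof.
move=> [mf [M Mf]] [mg [N Ng]]; split; first exact: measurable_funM.
by exists (M * N) => x; rewrite normrM ler_pM.
Qed.

Lemma bmfN f : bmf f -> bmf (fun x => - f x).
Proof.
move=> [mf [M Mf]]; split; first exact: measurableT_comp.
by exists M => x; rewrite normrN.
Qed.

Lemma bmfB f g : bmf f -> bmf g -> bmf (fun x => f x - g x).
Proof. by move=> bf bg; apply: bmfD => //; exact: bmfN. Qed.

Lemma bmfX f n : bmf f -> bmf (fun x => f x ^+ n).
Proof.
move=> bf; elim: n => [|n IH]; first exact: bmf_cst.
by under eq_fun do rewrite exprS; exact: bmfM.
Qed.

Lemma bmf_sum (I : Type) (r : seq I) (F : I -> T -> R) :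
  (forall i, bmf (F i)) -> bmf (fun x => \sum_(i <- r) F i x).
Proof.
move=> bF; elim: r => [|i r IH].
  by under eq_fun do rewrite big_nil; exact: bmf_cst.
by under eq_fun do rewrite big_cons; exact: bmfD.
Qed.

Lemma bmf_comp d' (T' : measurableType d') (f : T' -> R) (g : T -> T') :
  bmf f -> measurable_fun setT g -> bmf (fun x => f (g x)).
Proof.
move=> [mf [M Mf]] mg; split; first exact: measurableT_comp.
by exists M.
Qed.

End algebra.

Section expectation.
Context d (T : measurableType d) (Q : probability T R).
Implicit Types f g : T -> R.

Lemma bmf_integrable f : bmf f -> Q.-integrable setT (EFin \o f).
Proof.
move=> [mf [M Mf]]; apply: (@le_integrable _ _ _ _ _ _ _ (cst M%:E)) => //.
- exact/measurable_EFinP.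
- move=> x _ /=; rewrite lee_fin (le_trans (Mf x))// ler_norm//.
- exact: finite_measure_integrable_cst.
Qed.

Lemma Ex_cst (c : R) : \int[Q]_x c = c.
Proof. by rewrite Rintegral_cst//= probability_setT/= mulr1. Qed.

Lemma ExD f g : bmf f -> bmf g ->
  \int[Q]_x (f x + g x) = \int[Q]_x f x + \int[Q]_x g x.
Proof. by move=> bf bg; rewrite RintegralD//; exact: bmf_integrable. Qed.

Lemma ExB f g : bmf f -> bmf g ->
  \int[Q]_x (f x - g x) = \int[Q]_x f x - \int[Q]_x g x.
Proof. by move=> bf bg; rewrite RintegralB//; exact: bmf_integrable. Qed.

Lemma ExZ (c : R) f : bmf f -> \int[Q]_x (c * f x) = c * \int[Q]_x f x.
Proof. by move=> bf; rewrite RintegralZl//; exact: bmf_integrable. Qed.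

Lemma ExZr (c : R) f : bmf f -> \int[Q]_x (f x * c) = \int[Q]_x f x * c.
Proof. by move=> bf; rewrite RintegralZr//; exact: bmf_integrable. Qed.

Lemma Ex_sum (I : Type) (r : seq I) (F : I -> T -> R) :
  (forall i, bmf (F i)) ->
  \int[Q]_x (\sum_(i <- r) F i x) = \sum_(i <- r) \int[Q]_x F i x.
Proof.
move=> bF; elim: r => [|i r IH].
  by under eq_Rintegral do rewrite big_nil; rewrite big_nil Ex_cst.
under eq_Rintegral do rewrite big_cons.
by rewrite big_cons ExD// ?IH//; exact: bmf_sum.
Qed.

Lemma Ex_le f g : bmf f -> bmf g -> (forall x, f x <= g x) ->
  \int[Q]_x f x <= \int[Q]_x g x.
Proof. by move=> bf bg fg; apply: le_Rintegral => //; exact: bmf_integrable. Qed.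

Lemma Ex_norm f (M : R) : bmf f -> (forall x, `|f x| <= M) ->
  `|\int[Q]_x f x| <= M.
Proof.
move=> bf fM; have := fM; move=> /(_ _)/ler_normlP H.
rewrite ler_norml -[X in - X]Ex_cst -[X in _ && (_ <= X)]Ex_cst.
have -> : - (\int[Q]_x M) = \int[Q]_x (- M) by rewrite !Ex_cst.
by apply/andP; split; apply: Ex_le => //; try exact: bmf_cst;
  move=> x; have [] := H x; lra.
Qed.

Lemma Ex_sqr f : bmf f -> (\int[Q]_x f x) ^+ 2 <= \int[Q]_x (f x ^+ 2).
Proof.
move=> bf; set m := \int[Q]_x f x.
have : 0 <= \int[Q]_x (f x - m) ^+ 2.
  by apply: Rintegral_ge0 => x _; rewrite sqr_ge0.
rewrite (_ : (fun x => _) = fun x => f x ^+ 2 - 2 * m * f x + m ^+ 2); last first.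
  by apply/funext => x; ring.
have bf2 := bmfX 2 bf; have bmf2 := bmfM (bmf_cst _ (2 * m)) bf.
rewrite ExD ?ExB ?Ex_cst ?ExZ//; [|exact: bmfB|exact: bmf_cst].
rewrite -/m; nra.
Qed.

Lemma EFin_Ex f : bmf f -> (\int[Q]_x f x)%:E = (\int[Q]_x (f x)%:E)%E.
Proof.
move=> bf; rewrite /Rintegral fineK//.
exact: integrable_fin_num (bmf_integrable bf).
Qed.

End expectation.

Section fubini.
Context d1 d2 (T1 : measurableType d1) (T2 : measurableType d2).
Context (Q1 : probability T1 R) (Q2 : probability T2 R).

Lemma bmf_integrable2 (f : T1 * T2 -> R) : bmf f ->
  (Q1 \x Q2)%E.-integrable setT (EFin \o f).
Proof. exact: bmf_integrable. Qed.

Lemma bmf_pair1 (f : T1 * T2 -> R) x : bmf f -> bmf (fun y => f (x, y)).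
Proof. by move=> bf; apply: bmf_comp => //; exact: measurable_pair1. Qed.

Lemma bmf_pair2 (f : T1 * T2 -> R) y : bmf f -> bmf (fun x => f (x, y)).
Proof. by move=> bf; apply: bmf_comp => //; exact: measurable_pair2. Qed.

Lemma bmf_Ex2 (f : T1 * T2 -> R) : bmf f ->
  bmf (fun x => \int[Q2]_y f (x, y)).
Proof.
move=> bf; have [_ [M Mf]] := bf; split; last first.
  by exists M => x; apply: Ex_norm => //; exact: bmf_pair1.
apply: measurableT_comp => //.
(* The first factor carries no measure here; a Dirac mass stands in for one so that the
   measurability part of Fubini's theorem applies. *)
pose D : probability T1 R := \d_(point : T1).
exact: (@measurable_fubini_F _ _ _ _ _ D Q2 _ (bmf_integrable (D \x Q2)%E bf)).
Qed.

Lemma Ex_fubini (f : T1 * T2 -> R) : bmf f ->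
  \int[Q1]_x \int[Q2]_y f (x, y) = \int[Q2]_y \int[Q1]_x f (x, y).
Proof.
move=> bf; have := Fubini (bmf_integrable2 bf).
rewrite {1}/Rintegral => /(congr1 fine) E.
rewrite /Rintegral; transitivity (fine (\int[Q1]_x \int[Q2]_y (EFin \o f) (x, y))%E).
  by congr fine; apply: eq_integral => x _ /=; rewrite -EFin_Ex//; exact: bmf_pair1.
rewrite E; congr fine; apply: eq_integral => y _ /=.
by rewrite -EFin_Ex//; exact: bmf_pair2.
Qed.

End fubini.

End bounded_measurable.

Section ge0_integrals.
Context (R : realType).

(** Valid for arbitrary functions: the integral of a nonnegative function is a supremum over the
    simple functions below it, which can only grow with the function. The distance, a supremum over
    uncountably many test functions, is integrated through this lemma. *)
Lemma ge0_le_integralT d (T : measurableType d) (m : {measure set T -> \bar R})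
    (f g : T -> \bar R) :
  (forall x, 0 <= f x)%E -> (forall x, f x <= g x)%E ->
  (\int[m]_x f x <= \int[m]_x g x)%E.
Proof.
move=> f0 fg; rewrite !ge0_integralTE//; last first.
  by move=> x; exact: le_trans (fg x).
by apply: le_ereal_sup => _ [h hf <-]; exists h => // x; exact: le_trans (fg x).
Qed.

Lemma measurable_ge0_integral d1 d2 (T1 : measurableType d1) (T2 : measurableType d2)
    (m2 : {sigma_finite_measure set T2 -> \bar R}) (g : T1 * T2 -> R) :
  measurable_fun setT g -> (forall p, 0 <= g p) ->
  measurable_fun setT (fun a => \int[m2]_b (g (a, b))%:E)%E.
Proof.
move=> mg g0; apply: (@measurable_fun_fubini_tonelli_F _ _ _ _ _ m2 (EFin \o g)).
  exact/measurable_EFinP.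
by move=> p; rewrite lee_fin.
Qed.

Lemma ge0_swap d1 d2 (T1 : measurableType d1) (T2 : measurableType d2)
    (m1 : {sigma_finite_measure set T1 -> \bar R})
    (m2 : {sigma_finite_measure set T2 -> \bar R}) (g : T1 * T2 -> R) :
  measurable_fun setT g -> (forall p, 0 <= g p) ->
  (\int[m1]_a \int[m2]_b (g (a, b))%:E = \int[m2]_b \int[m1]_a (g (a, b))%:E)%E.
Proof.
move=> mg g0; apply: (@fubini_tonelli _ _ _ _ _ m1 m2 (EFin \o g)).
  exact/measurable_EFinP.
by move=> p; rewrite lee_fin.
Qed.

End ge0_integrals.

(** * Resampling and the Efron-Stein inequality *)

Section tuple_measures.
Context (R : realType).

Lemma measurable_mktuple d (T : measurableType d) N (F : 'I_N -> T -> R) :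
  (forall i, measurable_fun setT (F i)) ->
  measurable_fun setT (fun x => [tuple F i x | i < N]).
Proof.
move=> mF; apply/measurable_fun_tnthP => i.
rewrite [X in measurable_fun _ X](_ : _ = F i) //.
by apply/funext => x /=; rewrite tnth_mktuple.
Qed.

Definition box N (B : 'I_N -> set R) : set (N.-tuple R) :=
  [set z | forall i, B i (tnth z i)].

(** Boxes are stable under intersection and generate the sigma-algebra of tuples, so the uniqueness
    theorem for measures applies. *)
Lemma probability_tuple_unique N (Q1 Q2 : probability (N.-tuple R) R) :
  (forall B : 'I_N -> set R, (forall i, measurable (B i)) ->
    Q1 (box B) = Q2 (box B)) ->
  forall A, measurable A -> Q1 A = Q2 A.
Proof.
move=> H; pose G : set (set (N.-tuple R)) :=
  [set A | exists2 B : 'I_N -> set R, (forall i, measurable (B i)) & A = box B].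
apply: (measure_unique G (fun _ => setT)).
- apply/seteqP; split=> A.
    apply: smallest_sub; first exact: smallest_sigma_algebra.
    move=> {}A; rewrite -bigcup_seq => -[/= i _ [B mB]]; rewrite setTI => <-.
    apply: sub_sigma_algebra; exists (fun j => if j == i then B else setT).
      by move=> j; case: ifP.
    apply/seteqP; split=> z /=.
      by move=> Bz j; case: eqP => // ->.
    by move=> /(_ i); rewrite eqxx.
  apply: smallest_sub => [|{}A [B mB ->]]; first exact: sigma_algebra_measurable.
  rewrite (_ : box B = \big[setI/setT]_(i < N) ((fun z : N.-tuple R => tnth z i) @^-1` B i)).
    apply: bigsetI_measurable => i _.
    by rewrite -[X in measurable X]setTI; apply: measurable_tnth.
  rewrite -bigcap_seq; apply/seteqP; split=> z /=; first by move=> h i _; exact: h.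
  by move=> h i; apply: h; rewrite /= mem_index_enum.
- move=> _ _ [B1 mB1 ->] [B2 mB2 ->]; exists (fun i => B1 i `&` B2 i).
    by move=> i; exact: measurableI.
  apply/seteqP; split=> z /=; first by move=> [h1 h2] i; split.
  by move=> h; split=> i; have [] := h i.
- by move=> _; exists (fun=> setT) => //; apply/seteqP; split.
- by rewrite bigcup_const.
- by move=> _ [B mB ->]; exact: H.
- by move=> _ /=; rewrite (probability_setT Q1) ltry.
Qed.

End tuple_measures.

Section resampling.
Context (R : realType) d (T : measurableType d) (P : probability T R).
Context (N : nat) (Z : 'I_N -> T -> R) (al : T -> R).
Hypothesis mZ : forall i, measurable_fun setT (Z i).
Hypothesis mal : measurable_fun setT al.
(** Joint independence and equality of laws in one formula: every factor is computed with the single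
    variable [al]. Evaluated on the second factor of [P \x P], [al] also provides an independent
    copy of any coefficient. *)
Hypothesis indep : forall B : 'I_N -> set R, (forall i, measurable (B i)) ->
  P (\bigcap_i (Z i @^-1` B i)) = (\prod_(i < N) P (al @^-1` B i))%E.

Definition upd (z : N.-tuple R) (i : 'I_N) (x : R) : N.-tuple R :=
  [tuple (if j == i then x else tnth z j) | j < N].

Definition coefs (w : T) : N.-tuple R := [tuple Z i w | i < N].

Lemma tnth_upd z i x j : tnth (upd z i x) j = if j == i then x else tnth z j.
Proof. by rewrite tnth_mktuple. Qed.

Lemma upd_upd z i x y : upd (upd z i x) i y = upd z i y.
Proof. by apply/eq_from_tnth => j; rewrite !tnth_upd; case: (j == i). Qed.

Lemma updC z i j x y : i != j -> upd (upd z i x) j y = upd (upd z j y) i x.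
Proof.
move=> ij; apply/eq_from_tnth => k; rewrite !tnth_upd.
by case: (eqVneq k j) => // ->; rewrite eq_sym (negbTE ij).
Qed.

Lemma upd_tnth z i : upd z i (tnth z i) = z.
Proof. by apply/eq_from_tnth => j; rewrite !tnth_upd; case: eqP => [->|]. Qed.

Lemma measurable_coefs : measurable_fun setT coefs.
Proof. exact: measurable_mktuple. Qed.

Lemma measurable_upd d' (T' : measurableType d') (u : T' -> N.-tuple R) (v : T' -> R) i :
  measurable_fun setT u -> measurable_fun setT v ->
  measurable_fun setT (fun x => upd (u x) i (v x)).
Proof.
move=> mu mv; apply: measurable_mktuple => j; case: (j == i) => //.
by apply: (measurableT_comp (measurable_tnth j) mu).
Qed.

Let resamp (i : 'I_N) (w : T * T) := upd (coefs w.1) i (al w.2).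

Let measurable_resamp i : measurable_fun setT (resamp i).
Proof.
apply: measurable_upd.
  by apply: (measurableT_comp measurable_coefs); exact: measurable_fst.
exact: measurableT_comp.
Qed.

Let coefs_rv : {RV P >-> (N.-tuple R)} :=
  HB.pack coefs (isMeasurableFun.Build _ _ _ _ _ measurable_coefs).
Let resamp_rv i : {RV (P \x P)%E >-> (N.-tuple R)} :=
  HB.pack (resamp i) (isMeasurableFun.Build _ _ _ _ _ (measurable_resamp i)).

(** Both laws give a box the product of its marginal masses. For the resampled tuple the box becomes
    a rectangle in [T * T], side [i] being read off the second sample. *)
Lemma law_resample i A : measurable A ->
  distribution P coefs_rv A = distribution (P \x P)%E (resamp_rv i) A.
Proof.
apply: probability_tuple_unique => B mB.
change (P (coefs @^-1` box B) = (P \x P)%E (resamp i @^-1` box B)).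
have -> : coefs @^-1` box B = \bigcap_i (Z i @^-1` B i).
  apply/seteqP; split=> w /=.
    by move=> h j _; have := h j; rewrite tnth_mktuple.
  by move=> h j; rewrite tnth_mktuple; exact: h.
(* Side [i] is relaxed to [setT], so that independence applies to the first sample with a factor 1
   at [i]. *)
pose B' j := if j == i then setT else B j.
have mB' j : measurable (B' j) by rewrite /B'; case: ifP.
have -> : resamp i @^-1` box B =
    (\bigcap_j (Z j @^-1` B' j)) `*` (al @^-1` B i).
  apply/seteqP; split=> -[w w'] /=.
    move=> h; split; last by have := h i; rewrite tnth_upd eqxx.
    move=> j _; have := h j; rewrite tnth_upd /B' /=; case: eqP => // _.
    by rewrite tnth_mktuple.
  move=> [h h'] j; rewrite tnth_upd; case: (eqVneq j i) => [->//|ji].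
  by have := h j Logic.I; rewrite /B' (negbTE ji) tnth_mktuple.
rewrite product_measure1E//; last 2 first.
- apply: (fin_bigcap_measurable finite_finset) => j _.
  by rewrite -[X in measurable X]setTI; exact: mZ.
- by rewrite -[X in measurable X]setTI; exact: mal.
transitivity ((\prod_(j < N) P (al @^-1` B' j)) * P (al @^-1` B i))%E; last first.
  by congr (_ * _)%E; exact/esym/indep.
rewrite (indep mB) (bigD1 i)//= [X in _ = (X * _)%E](bigD1 i)//=.
have -> : B' i = setT by rewrite /B' eqxx.
rewrite preimage_setT (probability_setT P) mul1e muleC; congr (_ * _)%E.
by apply: eq_bigr => j ji; rewrite /B' (negbTE ji).
Qed.

(** Every later use of independence goes through this identity or its bounded version: a coefficient
    may be replaced by a fresh copy and integrated first, the others being fixed. *)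
Lemma ge0_resample i (H : N.-tuple R -> \bar R) :
  measurable_fun setT H -> (forall z, 0 <= H z)%E ->
  (\int[P]_w H (coefs w) =
   \int[P]_w \int[P]_w' H (upd (coefs w) i (al w')))%E.
Proof.
move=> mH H0.
transitivity (\int[distribution P coefs_rv]_z H z)%E.
  by rewrite ge0_integral_distribution.
rewrite (@eq_measure_integral _ _ _ _ (distribution (P \x P)%E (resamp_rv i))).
  rewrite ge0_integral_distribution//=.
  rewrite (fubini_tonelli1 (H \o resamp i))// => [|w]; last exact: H0.
  exact: measurableT_comp.
by move=> A mA _; exact: law_resample.
Qed.

Lemma bmf_resample i (H : N.-tuple R -> R) : bmf H ->
  \int[P]_w H (coefs w) = \int[P]_w \int[P]_w' H (upd (coefs w) i (al w')).
Proof.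
move=> bH; have [mH [M HM]] := bH.
have bH' : bmf (fun w : T * T => H (upd (coefs w.1) i (al w.2))).
  by apply: bmf_comp => //; exact: measurable_resamp.
(* Adding the bound [M] makes the integrand nonnegative; it cancels at the end. *)
have E : (\int[P]_w (H (coefs w) + M)%:E =
   \int[P]_w \int[P]_w' (H (upd (coefs w) i (al w')) + M)%:E)%E.
  apply: (ge0_resample i (H := fun z => (H z + M)%:E)).
    by apply/measurable_EFinP; exact: measurable_funD.
  by move=> z; rewrite lee_fin; have /ler_normlP[+ _] := HM z; lra.
have bHc : bmf (fun w => H (coefs w)).
  by apply: bmf_comp => //; exact: measurable_coefs.
have : \int[P]_w (H (coefs w) + M) =
   \int[P]_w \int[P]_w' (H (upd (coefs w) i (al w')) + M).
  rewrite {1}/Rintegral E /Rintegral; congr fine; apply: eq_integral => w _.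
  rewrite -EFin_Ex//; apply: bmfD; last exact: bmf_cst.
  exact: (bmf_pair1 w bH').
have b1 w : bmf (fun w' => H (upd (coefs w) i (al w'))).
  exact: (bmf_pair1 w bH').
have b2 : bmf (fun w => \int[P]_w' H (upd (coefs w) i (al w'))).
  exact: (bmf_Ex2 P bH').
rewrite ExD ?Ex_cst//; last exact: bmf_cst.
under [X in _ = X -> _]eq_Rintegral do rewrite (ExD _ (b1 _) (bmf_cst _ M)) Ex_cst.
rewrite (ExD _ b2 (bmf_cst _ M)) Ex_cst; exact: addIr.
Qed.

End resampling.

(** * The Efron-Stein inequality by successive averaging *)

Section efron_stein.
Context (R : realType) d (T : measurableType d) (P : probability T R).
Context (N : nat) (Z : 'I_N -> T -> R) (al : T -> R).
Hypothesis mZ : forall i, measurable_fun setT (Z i).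
Hypothesis mal : measurable_fun setT al.
Hypothesis indep : forall B : 'I_N -> set R, (forall i, measurable (B i)) ->
  P (\bigcap_i (Z i @^-1` B i)) = (\prod_(i < N) P (al @^-1` B i))%E.

(** The conditional expectation given all coefficients but the one of index [i], written as an
    operator on functions of the tuple. *)
Definition Eres (i : 'I_N) (H : N.-tuple R -> R) (z : N.-tuple R) : R :=
  \int[P]_w H (upd z i (al w)).

Definition nodep (i : 'I_N) (A : N.-tuple R -> R) :=
  forall z x, A (upd z i x) = A z.

Lemma bmf_upd_al i (H : N.-tuple R -> R) : bmf H ->
  bmf (fun p : N.-tuple R * T => H (upd p.1 i (al p.2))).
Proof.
move=> bH; apply: bmf_comp => //; apply: measurable_upd => //.
exact: measurableT_comp.
Qed.

Lemma bmf_upd_al1 i (H : N.-tuple R -> R) z : bmf H ->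
  bmf (fun w => H (upd z i (al w))).
Proof. by move=> bH; exact: (bmf_pair1 z (bmf_upd_al i bH)). Qed.

Lemma bmf_Eres i H : bmf H -> bmf (Eres i H).
Proof. by move=> bH; exact: (bmf_Ex2 P (bmf_upd_al i bH)). Qed.

Lemma nodep_Eres i H : nodep i (Eres i H).
Proof. by move=> z x; rewrite /Eres; under eq_Rintegral do rewrite upd_upd. Qed.

Lemma nodep_EresW i j H : nodep j H -> nodep j (Eres i H).
Proof.
move=> nH; have [->|ij] := eqVneq i j; first exact: nodep_Eres.
move=> z x; rewrite /Eres; apply: eq_Rintegral => w _.
by rewrite updC ?nH// eq_sym.
Qed.

Let bc (H : N.-tuple R -> R) : bmf H -> bmf (fun w => H (coefs Z w)).
Proof. by move=> bH; apply: bmf_comp => //; exact: measurable_coefs. Qed.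

Lemma Ex_Eres i H : bmf H ->
  \int[P]_w Eres i H (coefs Z w) = \int[P]_w H (coefs Z w).
Proof. by move=> bH; rewrite [RHS](bmf_resample mZ mal indep i). Qed.

(** Pythagoras: E(F - A)^2 = (E F^2 - E(E_i F)^2) + E(E_i F - A)^2, because E_i F is the orthogonal
    projection of F on the functions that do not depend on coordinate [i]. *)
Lemma Eres_sqr_defect i F A : bmf F -> bmf A -> nodep i A ->
  \int[P]_w (F (coefs Z w) ^+ 2) - \int[P]_w (Eres i F (coefs Z w) ^+ 2)
  <= \int[P]_w ((F (coefs Z w) - A (coefs Z w)) ^+ 2).
Proof.
move=> bF bA nA; set F' := Eres i F; have bF' : bmf F' := bmf_Eres i bF.
have E : \int[P]_w ((F (coefs Z w) - A (coefs Z w)) ^+ 2) =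
  \int[P]_w (Eres i (fun z => F z ^+ 2) (coefs Z w) - 2 * (A (coefs Z w) * F' (coefs Z w))
     + A (coefs Z w) ^+ 2).
  rewrite -(Ex_Eres i (H := fun z => (F z - A z) ^+ 2)); last by apply/bmfX/bmfB.
  apply: eq_Rintegral => w _; rewrite /Eres; set z := coefs Z w.
  rewrite (_ : (fun w' => _) = fun w' => F (upd z i (al w')) ^+ 2
     - (2 * A z) * F (upd z i (al w')) + A z ^+ 2); last first.
    by apply/funext => w'; rewrite nA; ring.
  have b1 := bmf_upd_al1 i z bF; have b2 := bmfX 2 b1.
  have b3 := bmfM (bmf_cst _ (2 * A z)) b1.
  by rewrite ExD ?ExB ?Ex_cst ?ExZ// ?mulrA//; [exact: bmfB|exact: bmf_cst].
have bEF2 : bmf (fun w => Eres i (fun z => F z ^+ 2) (coefs Z w)).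
  by apply: bc; apply: bmf_Eres; exact: bmfX.
have bAF : bmf (fun w => A (coefs Z w) * F' (coefs Z w)) by apply: bmfM; exact: bc.
have b2AF := bmfM (bmf_cst _ 2) bAF.
have bA2 := bmfX 2 (bc bA); have bF2 := bmfX 2 (bc bF').
rewrite E ExD ?ExB//; last exact: bmfB.
rewrite ExZ// (Ex_Eres i (H := fun z => F z ^+ 2)); last exact: bmfX.
have : 0 <= \int[P]_w ((F' (coefs Z w) - A (coefs Z w)) ^+ 2).
  by apply: Rintegral_ge0 => w _; exact: sqr_ge0.
rewrite (_ : (fun w => (F' _ - _) ^+ 2) = fun w => F' (coefs Z w) ^+ 2
  - 2 * (A (coefs Z w) * F' (coefs Z w)) + A (coefs Z w) ^+ 2); last first.
  by apply/funext => w; ring.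
rewrite ExD ?ExB ?ExZ//; [lra|exact: bmfB].
Qed.

(** Coordinates are averaged out one at a time and the losses of square mean telescope. Averaging in
    one coordinate keeps the comparison functions admissible for the remaining ones. *)
Lemma efron_stein_seq (l : seq 'I_N) F (A : 'I_N -> N.-tuple R -> R) :
  bmf F -> (forall i, bmf (A i)) -> (forall i, nodep i (A i)) ->
  \int[P]_w (F (coefs Z w) ^+ 2) -
    \int[P]_w (foldl (fun H i => Eres i H) F l (coefs Z w) ^+ 2)
  <= \sum_(i <- l) \int[P]_w ((F (coefs Z w) - A i (coefs Z w)) ^+ 2).
Proof.
elim: l F A => [|i l IH] F A bF bA nA /=; first by rewrite big_nil subrr.
rewrite big_cons.
have := IH (Eres i F) (fun j => Eres i (A j)) (bmf_Eres i bF)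
  (fun j => bmf_Eres i (bA j)) (fun j => nodep_EresW i (nA j)).
have := Eres_sqr_defect bF (bA i) (nA i).
(* The later losses are bounded with the already averaged function; Jensen's inequality brings them
   back to the original [F]. *)
suff : \sum_(j <- l) \int[P]_w ((Eres i F (coefs Z w) - Eres i (A j) (coefs Z w)) ^+ 2)
   <= \sum_(j <- l) \int[P]_w ((F (coefs Z w) - A j (coefs Z w)) ^+ 2) by lra.
apply: ler_sum => j _.
have bFA := bmfB bF (bA j).
rewrite -[leRHS](Ex_Eres i (H := fun z => (F z - A j z) ^+ 2)); last exact: bmfX.
apply: Ex_le.
- by apply/bmfX/bmfB; apply: bc; exact: bmf_Eres.
- by apply: bc; apply: bmf_Eres; exact: bmfX.
- move=> w; rewrite /Eres -ExB; [|exact: bmf_upd_al1..].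
  by apply: Ex_sqr; exact: (bmf_upd_al1 i _ bFA).
Qed.

(** Once all coordinates are averaged out, the function is a constant, which must be the mean. The
    [A i] are arbitrary functions free of coordinate [i], so setting that coordinate to 0 is
    allowed. *)
Theorem efron_stein F (A : 'I_N -> N.-tuple R -> R) :
  bmf F -> (forall i, bmf (A i)) -> (forall i, nodep i (A i)) ->
  \int[P]_w ((F (coefs Z w) - \int[P]_v F (coefs Z v)) ^+ 2)
  <= \sum_(i < N) \int[P]_w ((F (coefs Z w) - A i (coefs Z w)) ^+ 2).
Proof.
move=> bF bA nA; set m := \int[P]_v F (coefs Z v).
have := efron_stein_seq (index_enum 'I_N) bF bA nA.
set G := foldl _ F _.
have [bG nG EG] : [/\ bmf G, forall i, nodep i G & \int[P]_w G (coefs Z w) = m].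
  rewrite /m /G => {m G}.
  suff H (l : seq 'I_N) F' : bmf F' -> let G := foldl (fun H i => Eres i H) F' l in
      [/\ bmf G, forall i, i \in l \/ nodep i F' -> nodep i G
         & \int[P]_w G (coefs Z w) = \int[P]_w F' (coefs Z w)].
    have [b n e] := H (index_enum 'I_N) _ bF; split => // i.
    by apply: n; left; rewrite mem_index_enum.
  elim: l F' => [|i l IH] F' bF' /=; first by split=> // i [].
  have [b n e] := IH _ (bmf_Eres i bF'); split=> //; last by rewrite e Ex_Eres.
  move=> j; rewrite inE => -[/orP[/eqP ->|jl]|nj]; apply: n.
  - by right; exact: nodep_Eres.
  - by left.
  - by right; exact: nodep_EresW.
(* Any tuple is reached from the zero tuple by updating the coordinates one after the other, and no
   update changes [G]. *)
have [c Gc] : exists c, forall z, G z = c.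
  exists (G [tuple 0 | i < N]) => z.
  have H (l : seq 'I_N) z' : G (foldl (fun u i => upd u i (tnth z i)) z' l) = G z'.
    by elim: l z' => //= i l IH z'; rewrite IH nG.
  rewrite -(H (enum 'I_N) [tuple 0 | i < N]); congr G; apply/eq_from_tnth => i; apply/esym.
  have H2 (l : seq 'I_N) (z' : N.-tuple R) : i \in l \/ tnth z' i = tnth z i ->
      tnth (foldl (fun u i => upd u i (tnth z i)) z' l) i = tnth z i.
    elim: l z' => [|j l IH] z' /=; first by case.
    rewrite inE => -[/orP[/eqP ij|il]|e]; apply: IH; last first.
    - by right; rewrite tnth_upd; case: eqP => [->|].
    - by left.
    - by right; rewrite tnth_upd ij eqxx.
  by apply: H2; left; rewrite mem_enum.
have cm : c = m by rewrite -EG; under eq_Rintegral do rewrite Gc; rewrite Ex_cst.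
rewrite (_ : (fun w => G (coefs Z w) ^+ 2) = fun=> m ^+ 2); last first.
  by apply/funext => w; rewrite Gc cm.
rewrite Ex_cst => H; apply: le_trans H.
have bFc := bc bF.
rewrite (_ : (fun w => (_ - m) ^+ 2) = fun w => F (coefs Z w) ^+ 2
  - (2 * m) * F (coefs Z w) + m ^+ 2); last by apply/funext => w; ring.
have b2 := bmfX 2 bFc; have b3 := bmfM (bmf_cst _ (2 * m)) bFc.
rewrite ExD ?ExB ?ExZ ?Ex_cst//; do ?[exact: bmfB|exact: bmf_cst].
by rewrite -/m le_eqVlt; apply/orP; left; apply/eqP; ring.
Qed.

End efron_stein.

(** * The smoothing kernel *)

Section calculus.
Context (R : realType).
Implicit Types f df F : R -> R.

Lemma is_derive_continuous f df : (forall x : R, is_derive x 1 f (df x)) ->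
  continuous f.
Proof.
move=> fdf x; apply: differentiable_continuous; apply/derivable1_diffP.
by have := fdf x => -[].
Qed.

Lemma is_derive_le f df (a b : R) : (forall x : R, is_derive x 1 f (df x)) ->
  (forall x, a <= x <= b -> 0 <= df x) -> a <= b -> f a <= f b.
Proof.
move=> fdf df0 ab.
have [|c cab] := @MVT_segment _ f df a b ab (fun x _ => fdf x).
  by apply: continuous_subspaceT; exact: is_derive_continuous fdf.
move=> E; rewrite -subr_ge0 E mulr_ge0 ?subr_ge0// df0//.
Qed.

Lemma is_derive_FTC2 f F (a b : R) : a <= b ->
  (forall x : R, is_derive x 1 F (f x)) -> continuous f ->
  (\int[lebesgue_measure]_(x in `[a, b]) (f x)%:E = (F b - F a)%:E)%E.
Proof.
rewrite le_eqVlt => /predU1P[<- _ _|ab Ff cf].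
  by rewrite set_itv1 integral_set1 subrr.
have dF : derivable_oo_LRcontinuous F a b.
  split; first by move=> x _; have := Ff x => -[].
  - exact/cvg_at_right_filter/(is_derive_continuous Ff).
  - exact/cvg_at_left_filter/(is_derive_continuous Ff).
rewrite (continuous_FTC2 ab (continuous_subspaceT cf) dF) ?EFinB//.
by move=> x _; rewrite derive1E; have := Ff x => /@derive_val.
Qed.

Lemma ge0_is_derive_FTC2y f F (a l : R) :
  (forall x, a <= x -> 0 <= f x) ->
  (forall x : R, is_derive x 1 F (f x)) -> continuous f ->
  F x @[x --> +oo] --> l ->
  (\int[lebesgue_measure]_(x in `[a, +oo[) (f x)%:E = (l - F a)%:E)%E.
Proof.
move=> f0 Ff cf Fl; have dF x : a < x -> derivable F x 1 by move=> _; have := Ff x => -[].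
have cF : F x @[x --> a^'+] --> F a.
  exact/cvg_at_right_filter/(is_derive_continuous Ff).
rewrite (ge0_continuous_FTC2y f0 (continuous_subspaceT cf) Fl dF cF) ?EFinB//.
by move=> x _; rewrite derive1E; have := Ff x => /@derive_val.
Qed.

(** Polynomials times a decaying exponential are stable under differentiation and integration, so
    every kernel integral below becomes arithmetic on coefficients. *)
Definition pexp (c : R) (A : {poly R}) (x : R) : R := A.[x] * expR (- (c * x)).

Lemma is_derive_pexp c A (x : R) :
  is_derive x 1 (pexp c A) (pexp c (A^`() - c *: A) x).
Proof.
have H2 : is_derive x 1 (fun y : R => expR (- (c * y))) (- c * expR (- (c * x))).
  apply: trigger_derive.
  by rewrite /GRing.scale /=; ring.
apply: is_derive_eq; rewrite /pexp /GRing.scale /= hornerD hornerN hornerZ; ring.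
Qed.

Lemma continuous_pexp c A : continuous (pexp c A).
Proof. exact: is_derive_continuous (is_derive_pexp c A). Qed.

Lemma cvg_Xn_expRN c k : 0 < c ->
  x ^+ k * expR (- (c * x)) @[x --> +oo] --> (0 : R).
Proof.
(* From e^(c x) >= (c x)^(k+1) / (k+1)!, the function is at most K / x. *)
move=> c0; pose K := (k.+1)`!%:R / c ^+ k.+1.
apply: (@squeeze_cvgr _ _ _ _ (cst 0) (fun x : R => K * x^-1)).
- near=> x; have x0 : 0 < x by near: x; exact: nbhs_pinfty_gt.
  rewrite mulr_ge0 ?exprn_ge0 ?expR_ge0 ?(ltW x0)//=.
  have H := expR_ge1Dxn k (ltW (mulr_gt0 c0 x0)).
  have E : (c * x) ^+ k.+1 / k.+1`!%:R <= expR (c * x) by lra.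
  rewrite expRN ler_pdivrMr ?expR_gt0//.
  apply: le_trans (ler_wpM2l _ E); last first.
    by rewrite mulr_ge0 ?invr_ge0 ?(ltW x0)// divr_ge0 ?exprn_ge0 ?(ltW c0).
  rewrite /K exprMn (exprS x) le_eqVlt; apply/orP; left; apply/eqP.
  have : (k.+1)`!%:R != 0 :> R by rewrite pnatr_eq0 -lt0n fact_gt0.
  have : c ^+ k.+1 != 0 by rewrite gt_eqF ?exprn_gt0.
  move: (c ^+ k.+1) (k.+1)`!%:R => C F C0 F0.
  by field; rewrite C0 F0 gt_eqF.
- exact: cvg_cst.
- rewrite -[X in _ --> X](mulr0 K); apply: cvgM; first exact: cvg_cst.
  by apply/(gtr0_cvgV0 (f := @id R)); [exact: nbhs_pinfty_gt|exact: cvg_id].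
Unshelve. all: by end_near. Qed.

Lemma cvg_pexp c A : 0 < c -> pexp c A x @[x --> +oo] --> (0 : R).
Proof.
move=> c0; rewrite (_ : pexp c A =
    fun x => \sum_(i < size A) A`_i * (x ^+ i * expR (- (c * x)))); last first.
  apply/funext => x; rewrite /pexp horner_coef mulr_suml.
  by apply: eq_bigr => i _; rewrite mulrA.
elim: (size A) => [|n IH].
  rewrite (_ : (fun x => _) = cst (0 : R)); first exact: cvg_cst.
  by apply/funext => x; rewrite big_ord0.
rewrite (_ : (fun x => _) = (fun x => \sum_(i < n) A`_i * (x ^+ i * expR (- (c * x))))
    + (fun x => A`_n * (x ^+ n * expR (- (c * x))))); last first.
  by apply/funext => x; rewrite big_ord_recr.
rewrite -[X in _ --> X]addr0; apply: cvgD; first exact: IH.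
by rewrite -[X in _ --> X](mulr0 A`_n); apply: cvgM; [exact: cvg_cst|exact: cvg_Xn_expRN].
Qed.

(** Repeated integration by parts: B is minus the sum of c^(-i-1) times the i-th derivative of A, a
    finite series inverting the operator d/dx - c. The value -B(0) is then the integral over the
    half-line. *)
Lemma pexp_antiderivative c A : 0 < c -> exists B : {poly R},
  B^`() - c *: B = A /\
  (- B.[0]) = \sum_(i < size A) A`_i * i`!%:R / c ^+ i.+1.
Proof.
move=> c0; pose B := - \sum_(i < size A) c ^- i.+1 *: A^`(i).
exists B; split.
  rewrite /B derivN raddf_sum scalerN opprK /= scaler_sumr addrC -sumrB.
  pose D i := c ^- i *: A^`(i).
  rewrite (eq_bigr (fun i : 'I_(size A) => - (D i.+1 - D i))); last first.
    move=> i _; rewrite opprB /D derivZ -derivnS scalerA; congr (_ *: _ - _).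
    by rewrite exprS invfM mulrA divff ?mul1r// gt_eqF.
  rewrite sumrN -(big_mkord xpredT (fun i => D i.+1 - D i)) telescope_sumr//.
  rewrite /D derivn_poly0// scaler0 sub0r opprK expr0 invr1 scale1r.
  by rewrite derivn0.
rewrite /B hornerN opprK horner_sum; apply: eq_bigr => i _.
rewrite hornerZ horner_coef0 coef_derivn addn0 ffactnn -[A`_i *+ _]mulr_natr.
by rewrite mulrC.
Qed.

Lemma integral_pexp c A : 0 < c -> (forall x, 0 <= x -> 0 <= A.[x]) ->
  (\int[lebesgue_measure]_(x in `[0%R, +oo[) (pexp c A x)%:E =
   (\sum_(i < size A) A`_i * i`!%:R / c ^+ i.+1)%:E)%E.
Proof.
move=> c0 A0; have [B [dB B0]] := pexp_antiderivative A c0.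
have F' (x : R) : is_derive x 1 (pexp c B) (pexp c A x).
  by rewrite -dB; exact: is_derive_pexp.
rewrite (ge0_is_derive_FTC2y _ F' (continuous_pexp (c:=c) (A:=A)) (cvg_pexp B c0)); last first.
  by move=> x x0; rewrite mulr_ge0 ?expR_ge0 ?A0.
by rewrite sub0r /pexp mulr0 oppr0 expR0 mulr1 B0.
Qed.

(** The sum runs over the given list and not up to the size of the polynomial, so that it unfolds by
    computation when the entries contain parameters. *)
Lemma integral_pexp_seq c (s : seq R) : 0 < c ->
  (forall x, 0 <= x -> 0 <= (Poly s).[x]) ->
  (\int[lebesgue_measure]_(x in `[0%R, +oo[) (pexp c (Poly s) x)%:E =
   (\sum_(0 <= i < size s) s`_i * i`!%:R / c ^+ i.+1)%:E)%E.
Proof.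
move=> c0 s0; rewrite integral_pexp//; congr EFin.
rewrite -(big_mkord xpredT (fun i => (Poly s)`_i * i`!%:R / c ^+ i.+1)).
rewrite [RHS](big_cat_nat _ (size_Poly s))//=.
rewrite [X in _ + X]big_nat_cond [X in _ + X]big1 ?addr0; last first.
  move=> i /andP[/andP[le_i _] _].
  by rewrite -coef_Poly nth_default// !mul0r.
by apply: eq_bigr => i _; rewrite coef_Poly.
Qed.

(* The quadratic form [X - 2 l Y + l^2 Z] is nonnegative because it is the
   increment of a function with derivative [h - 2 l f + l^2 k >= 0]. *)
Lemma increment_cauchy_schwarz f F (h H k K : R -> R) (a b : R) :
  (forall x : R, is_derive x 1 F (f x)) ->
  (forall x : R, is_derive x 1 H (h x)) ->
  (forall x : R, is_derive x 1 K (k x)) ->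
  (forall x, 0 <= h x) -> (forall x, 0 <= k x) ->
  (forall x, f x ^+ 2 <= h x * k x) -> a <= b ->
  (F b - F a) ^+ 2 <= (H b - H a) * (K b - K a).
Proof.
move=> dF dH dK h0 k0 fhk ab.
set X := H b - H a; set Y := F b - F a; set V := K b - K a.
have X0 : 0 <= X by rewrite subr_ge0; apply: (is_derive_le dH).
have V0 : 0 <= V by rewrite subr_ge0; apply: (is_derive_le dK).
have Q l : 0 <= X - 2 * l * Y + l ^+ 2 * V.
  have dL (x : R) : is_derive x 1 (fun x => H x - 2 * l * F x + l ^+ 2 * K x)
      (h x - 2 * l * f x + l ^+ 2 * k x).
    have dFx := dF x; have dHx := dH x; have dKx := dK x.
    apply: trigger_derive.
    by rewrite /GRing.scale /=; ring.
  have := is_derive_le dL _ ab; rewrite /X /Y /V.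
  suff H0 x : 0 <= h x - 2 * l * f x + l ^+ 2 * k x.
    by move=> /(_ (fun x _ => H0 x)); lra.
  have := fhk x; have := h0 x; have := k0 x.
  move: (h x) (f x) (k x) => p q r r0 p0 pr.
  have [r00|rN0] := eqVneq r 0.
    move: pr; rewrite r00 mulr0 => pr.
    have /eqP : q ^+ 2 == 0 by rewrite eq_le pr sqr_ge0.
    by move=> /eqP; rewrite sqrf_eq0 => /eqP ->; lra.
  have rp : 0 < r by rewrite lt_neqAle eq_sym rN0.
  rewrite -(pmulr_rge0 _ rp).
  rewrite (_ : r * _ = (l * r - q) ^+ 2 + (p * r - q ^+ 2)); last by ring.
  by rewrite addr_ge0 ?sqr_ge0// subr_ge0.
have [V0'|VN0] := eqVneq V 0.
  have Y0 : Y = 0.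
    apply/eqP; apply/negPn/negP => Y0.
    (* When V = 0 the form is affine in l, and this value of l makes it equal to -1. *)
    have := Q ((X + 1) / (2 * Y)).
    rewrite V0' mulr0 addr0 (_ : 2 * _ * Y = X + 1); last by field.
    by lra.
  by rewrite Y0 expr0n mulr_ge0.
have Vp : 0 < V by rewrite lt_neqAle eq_sym VN0.
have := Q (Y / V).
rewrite -(pmulr_rge0 _ Vp) (_ : V * _ = X * V - Y ^+ 2); last by field.
by rewrite subr_ge0.
Qed.

End calculus.

(** * Increments of the kernel and of its derivative *)

Section kernel.
Context (R : realType).
Implicit Types (u v r s y xi : R) (A : {poly R}).
Local Notation mu := (@lebesgue_measure R).
Local Notation pos x := (Num.max x 0).

(** [k1] and [k2] are the first two derivatives of [k0]. Since [k0] and [k1] vanish at 0, composing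
    them with the positive part extends them by zero, and [dker] is a continuous derivative of
    [ker]; the second derivative jumps from 0 to 1 at the origin. *)
Definition k0 : R -> R := pexp 1 (2^-1 *: 'X^2).
Definition k1 : R -> R := pexp 1 ('X - 2^-1 *: 'X^2).
Definition k2 : R -> R := pexp 1 (1 - 2 *: 'X + 2^-1 *: 'X^2).

Definition ker u := k0 (pos u).
Definition dker u := k1 (pos u).

(** Ascending coefficients of (r - r^2 / 2)^2 and, below, of (1 - 2 r + r^2 / 2)^2: the polynomial
    factors of the squares of [k1] and [k2]. *)
Definition sqk1 : {poly R} := Poly [:: 0; 0; 1; -1; 4^-1].
Definition sqk2 : {poly R} := Poly [:: 1; -4; 5; -2; 4^-1].

(** The L2 energy of a derivative of the kernel between [u] and [v], cut to the half-line where the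
    kernel lives. The minimum and maximum make it symmetric, so increments of either sign are
    covered. *)
Definition itv_energy A u v : \bar R :=
  (\int[mu]_(r in `[0%R, +oo[)
    (if Num.min u v <= r <= Num.max u v then pexp 2 A r else 0)%:E)%E.

Lemma is_derive_k0 r : is_derive r 1 k0 (k1 r).
Proof.
have -> : k1 r = pexp 1 ((2^-1 *: 'X^2)^`() - 1 *: (2^-1 *: 'X^2)) r.
  congr (pexp _ _ _); rewrite derivZ derivXn scale1r expr1 /= -['X *+ 2]scaler_nat scalerA.
  by rewrite mulVf ?scale1r ?pnatr_eq0.
exact: is_derive_pexp.
Qed.

Lemma is_derive_k1 r : is_derive r 1 k1 (k2 r).
Proof.
have -> : k2 r = pexp 1 (('X - 2^-1 *: 'X^2)^`() - 1 *: ('X - 2^-1 *: 'X^2)) r.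
  congr (pexp _ _ _); rewrite derivB derivX derivZ derivXn scale1r expr1 /=.
  rewrite -['X *+ 2]scaler_nat [_ *: (_ *: 'X)]scalerA mulVf ?pnatr_eq0// scale1r.
  by rewrite scaler_nat mulr2n; ring.
exact: is_derive_pexp.
Qed.

Lemma k0E r : k0 r = r ^+ 2 / 2 * expR (- r).
Proof. by rewrite /k0 /pexp mul1r hornerZ hornerXn; ring. Qed.

Lemma k1E r : k1 r = (r - r ^+ 2 / 2) * expR (- r).
Proof. by rewrite /k1 /pexp mul1r hornerD hornerN hornerZ hornerX hornerXn; ring. Qed.

Lemma k2E r : k2 r = (1 - 2 * r + r ^+ 2 / 2) * expR (- r).
Proof.
by rewrite /k2 /pexp mul1r !hornerD hornerN !hornerZ hornerX hornerXn hornerC; ring.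
Qed.

Let expRN2 r : expR (- (2 * r)) = expR (- r) ^+ 2.
Proof. by rewrite -mulrN expRM_natl. Qed.

Lemma k1_sqr r : k1 r ^+ 2 = pexp 2 sqk1 r.
Proof. by rewrite k1E /pexp /sqk1 horner_Poly /= expRN2; field. Qed.

Lemma k2_sqr r : k2 r ^+ 2 = pexp 2 sqk2 r.
Proof. by rewrite k2E /pexp /sqk2 horner_Poly /= expRN2; field. Qed.

Lemma measurable_pexp (c : R) A : measurable_fun setT (pexp c A).
Proof. by apply: continuous_measurable_fun; exact: continuous_pexp. Qed.

(** Cauchy-Schwarz on the segment from [pos a] to [pos b]. The second factor is left as a free
    primitive [K]: the identity for plain increments, a cubic for the Taylor remainder. *)
Lemma itv_energy_ge A (F f K k : R -> R) (a b : R) :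
  (forall x : R, is_derive x 1 F (f x)) ->
  (forall x : R, is_derive x 1 K (k x)) ->
  (forall x, 0 <= pexp 2 A x) -> (forall x, 0 <= k x) ->
  (forall x, f x ^+ 2 <= pexp 2 A x * k x) -> a <= b ->
  (((F (pos b) - F (pos a)) ^+ 2)%:E <=
    (K (pos b) - K (pos a))%:E * itv_energy A a b)%E.
Proof.
move=> dF dK A0 k_ge0 fAk ab.
have pab : pos a <= pos b by case: (leP a 0); case: (leP b 0) => ? ?; lra.
have [B [dB _]] := pexp_antiderivative A (ltr0n R 2).
have dH (x : R) : is_derive x 1 (pexp 2 B) (pexp 2 A x).
  by rewrite -dB; exact: is_derive_pexp.
have H := increment_cauchy_schwarz dF dH dK A0 k_ge0 fAk pab.
apply: (@le_trans _ _ ((K (pos b) - K (pos a)) * (pexp 2 B (pos b) - pexp 2 B (pos a)))%:E).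
  by rewrite lee_fin mulrC.
rewrite EFinM; apply: lee_wpmul2l.
  by rewrite lee_fin subr_ge0; apply: (is_derive_le dK).
(* For b < 0 both positive parts are 0 and the increments vanish; otherwise the segment is the
   nonnegative part of [a, b]. *)
have [b0|] := boolP (b < 0); last rewrite -leNgt => b0.
  rewrite (_ : pos b = pos a) ?subrr; last by case: (leP a 0); case: (leP b 0) => ? ?; lra.
  by apply: integral_ge0 => x _; rewrite lee_fin; case: ifP.
rewrite -(is_derive_FTC2 pab dH); last exact: continuous_pexp.
rewrite /itv_energy (min_idPl ab) (max_idPr ab).
have -> : (\int[mu]_(x in `[pos a, pos b]) (pexp 2 A x)%:E =
    \int[mu]_(x in `[pos a, pos b]) (if a <= x <= b then pexp 2 A x else 0)%:E)%E.
  apply: eq_integral => x; rewrite inE /= in_itv /= ge_max le_max.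
  move=> /andP[/andP[ax x0] xb].
  by rewrite ax /=; have -> : x <= b by case/orP: xb => // ?; lra.
apply: ge0_subset_integral => //=.
- apply/measurable_EFinP; apply: measurable_funTS.
  apply: measurable_fun_ifT => //; last exact: measurable_pexp.
  by apply: measurable_and; apply: measurable_fun_ler.
- by move=> x _; rewrite lee_fin; case: ifP.
- move=> x /=; rewrite !in_itv /= andbT => /andP[+ _].
  by apply: le_trans; rewrite le_max lexx orbT.
Qed.

Let energy_swap A u v : itv_energy A u v = itv_energy A v u.
Proof. by rewrite /itv_energy minC maxC. Qed.

Let posdker u : pos u * dker u = u * dker u.
Proof.
rewrite /dker; case: (leP u 0) => // u0.
have -> : k1 0 = 0 by rewrite k1E expr0n /= mul0r subr0 mul0r.
by rewrite !mulr0.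
Qed.

Let sqk1_ge0 x : 0 <= pexp 2 sqk1 x. Proof. by rewrite -k1_sqr sqr_ge0. Qed.
Let sqk2_ge0 x : 0 <= pexp 2 sqk2 x. Proof. by rewrite -k2_sqr sqr_ge0. Qed.

Let itv_energy_ge0 A u v : (forall x, 0 <= pexp 2 A x) -> (0 <= itv_energy A u v)%E.
Proof. by move=> A0; apply: integral_ge0 => x _; rewrite lee_fin; case: ifP. Qed.

Let pos_le (a b : R) : a <= b -> pos b - pos a <= b - a.
Proof. by case: (leP a 0); case: (leP b 0) => ? ? ?; lra. Qed.

Lemma ker_diff u v :
  (((ker v - ker u) ^+ 2)%:E <= `|v - u|%:E * itv_energy sqk1 u v)%E.
Proof.
wlog uv : u v / u <= v.
  move=> H; have [|/ltW vu] := leP u v; first exact: H.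
  by rewrite energy_swap distrC -sqrrN opprB; exact: H.
have H := itv_energy_ge (K := id) (k := cst 1) is_derive_k0
  (fun x => is_derive_id x 1) sqk1_ge0 (fun=> ler01)
  (fun x => _ : _ <= _) uv.
apply: le_trans (H _) _ => [x|]; first by rewrite /= mulr1 k1_sqr.
rewrite lee_wpmul2r ?itv_energy_ge0// lee_fin ger0_norm ?subr_ge0//.
exact: pos_le.
Qed.

Lemma dker_diff u v :
  (((dker v - dker u) ^+ 2)%:E <= `|v - u|%:E * itv_energy sqk2 u v)%E.
Proof.
wlog uv : u v / u <= v.
  move=> H; have [|/ltW vu] := leP u v; first exact: H.
  by rewrite energy_swap distrC -sqrrN opprB; exact: H.
have H := itv_energy_ge (K := id) (k := cst 1) is_derive_k1
  (fun x => is_derive_id x 1) sqk2_ge0 (fun=> ler01)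
  (fun x => _ : _ <= _) uv.
apply: le_trans (H _) _ => [x|]; first by rewrite /= mulr1 k2_sqr.
rewrite lee_wpmul2r ?itv_energy_ge0// lee_fin ger0_norm ?subr_ge0//.
exact: pos_le.
Qed.

(** The remainder is the integral of (v - r) G''(r) from u to v; Cauchy-Schwarz separates G'' from
    (v - r), whose square integrates to |v - u|^3 / 3. *)
Lemma ker_taylor u v :
  (((ker v - ker u - (v - u) * dker u) ^+ 2)%:E <=
   (`|v - u| ^+ 3 / 3)%:E * itv_energy sqk2 u v)%E.
Proof.
(* A primitive of (r - c) [k2] r; for c = v its increment from u to v is minus the Taylor
   remainder. *)
pose M (c r : R) := (r - c) * k1 r - k0 r.
have dM c r : is_derive r 1 (M c) ((r - c) * k2 r).
  have h0 := is_derive_k0 r; have h1 := is_derive_k1 r.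
  apply: trigger_derive; rewrite /GRing.scale /=; ring.
pose K (c r : R) := (r - c) ^+ 3 / 3.
have dK c r : is_derive r 1 (K c) ((r - c) ^+ 2).
  by apply: trigger_derive; rewrite /GRing.scale /=; field.
(* Replacing the end points by their positive parts only shortens the segment. *)
have Kle (a b c : R) : a <= b -> c = a \/ c = b ->
    K c (pos b) - K c (pos a) <= (b - a) ^+ 3 / 3.
  move=> ab; rewrite /K => -[->|->]; case: (leP a 0); case: (leP b 0) => b0 a0.
  - by rewrite subrr divr_ge0 ?exprn_ge0 ?subr_ge0.
  - rewrite lerBlDr lerDl divr_ge0 ?exprn_ge0 ?subr_ge0//.
  - lra.
  - by rewrite subrr expr0n /= mul0r subr0.
  - by rewrite subrr divr_ge0 ?exprn_ge0 ?subr_ge0.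
  - rewrite subrr expr0n /= mul0r sub0r -mulNr ler_pM2r ?invr_gt0//.
    rewrite (_ : - (0 - b) ^+ 3 = b ^+ 3); last by ring.
    by rewrite lerXn2r ?nnegrE; lra.
  - lra.
  - by rewrite subrr expr0n /= mul0r sub0r -mulNr (_ : - (a - b) ^+ 3 = (b - a) ^+ 3)//; ring.
have [uv|/ltW vu] := leP u v.
- have H := itv_energy_ge (dM v) (dK v) sqk2_ge0 (fun=> sqr_ge0 _)
    (fun x => _ : _ <= _) uv.
  apply: le_trans (le_trans (H _) _) => [|x|].
  + rewrite lee_fin le_eqVlt; apply/orP; left; apply/eqP; rewrite /M -/(ker u) -/(ker v) -/(dker u) -/(dker v).
    rewrite !mulrBl !posdker; ring.
  + by rewrite exprMn mulrC k2_sqr.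
  + rewrite lee_wpmul2r ?itv_energy_ge0// lee_fin ger0_norm ?subr_ge0//.
    by apply: Kle => //; right.
- have H := itv_energy_ge (dM v) (dK v) sqk2_ge0 (fun=> sqr_ge0 _)
    (fun x => _ : _ <= _) vu.
  apply: le_trans (le_trans (H _) _) => [|x|].
  + rewrite lee_fin le_eqVlt; apply/orP; left; apply/eqP; rewrite /M -/(ker u) -/(ker v) -/(dker u) -/(dker v).
    rewrite !mulrBl !posdker; ring.
  + by rewrite exprMn mulrC k2_sqr.
  + rewrite energy_swap lee_wpmul2r ?itv_energy_ge0// lee_fin distrC ger0_norm ?subr_ge0//.
    by apply: Kle => //; left.
Qed.

End kernel.

(** * The weight and exact weighted energies *)

Section weights.
Context (R : realType).
Implicit Types (u v r s y xi : R) (A : {poly R}).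
Local Notation mu := (@lebesgue_measure R).

(** The centre 1/2 is the centroid of the density [k2 ^+ 2] on the half-line, which removes the term
    linear in y from its weighted integral when [xi] is 0. *)
Definition weight s : R := 1 + (s - 2^-1) ^+ 2.

Lemma weight_gt0 s : 0 < weight s.
Proof. by rewrite /weight ltr_wpDr// sqr_ge0. Qed.

Lemma continuous_weight : continuous weight.
Proof.
apply: (@is_derive_continuous _ _ (fun s => 2 * (s - 2^-1))) => s.
by apply: trigger_derive; rewrite /GRing.scale /=; ring.
Qed.

Lemma measurable_weight : measurable_fun setT weight.
Proof. by apply: continuous_measurable_fun; exact: continuous_weight. Qed.

Lemma continuous_ker : continuous (@ker R).
Proof.
suff : continuous (@k0 R \o (fun x : R => Num.max x 0)) by [].
move=> x; apply: continuous_comp.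
  by apply: continuous_max; [exact: cvg_id|exact: cvg_cst].
exact: continuous_pexp.
Qed.

Lemma continuous_dker : continuous (@dker R).
Proof.
suff : continuous (@k1 R \o (fun x : R => Num.max x 0)) by [].
move=> x; apply: continuous_comp.
  by apply: continuous_max; [exact: cvg_id|exact: cvg_cst].
exact: continuous_pexp.
Qed.

Lemma integral_halfline (f : R -> R) :
  (\int[mu]_(r in `[0%R, +oo[) (f r)%:E =
   \int[mu]_r (if 0 <= r then f r else 0)%:E)%E.
Proof.
rewrite integral_mkcond; apply: eq_integral => r _; rewrite patchE.
by rewrite mem_setE in_itv /= andbT; case: ifP.
Qed.

Lemma integral_weight_itv (c e : R) : c <= e ->
  (\int[mu]_s (if c <= s <= e then weight s else 0)%:E =
   ((e - c) * (1 + ((c - 2^-1) ^+ 2 + (c - 2^-1) * (e - c) + (e - c) ^+ 2 / 3)))%:E)%E.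
Proof.
move=> ce; transitivity (\int[mu]_(s in `[c, e]) (weight s)%:E)%E.
  rewrite [RHS]integral_mkcond; apply: eq_integral => s _; rewrite patchE.
  by rewrite mem_setE in_itv /=; case: ifP.
pose W s : R := s + (s - 2^-1) ^+ 3 / 3.
have dW s : is_derive s 1 W (weight s).
  by apply: trigger_derive; rewrite /GRing.scale /= /weight; field.
rewrite (is_derive_FTC2 ce dW continuous_weight); congr EFin.
by rewrite /W; field.
Qed.

(* The mean of [weight (y + r + t * xi)] for [t] uniform on [0, 1]. *)
Definition quad y xi r : R :=
  1 + ((y + r - 2^-1) ^+ 2 + (y + r - 2^-1) * xi + xi ^+ 2 / 3).

Lemma quad_ge0 y xi r : 0 <= quad y xi r.
Proof.
rewrite /quad (_ : 1 + _ = 1 + (y + r - 2^-1 + xi / 2) ^+ 2 + xi ^+ 2 / 12); last by field.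
by rewrite !addr_ge0// ?sqr_ge0// divr_ge0 ?sqr_ge0.
Qed.

(** Tonelli: for fixed r >= 0, the points s such that r lies between s - y and s - y - xi form the
    interval between y + r and y + r + xi, of length |xi|, on which the mean weight is
    [quad y xi r]. *)
Lemma integral_weight_energy A y xi : (forall r, 0 <= pexp 2 A r) ->
  (\int[mu]_s ((weight s)%:E * itv_energy A (s - y) (s - y - xi)) =
   `|xi|%:E * \int[mu]_(r in `[0%R, +oo[) (pexp 2 A r * quad y xi r)%:E)%E.
Proof.
move=> A0.
pose c r := Num.min (y + r) (y + r + xi); pose e r := Num.max (y + r) (y + r + xi).
pose f (p : R * R) : R := if (0 <= p.2) && (c p.2 <= p.1 <= e p.2)
  then weight p.1 * pexp 2 A p.2 else 0.
have mc : measurable_fun setT c.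
  by apply: measurable_minr; do ?apply: measurable_funD.
have me : measurable_fun setT e.
  by apply: measurable_maxr; do ?apply: measurable_funD.
have mf : measurable_fun setT f.
  apply: measurable_fun_ifT => //.
    apply: measurable_and; first exact: measurable_fun_ler.
    apply: measurable_and; apply: measurable_fun_ler => //.
      exact: (measurableT_comp mc).
    exact: (measurableT_comp me).
  apply: measurable_funM.
    exact: (measurableT_comp measurable_weight).
  exact: (measurableT_comp (@measurable_pexp R 2 A)).
have f0 p : 0 <= f p.
  by rewrite /f; case: ifP => // _; rewrite mulr_ge0 ?(ltW (weight_gt0 _)).
transitivity (\int[mu]_s \int[mu]_r (f (s, r))%:E)%E.
  apply: eq_integral => s _; rewrite /itv_energy integral_halfline.
  rewrite -ge0_integralZl//.
  - apply: eq_integral => r _; rewrite /f /= -EFinM; congr EFin.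
    have -> : (Num.min (s - y) (s - y - xi) <= r <= Num.max (s - y) (s - y - xi)) =
        (c r <= s <= e r).
      rewrite /c /e; have [xi0|/ltW xi0] := leP 0 xi.
        have h1 : s - y - xi <= s - y by lra.
        have h2 : y + r <= y + r + xi by lra.
        rewrite (min_idPr h1) (max_idPl h1) (min_idPl h2) (max_idPr h2).
        by apply/idP/idP => /andP[? ?]; apply/andP; split; lra.
      have h1 : s - y <= s - y - xi by lra.
      have h2 : y + r + xi <= y + r by lra.
      rewrite (min_idPl h1) (max_idPr h1) (min_idPr h2) (max_idPl h2).
      by apply/idP/idP => /andP[? ?]; apply/andP; split; lra.
    by case: (0 <= r) => /=; rewrite ?mulr0//; case: (c r <= s <= e r); rewrite ?mulr0.
  - apply/measurable_EFinP; apply: measurable_fun_ifT => //.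
      exact: measurable_fun_ler.
    apply: measurable_fun_ifT => //; last exact: measurable_pexp.
    by apply: measurable_and; exact: measurable_fun_ler.
  - by move=> r _; rewrite lee_fin; case: (0 <= r) => //; case: ifP.
  - by rewrite lee_fin ltW// weight_gt0.
rewrite (fubini_tonelli (m1 := mu) (m2 := mu) (EFin \o f)) => [| |p]; last 2 first.
- exact/measurable_EFinP.
- by rewrite lee_fin.
rewrite integral_halfline -ge0_integralZl//; last 2 first.
- apply/measurable_EFinP; apply: measurable_fun_ifT => //.
    exact: measurable_fun_ler.
  apply: measurable_funM; first exact: measurable_pexp.
  apply: continuous_measurable_fun.
  apply: (@is_derive_continuous _ _ (fun r => 2 * (y + r - 2^-1) + xi)) => r.
  by apply: trigger_derive; rewrite /GRing.scale /=; ring.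
- by move=> r _; rewrite lee_fin; case: ifP => // _; rewrite mulr_ge0 ?quad_ge0.
apply: eq_integral => r _ /=.
have [r0|r0] := boolP (0 <= r); last first.
  rewrite mule0 integral0_eq// => s _.
  by rewrite /f /= (negbTE r0).
have ce : c r <= e r by rewrite /c /e ge_min !le_max lexx.
transitivity (\int[mu]_s ((pexp 2 A r)%:E * (if c r <= s <= e r then weight s else 0)%:E))%E.
  apply: eq_integral => s _; rewrite /f /= r0 /= -EFinM; congr EFin.
  by case: ifP; rewrite ?mulr0// mulrC.
rewrite ge0_integralZl//.
- rewrite integral_weight_itv// -!EFinM; congr EFin.
  rewrite /quad /c /e; have [xi0|/ltW xi0] := leP 0 xi.
    have h : y + r <= y + r + xi by lra.
    rewrite (min_idPl h) (max_idPr h) ger0_norm//.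
    have -> : y + r + xi - (y + r) = xi by ring.
    by rewrite mulrCA.
  have h : y + r + xi <= y + r by lra.
  rewrite (min_idPr h) (max_idPl h) ler0_norm//.
  have -> : y + r - (y + r + xi) = - xi by ring.
  by field.
- apply/measurable_EFinP; apply: measurable_fun_ifT => //; last exact: measurable_weight.
  by apply: measurable_and; exact: measurable_fun_ler.
- by move=> s _; rewrite lee_fin; case: ifP => // _; rewrite ltW ?weight_gt0.
- by rewrite lee_fin.
Qed.

Lemma integral_sqk1_quad y xi :
  (\int[mu]_(r in `[0%R, +oo[) (pexp 2 (sqk1 R) r * quad y xi r)%:E =
   ((1 + y ^+ 2 + y * xi + xi ^+ 2 / 3 + 2 * y + xi) / 16 + 13 / 64)%:E)%E.
Proof.
(* As a polynomial in r, [quad y xi r] is al + be r + r^2; [S] lists the coefficients of its product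
   with [sqk1]. *)
pose al := 1 + (y - 2^-1) ^+ 2 + (y - 2^-1) * xi + xi ^+ 2 / 3.
pose be := 2 * (y - 2^-1) + xi.
pose S : seq R := [:: 0; 0; al; be - al; 1 - be + al / 4; - 1 + be / 4; 4^-1].
have E r : pexp 2 (sqk1 R) r * quad y xi r = pexp 2 (Poly S) r.
  rewrite /pexp /sqk1 /S !horner_Poly /= /quad /al /be; by field.
transitivity (\int[mu]_(r in `[0%R, +oo[) (pexp 2 (Poly S) r)%:E)%E.
  by apply: eq_integral => r _; rewrite E.
rewrite integral_pexp_seq//; last first.
  move=> r _; rewrite -(pmulr_lge0 _ (expR_gt0 (- (2 * r)))) -/(pexp 2 (Poly S) r) -E.
  by rewrite mulr_ge0 ?quad_ge0// -k1_sqr sqr_ge0.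
congr EFin; rewrite /S /al /be; do !rewrite big_nat_recl//=; rewrite big_geq//.
by rewrite !factS fact0; field.
Qed.

Lemma integral_sqk2_quad y xi :
  (\int[mu]_(r in `[0%R, +oo[) (pexp 2 (sqk2 R) r * quad y xi r)%:E =
   (3 * (1 + y ^+ 2 + y * xi + xi ^+ 2 / 3) / 16 + 7 / 64)%:E)%E.
Proof.
pose al := 1 + (y - 2^-1) ^+ 2 + (y - 2^-1) * xi + xi ^+ 2 / 3.
pose be := 2 * (y - 2^-1) + xi.
pose S : seq R := [:: al; be - 4 * al; 1 - 4 * be + 5 * al;
  - 4 + 5 * be - 2 * al; 5 - 2 * be + al / 4; - 2 + be / 4; 4^-1].
have E r : pexp 2 (sqk2 R) r * quad y xi r = pexp 2 (Poly S) r.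
  rewrite /pexp /sqk2 /S !horner_Poly /= /quad /al /be; by field.
transitivity (\int[mu]_(r in `[0%R, +oo[) (pexp 2 (Poly S) r)%:E)%E.
  by apply: eq_integral => r _; rewrite E.
rewrite integral_pexp_seq//; last first.
  move=> r _; rewrite -(pmulr_lge0 _ (expR_gt0 (- (2 * r)))) -/(pexp 2 (Poly S) r) -E.
  by rewrite mulr_ge0 ?quad_ge0// -k2_sqr sqr_ge0.
congr EFin; rewrite /S /al /be; do !rewrite big_nat_recl//=; rewrite big_geq//.
by rewrite !factS fact0; field.
Qed.

End weights.

Section weighted_bounds.
Context (R : realType).
Implicit Types (u v r s y xi : R).
Local Notation mu := (@lebesgue_measure R).

Let measurable_comp (h : R -> R) c : continuous h ->
  measurable_fun setT (fun s => h (s - c)).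
Proof.
move=> ch; apply: (measurableT_comp (continuous_measurable_fun ch)).
exact: measurable_funB.
Qed.

Definition sqk1_mean y xi : R :=
  (1 + y ^+ 2 + y * xi + xi ^+ 2 / 3 + 2 * y + xi) / 16 + 13 / 64.

Definition sqk2_mean y xi : R :=
  3 * (1 + y ^+ 2 + y * xi + xi ^+ 2 / 3) / 16 + 7 / 64.

Let sqk1_ge0 r : 0 <= pexp 2 (sqk1 R) r. Proof. by rewrite -k1_sqr sqr_ge0. Qed.
Let sqk2_ge0 r : 0 <= pexp 2 (sqk2 R) r. Proof. by rewrite -k2_sqr sqr_ge0. Qed.

Lemma weighted_le_energy (A : {poly R}) (h : R -> R) (c y xi : R) :
  (forall r, 0 <= pexp 2 A r) -> measurable_fun setT h -> (forall s, 0 <= h s) ->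
  0 <= c ->
  (forall s, ((h s)%:E <= c%:E * itv_energy A (s - y) (s - y - xi))%E) ->
  (\int[mu]_s (weight s * h s)%:E <=
   (c * `|xi|)%:E * \int[mu]_(r in `[0%R, +oo[) (pexp 2 A r * quad y xi r)%:E)%E.
Proof.
move=> A0 mh h0 c0 H; rewrite EFinM -muleA -integral_weight_energy//.
have mE : measurable_fun setT (fun s => itv_energy A (s - y) (s - y - xi)).
  pose f (p : R * R) : R :=
    if 0 <= p.2 then (if Num.min (p.1 - y) (p.1 - y - xi) <= p.2 <=
      Num.max (p.1 - y) (p.1 - y - xi) then pexp 2 A p.2 else 0) else 0.
  have mf : measurable_fun setT f.
    apply: measurable_fun_ifT => //; first exact: measurable_fun_ler.
    apply: measurable_fun_ifT => //.
      apply: measurable_and; apply: measurable_fun_ler => //.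
        by apply: measurable_minr; do ?apply: measurable_funB.
      by apply: measurable_maxr; do ?apply: measurable_funB.
    exact: (measurableT_comp (@measurable_pexp R 2 A)).
  have := @measurable_fun_fubini_tonelli_F _ _ _ _ _ mu (EFin \o f).
  rewrite (_ : fubini_F _ _ = (fun s => itv_energy A (s - y) (s - y - xi))).
    apply; first exact/measurable_EFinP.
    by move=> p; rewrite lee_fin /f; case: (0 <= p.2) => //; case: ifP.
  by apply/funext => s; rewrite /fubini_F /= /itv_energy integral_halfline.
have E0 s : (0 <= itv_energy A (s - y) (s - y - xi))%E.
  by apply: integral_ge0 => r _; rewrite lee_fin; case: ifP.
rewrite -ge0_integralZl//; last 2 first.
- by apply: emeasurable_funM => //; apply/measurable_EFinP; exact: measurable_weight.
- by move=> s _; rewrite mule_ge0// lee_fin ltW// weight_gt0.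
apply: ge0_le_integral => //.
- by move=> s _; rewrite lee_fin mulr_ge0// ltW// weight_gt0.
- by apply/measurable_EFinP; apply: measurable_funM => //; exact: measurable_weight.
- apply: emeasurable_funM => //; apply: emeasurable_funM => //.
  by apply/measurable_EFinP; exact: measurable_weight.
- move=> s _; rewrite EFinM muleCA lee_wpmul2l//.
  by rewrite lee_fin ltW// weight_gt0.
Qed.

Lemma weighted_ker_diff y xi :
  (\int[mu]_s (weight s * (ker (s - y - xi) - ker (s - y)) ^+ 2)%:E <=
   (xi ^+ 2 * sqk1_mean y xi)%:E)%E.
Proof.
apply: le_trans (@weighted_le_energy (sqk1 R) _ `|xi| y xi _ _ _ _ _) _ => //.
- apply: measurable_funX; apply: measurable_funB; last exact: (measurable_comp _ (@continuous_ker R)).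
  under eq_fun do rewrite -addrA -opprD.
  exact: (measurable_comp _ (@continuous_ker R)).
- by move=> s; rewrite sqr_ge0.
- move=> s; apply: le_trans (ker_diff _ _) _.
  by rewrite (_ : _ - xi - _ = - xi) ?normrN//; ring.
- by rewrite integral_sqk1_quad -EFinM lee_fin -expr2 real_normK ?num_real.
Qed.

Lemma weighted_dker_diff y xi :
  (\int[mu]_s (weight s * (dker (s - y - xi) - dker (s - y)) ^+ 2)%:E <=
   (xi ^+ 2 * sqk2_mean y xi)%:E)%E.
Proof.
apply: le_trans (@weighted_le_energy (sqk2 R) _ `|xi| y xi _ _ _ _ _) _ => //.
- apply: measurable_funX; apply: measurable_funB; last exact: (measurable_comp _ (@continuous_dker R)).
  under eq_fun do rewrite -addrA -opprD.
  exact: (measurable_comp _ (@continuous_dker R)).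
- by move=> s; rewrite sqr_ge0.
- move=> s; apply: le_trans (dker_diff _ _) _.
  by rewrite (_ : _ - xi - _ = - xi) ?normrN//; ring.
- by rewrite integral_sqk2_quad -EFinM lee_fin -expr2 real_normK ?num_real.
Qed.

Lemma weighted_ker_taylor y xi :
  (\int[mu]_s (weight s *
     (ker (s - y - xi) - ker (s - y) + xi * dker (s - y)) ^+ 2)%:E <=
   (xi ^+ 4 / 3 * sqk2_mean y xi)%:E)%E.
Proof.
apply: le_trans (@weighted_le_energy (sqk2 R) _ (`|xi| ^+ 3 / 3) y xi _ _ _ _ _) _ => //.
- apply: measurable_funX; apply: measurable_funD; last first.
    by apply: measurable_funM => //; exact: (measurable_comp _ (@continuous_dker R)).
  apply: measurable_funB; last exact: (measurable_comp _ (@continuous_ker R)).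
  under eq_fun do rewrite -addrA -opprD.
  exact: (measurable_comp _ (@continuous_ker R)).
- by move=> s; rewrite sqr_ge0.
- move=> s; have := ker_taylor (s - y) (s - y - xi).
  rewrite (_ : _ - xi - _ = - xi); last by ring.
  by rewrite mulNr opprK normrN.
- rewrite integral_sqk2_quad -EFinM lee_fin [_ / 3 * `|xi|]mulrAC -exprSr.
  by rewrite (_ : `|xi| ^+ 4 = xi ^+ 4)// -[4%N]/(2 * 2)%N !exprM real_normK ?num_real.
Qed.

Lemma integral_translation (f : R -> R) (c : R) : continuous f ->
  (forall x, 0 <= f x) ->
  (\int[mu]_x (f x)%:E = \int[mu]_x (f (x + c))%:E)%E.
Proof.
move=> cf f0; pose F (x : R) := x + c.
have dF (x : R) : is_derive x 1 F 1.
  by apply: trigger_derive; rewrite addr0.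
have F' : derive1 F = cst 1.
  by apply/funext => x; rewrite derive1E; have := dF x => /@derive_val.
rewrite (@increasing_ge0_integration_by_substitutionT _ F)//.
- by apply: eq_integral => x _; rewrite F' /= mulr1.
- by move=> x y xy; rewrite /F ltrD2r.
- by rewrite F'; move=> x; exact: cvg_cst.
- by rewrite F'; exact: is_cvg_cst.
- by rewrite F'; exact: is_cvg_cst.
- exact: cvg_addrr_Ny.
- exact: cvg_addrr.
Qed.

Lemma weighted_dker y :
  (\int[mu]_s (weight s * (dker (s - y)) ^+ 2)%:E = (sqk1_mean y 0)%:E)%E.
Proof.
rewrite (@integral_translation _ y); last 2 first.
- move=> s; apply: (@continuousM _ _ _ (fun s => dker (s - y) ^+ 2)).
    exact: continuous_weight.
  apply: (@continuous_comp _ _ _ (fun s => dker (s - y)) (fun x => x ^+ 2)); last exact: exprn_continuous.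
  apply: (@continuous_comp _ _ _ (fun s => s - y) (@dker R)); last exact: continuous_dker.
  by apply: continuousB; [exact: cvg_id|exact: cvg_cst].
- by move=> s; rewrite mulr_ge0 ?sqr_ge0// ltW// weight_gt0.
rewrite -integral_sqk1_quad integral_halfline; apply: eq_integral => r _.
congr EFin; rewrite addrK /dker; case: (leP 0 r) => r0; last first.
  by rewrite k1E expr0n /= mul0r subrr mul0r expr0n mulr0.
by rewrite k1_sqr mulrC; congr (_ * _); rewrite /weight /quad; ring.
Qed.

(** The exact value is pi, each half-line around 1/2 contributing pi / 2 through the arctangent; the
    bound 4 keeps the later constants rational. *)
Lemma integral_inv_weight : (\int[mu]_s ((weight s)^-1)%:E <= 4%R%:E)%E.
Proof.
have cinv (c : R) : continuous (fun s : R => (1 + (s - c) ^+ 2)^-1).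
  move=> s; apply: (@continuousV _ _ (fun s : R => 1 + (s - c) ^+ 2)).
    by rewrite gt_eqF// ltr_wpDr// sqr_ge0.
  apply: (@is_derive_continuous _ _ (fun s => 2 * (s - c))) => {}s.
  by apply: trigger_derive; rewrite /GRing.scale /=; ring.
have half (c : R) : (\int[mu]_(s in `[c, +oo[) ((1 + (s - c) ^+ 2)^-1)%:E = (pi / 2)%:E)%E.
  have dF (s : R) : is_derive s 1 (fun s => atan (s - c)) ((1 + (s - c) ^+ 2)^-1).
    by apply: trigger_derive; rewrite /GRing.scale /=; ring.
  have Foo : atan (s - c) @[s --> +oo] --> (pi / 2 : R).
    by apply: (cvg_comp _ _ (cvg_addrr (- c)) (@cvgy_atan R)).
  rewrite (ge0_is_derive_FTC2y _ dF (cinv c) Foo) ?subrr ?atan0 ?subr0//.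
  by move=> x _; rewrite invr_ge0 addr_ge0 ?sqr_ge0.
have mw D : measurable_fun D (fun s => ((weight s)^-1)%:E).
  apply/measurable_EFinP; apply: measurable_funTS.
  by apply: continuous_measurable_fun; exact: cinv.
have w0 s : (0 <= ((weight s)^-1)%:E)%E.
  by rewrite lee_fin invr_ge0 ltW ?weight_gt0.
rewrite (_ : setT = `]-oo, 2^-1] `|` `]2^-1, +oo[); last first.
  apply/seteqP; split => // s _ /=; rewrite !in_itv /= andbT.
  by have [|] := leP s 2^-1; [left|right].
rewrite ge0_integral_setU//=; last first.
  rewrite disj_set2E; apply/eqP; rewrite -subset0 => s /=.
  by rewrite !in_itv /= andbT => -[]; lra.
  exact: mw.
apply: (@le_trans _ _ ((pi / 2)%:E + (4 - pi / 2)%R%:E)%E); last first.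
  by rewrite -EFinD lee_fin; lra.
apply: leeD.
  rewrite -[X in `]-oo, X]](opprK 2^-1).
  rewrite (@ge0_integration_by_substitutionNy _ (fun s => (weight s)^-1)).
  - rewrite -(half (- 2^-1)) le_eqVlt; apply/orP; left; apply/eqP.
    apply: eq_integral => s _; congr EFin; rewrite /= /weight; congr (_ ^-1).
    by ring.
  - exact/continuous_subspaceT/cinv.
  - by move=> s _; rewrite invr_ge0 ltW ?weight_gt0.
have pi4 := @pihalf_lt2 R.
apply: (@le_trans _ _ (pi / 2)%:E); last by rewrite lee_fin; lra.
rewrite -(half 2^-1); apply: ge0_subset_integral => //=.
- exact: mw.
- by move=> s /=; rewrite !in_itv /= !andbT => /ltW.
Qed.

End weighted_bounds.

(** * Test functions as potentials of the kernel *)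

Section representation.
Context (R : realType).
Local Notation mu := (@lebesgue_measure R).

Lemma C3_is_derive (phi : R -> R) k (x : R) : C3_unit phi -> (k <= 2)%N ->
  is_derive x 1 (derive1n k phi) (derive1n k.+1 phi x).
Proof.
case=> D _ k2; apply: DeriveDef; first exact: D.
by rewrite derive1nS derive1E.
Qed.

Lemma C3_continuous (phi : R -> R) k : C3_unit phi -> (k <= 3)%N ->
  continuous (derive1n k phi).
Proof.
move=> H; rewrite leq_eqVlt => /predU1P[->|k2]; first by have [_ []] := H.
by apply: is_derive_continuous => x; exact: (C3_is_derive x H k2).
Qed.

Lemma C3_bmf (phi : R -> R) : C3_unit phi -> bmf phi.
Proof.
move=> H; split; last by exists 1 => x; have [_ [_ B]] := H; exact: (B 0%N).
by apply: continuous_measurable_fun; exact: (@C3_continuous phi 0 H).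
Qed.

Lemma derive1n_cst0 k : derive1n k (cst 0 : R -> R) = cst 0.
Proof.
elim: k => // k IH; rewrite derive1nS IH; apply/funext => x.
exact: derive1_cst.
Qed.

(** The zero test function serves twice: its representation gives the total mass of the kernel, and
    it makes the distance nonnegative. *)
Lemma C3_unit0 : C3_unit (cst 0 : R -> R).
Proof.
split; first by move=> k _ x; rewrite derive1n_cst0; exact: derivable_cst.
split; first by rewrite derive1n_cst0; exact: cst_continuous.
by move=> k _ x; rewrite derive1n_cst0 normr0.
Qed.

(* [(1 - d/ds)^3 phi], the source term for which [ker] is the Green kernel. *)
Definition source (phi : R -> R) (s : R) : R :=
  phi s - 3 * derive1n 1 phi s + 3 * derive1n 2 phi s - derive1n 3 phi s.

Lemma source_le8 phi s : C3_unit phi -> `|source phi s| <= 8.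
Proof.
move=> [_ [_ B]]; rewrite /source.
have := B 0%N isT s; have := B 1%N isT s; have := B 2%N isT s; have := B 3%N isT s.
rewrite derive1n0.
move: (phi s) (derive1n 1 phi s) (derive1n 2 phi s) (derive1n 3 phi s).
move=> q0 q1 q2 q3 /ler_normlP[? ?] /ler_normlP[? ?] /ler_normlP[? ?] /ler_normlP[? ?].
by apply/ler_normlP; split; lra.
Qed.

Lemma continuous_source phi : C3_unit phi -> continuous (source phi).
Proof.
move=> H x; apply: cvgB; last exact: (@C3_continuous phi 3 H).
apply: cvgD.
  apply: cvgB; first exact: (@C3_continuous phi 0 H).
  by apply: cvgM; [exact: cvg_cst|exact: (@C3_continuous phi 1 H)].
by apply: cvgM; [exact: cvg_cst|exact: (@C3_continuous phi 2 H)].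
Qed.

Lemma ker_ge0 (u : R) : 0 <= ker u.
Proof.
by rewrite /ker k0E mulr_ge0 ?expR_ge0// divr_ge0// exprn_ge0// le_max lexx orbT.
Qed.

(** Three integrations by parts yield the explicit primitive [F], which equals -f0(x) at s = x and
    tends to 0 at infinity. The sign of the source is what the improper fundamental theorem for
    nonnegative integrands asks for. *)
Lemma green_representation (f0 f1 f2 f3 : R -> R) (M x : R) :
  (forall s : R, is_derive s 1 f0 (f1 s)) ->
  (forall s : R, is_derive s 1 f1 (f2 s)) ->
  (forall s : R, is_derive s 1 f2 (f3 s)) -> continuous f3 ->
  (forall s, [/\ `|f0 s| <= M, `|f1 s| <= M & `|f2 s| <= M]) ->
  (forall s, 0 <= f0 s - 3 * f1 s + 3 * f2 s - f3 s) ->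
  (\int[mu]_s (ker (s - x) * (f0 s - 3 * f1 s + 3 * f2 s - f3 s))%:E = (f0 x)%:E)%E.
Proof.
move=> d0 d1 d2 cf3 B src.
pose Q s : R := (s - x) ^+ 2 / 2 * (f2 s - 2 * f1 s + f0 s)
  - (s - x) * (f1 s - f0 s) + f0 s.
pose F s : R := - (expR (- (s - x)) * Q s).
pose f s := k0 (s - x) * (f0 s - 3 * f1 s + 3 * f2 s - f3 s).
have dF (s : R) : is_derive s 1 F (f s).
  have h0 := d0 s; have h1 := d1 s; have h2 := d2 s.
  apply: trigger_derive.
  by rewrite /GRing.scale /= /f k0E /Q; field.
have cf : continuous f.
  move=> s; apply: cvgM.
    apply: (@continuous_comp _ _ _ (fun s => s - x) (@k0 R)); last exact: continuous_pexp.
    by apply: cvgB; [exact: cvg_id|exact: cvg_cst].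
  apply: cvgB; last exact: cf3.
  apply: cvgD.
    apply: cvgB; first exact: (is_derive_continuous d0).
    by apply: cvgM; [exact: cvg_cst|exact: (is_derive_continuous d1)].
  by apply: cvgM; [exact: cvg_cst|exact: (is_derive_continuous d2)].
have f_ge0 s : x <= s -> 0 <= f s.
  by move=> xs; rewrite mulr_ge0// k0E mulr_ge0 ?expR_ge0// divr_ge0 ?sqr_ge0.
have Foo : F s @[s --> +oo] --> (0 : R).
  (* With u = s - x >= 0, |Q| <= M + 2 M u + 2 M u^2, since the second difference f2 - 2 f1 + f0 is
     at most 4 M. *)
  pose A : {poly R} := Poly [:: M; 2 * M; 2 * M].
  have L : pexp 1 A (s - x) @[s --> +oo] --> (0 : R).
    by apply: (cvg_comp _ _ (cvg_addrr (- x)) (cvg_pexp A ltr01)).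
  have L' : - pexp 1 A (s - x) @[s --> +oo] --> (0 : R).
    by rewrite -(@oppr0 R); exact: cvgN.
  apply: (squeeze_cvgr _ L' L); near=> s.
  have xs : 0 <= s - x by rewrite subr_ge0; near: s; by apply: nbhs_pinfty_ge; rewrite num_real.
  rewrite -ler_norml /F normrN normrM ger0_norm ?expR_ge0// /pexp mul1r mulrC.
  rewrite ler_wpM2r ?expR_ge0// horner_Poly /= /Q.
  have [] := B s.
  move: (s - x) xs (f0 s) (f1 s) (f2 s).
  move=> u u0 q0 q1 q2 /ler_normlP[b1 b2] /ler_normlP[b3 b4] /ler_normlP[b5 b6].
  have u2 : 0 <= u ^+ 2 by rewrite sqr_ge0.
  have e1 : u ^+ 2 * (q2 - 2 * q1 + q0) <= 4 * M * u ^+ 2.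
    by rewrite [leRHS]mulrC ler_wpM2l//; lra.
  have e1' : - (4 * M * u ^+ 2) <= u ^+ 2 * (q2 - 2 * q1 + q0).
    by rewrite lerNl -mulrN [leRHS]mulrC ler_wpM2l//; lra.
  have e2 : u * (q1 - q0) <= 2 * M * u.
    by rewrite [leRHS]mulrC ler_wpM2l//; lra.
  have e2' : - (2 * M * u) <= u * (q1 - q0).
    by rewrite lerNl -mulrN [leRHS]mulrC ler_wpM2l//; lra.
  by apply/ler_normlP; split; lra.
have := ge0_is_derive_FTC2y f_ge0 dF cf Foo.
rewrite sub0r /F opprK subrr oppr0 expR0 mul1r /Q subrr expr0n /= !mul0r subr0 add0r.
move=> <-; rewrite [RHS]integral_mkcond; apply: eq_integral => s _.
rewrite patchE mem_setE in_itv /= andbT /f /ker.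
case: (leP x s) => xs; first by have -> : Num.max (s - x) 0 = s - x by apply/max_idPl; lra.
have -> : Num.max (s - x) 0 = 0 by apply/max_idPr; lra.
by rewrite k0E expr0n /= !mul0r.
Unshelve. all: by end_near. Qed.

Lemma ker_representation phi x : C3_unit phi ->
  (\int[mu]_s (ker (s - x) * (source phi s + 8))%:E = (phi x + 8)%:E)%E.
Proof.
move=> H.
have d0 (s : R) : is_derive s 1 (fun s => phi s + 8) (derive1n 1 phi s).
  have := @C3_is_derive phi 0 s H isT; rewrite derive1n0 => h0.
  by apply: trigger_derive; rewrite addr0.
have d1 s := @C3_is_derive phi 1 s H isT.
have d2 s := @C3_is_derive phi 2 s H isT.
have [_ [_ B]] := H.
(* The constant 8 added to [phi] is reproduced in its source and makes it nonnegative; 9 = 1 + 8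
   then bounds the shifted function and its derivatives. *)
rewrite -(green_representation (M := 9) x d0 d1 d2).
- apply: eq_integral => s _; congr (_ * _)%:E.
  rewrite /source; move: (phi s) (derive1n 1 phi s) (derive1n 2 phi s) (derive1n 3 phi s).
  by move=> ? ? ? ?; ring.
- exact: (@C3_continuous phi 3 H).
- move=> s; split; last 2 first.
  + by apply: le_trans (B 1%N isT s) _; rewrite ler1n.
  + by apply: le_trans (B 2%N isT s) _; rewrite ler1n.
  apply: le_trans (ler_normD _ _) _.
  have := B 0%N isT s; rewrite derive1n0 [`|8|]ger0_norm//; lra.
- move=> s; have := source_le8 s H; rewrite /source.
  move: (phi s) (derive1n 1 phi s) (derive1n 2 phi s) (derive1n 3 phi s).
  by move=> q0 q1 q2 q3 /ler_normlP[? ?]; lra.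
Qed.

Lemma source_cst0 (s : R) : source (cst 0) s = 0.
Proof. by rewrite /source !derive1n_cst0 /=; ring. Qed.

Lemma ker_le1 (u : R) : `|ker u| <= 1.
Proof.
rewrite ger0_norm ?ker_ge0// /ker; set v := Num.max u 0.
have v0 : 0 <= v by rewrite /v le_max lexx orbT.
have := expR_ge1Dxn 1 v0; rewrite k0E expRN ler_pdivrMr ?expR_gt0// mul1r.
by rewrite !factS fact0; lra.
Qed.

Lemma dker_le : exists M : R, forall u, `|dker u| <= M.
Proof.
exists 2 => u; rewrite /dker; set v := Num.max u 0.
have v0 : 0 <= v by rewrite /v le_max lexx orbT.
rewrite k1E normrM (ger0_norm (expR_ge0 _)) expRN ler_pdivrMr ?expR_gt0//.
have := expR_ge1Dxn 1 v0; have := expR_ge1Dx v; rewrite !factS fact0 => h1 h2.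
apply/ler_normlP; split; nra.
Qed.

Lemma bmf_ker : bmf (@ker R).
Proof.
split; first by apply: continuous_measurable_fun; exact: continuous_ker.
by exists 1 => u; exact: ker_le1.
Qed.

Lemma bmf_dker : bmf (@dker R).
Proof.
split; first by apply: continuous_measurable_fun; exact: continuous_dker.
exact: dker_le.
Qed.

Section expectation.
Context d (S : measurableType d) (Q : probability S R) (Y : S -> R).
Hypothesis mY : measurable_fun setT Y.

Lemma bmf_ker_shift : bmf (fun p : R * S => ker (p.1 - Y p.2)).
Proof.
apply: bmf_comp; first exact: bmf_ker.
by apply: measurable_funB => //; exact: (measurableT_comp mY).
Qed.

Lemma bmf_Ex_ker : bmf (fun s : R => \int[Q]_x ker (s - Y x)).
Proof. exact: (bmf_Ex2 Q bmf_ker_shift). Qed.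

Lemma Ex_representation phi : C3_unit phi ->
  (\int[mu]_s ((source phi s + 8) * \int[Q]_x ker (s - Y x))%:E =
   (\int[Q]_x phi (Y x) + 8)%:E)%E.
Proof.
move=> H.
have src s : 0 <= source phi s + 8.
  by have /ler_normlP[] := source_le8 s H; lra.
have bphi : bmf (fun x => phi (Y x)) by apply: bmf_comp => //; exact: C3_bmf.
rewrite -[in RHS](Ex_cst Q 8) -ExD//; last exact: bmf_cst.
rewrite EFin_Ex; last by apply: bmfD => //; exact: bmf_cst.
under [RHS]eq_integral do rewrite -(ker_representation _ H).
pose f (p : S * R) : R := ker (p.2 - Y p.1) * (source phi p.2 + 8).
rewrite -[RHS]/(\int[Q]_x \int[mu]_s (EFin \o f) (x, s))%E.
rewrite (fubini_tonelli (m1 := Q) (m2 := mu) (EFin \o f)) => [| |p]; last 2 first.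
- apply/measurable_EFinP; apply: measurable_funM.
    apply: (measurableT_comp (bmf_measurable bmf_ker)).
    by apply: measurable_funB => //; exact: (measurableT_comp mY).
  apply: measurable_funD => //; apply: (measurableT_comp _ measurable_snd).
  by apply: continuous_measurable_fun; exact: continuous_source.
- by rewrite lee_fin mulr_ge0 ?ker_ge0.
apply: eq_integral => s _; rewrite /f /=.
have bk := bmf_pair1 s bmf_ker_shift.
rewrite -EFin_Ex; last by apply: bmfM => //; exact: bmf_cst.
by rewrite ExZr// mulrC.
Qed.

Lemma Ex_ker_mass :
  (\int[mu]_s (8 * \int[Q]_x ker (s - Y x))%:E = 8%R%:E)%E.
Proof.
have := Ex_representation C3_unit0; rewrite Ex_cst add0r => <-.
by apply: eq_integral => s _; rewrite source_cst0 add0r.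
Qed.

End expectation.

(* The pointwise bound is [8 |D| <= 4 eta / w + (4 / eta) w D^2] for the
   difference [D] of the two kernel averages; [\int 1 / w <= 4] gives [16 eta]. *)
Lemma Ex_diff_le d1 d2 (S1 : measurableType d1) (S2 : measurableType d2)
    (Q1 : probability S1 R) (Q2 : probability S2 R) (Y1 : S1 -> R) (Y2 : S2 -> R)
    (eta : R) phi :
  measurable_fun setT Y1 -> measurable_fun setT Y2 -> 0 < eta -> C3_unit phi ->
  ((\int[Q1]_x phi (Y1 x) - \int[Q2]_x phi (Y2 x))%:E <=
   (16 * eta)%:E + (4 / eta)%:E *
   \int[mu]_s (weight s * (\int[Q1]_x ker (s - Y1 x) - \int[Q2]_x ker (s - Y2 x)) ^+ 2)%:E)%E.
Proof.
move=> mY1 mY2 eta0 H.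
pose D1 (s : R) := \int[Q1]_x ker (s - Y1 x); pose D2 (s : R) := \int[Q2]_x ker (s - Y2 x).
have [mD1 _] : bmf D1 := bmf_Ex_ker Q1 mY1.
have [mD2 _] : bmf D2 := bmf_Ex_ker Q2 mY2.
have D1_ge0 s : 0 <= D1 s by apply: Rintegral_ge0 => x _; exact: ker_ge0.
have D2_ge0 s : 0 <= D2 s by apply: Rintegral_ge0 => x _; exact: ker_ge0.
have src s : 0 <= source phi s + 8.
  by have /ler_normlP[] := source_le8 s H; lra.
have msrc : measurable_fun setT (fun s => source phi s + 8).
  apply: measurable_funD => //; apply: continuous_measurable_fun.
  exact: continuous_source.
have mw := @measurable_weight R.
have w0 (s : R) : 0 < weight s := weight_gt0 s.
have mwi : measurable_fun setT (fun s : R => (weight s)^-1).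
  apply: continuous_measurable_fun => s; apply: (@continuousV _ _ (@weight R)).
    by rewrite gt_eqF ?weight_gt0.
  exact: continuous_weight.
have I1 : (\int[mu]_s ((source phi s + 8) * D1 s)%:E =
  (\int[Q1]_x phi (Y1 x) + 8)%:E)%E := Ex_representation Q1 mY1 H.
have I2 : (\int[mu]_s ((source phi s + 8) * D2 s)%:E =
  (\int[Q2]_x phi (Y2 x) + 8)%:E)%E := Ex_representation Q2 mY2 H.
have J1 : (\int[mu]_s (8 * D1 s)%:E = 8%R%:E)%E := Ex_ker_mass Q1 mY1.
have J2 : (\int[mu]_s (8 * D2 s)%:E = 8%R%:E)%E := Ex_ker_mass Q2 mY2.
(* The inequality is arranged with nonnegative terms only on both sides, so that integrating it
   involves no difference of possibly infinite integrals. *)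
have pw s : (source phi s + 8) * D1 s + 8 * D2 s <=
    ((source phi s + 8) * D2 s + 8 * D1 s) +
    (4 * eta * (weight s)^-1 + 4 / eta * (weight s * (D1 s - D2 s) ^+ 2)).
  have /ler_normlP[b1 b2] := source_le8 s H.
  move: (w0 s) (source phi s) b1 b2 (D1 s) (D2 s) => + S + + a1 a2.
  move: (weight s) => w wp b1 b2.
  suff h : 8 * `|a1 - a2| <= 4 * eta / w + 4 / eta * (w * (a1 - a2) ^+ 2).
    have h2 : S * (a1 - a2) <= 8 * `|a1 - a2|.
      apply: le_trans (ler_norm _) _; rewrite normrM ler_wpM2r//.
      by apply/ler_normlP; split; lra.
    by nra.
  rewrite -[(a1 - a2) ^+ 2]real_normK ?num_real//.
  set e := `|a1 - a2|.
  (* With e = |D|, the two sides differ by the square (4 w / eta) (e - eta / w)^2. *)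
  rewrite -subr_ge0 (_ : _ - _ = 4 * w / eta * (e - eta / w) ^+ 2); last first.
    by field; rewrite !gt_eqF.
  by rewrite mulr_ge0 ?sqr_ge0// divr_ge0 ?mulr_ge0// ltW.
have mf (h D : R -> R) : measurable_fun setT h -> measurable_fun setT D ->
    measurable_fun setT (fun s => (h s * D s)%:E).
  by move=> mh mD; apply/measurable_EFinP; exact: measurable_funM.
have p0 (D : R -> R) s : 0 <= D s -> (0 <= ((source phi s + 8) * D s)%:E)%E.
  by move=> D0; rewrite lee_fin mulr_ge0.
have q0 (D : R -> R) s : 0 <= D s -> (0 <= (8 * D s)%:E)%E.
  by move=> D0; rewrite lee_fin mulr_ge0.
have r0 s : (0 <= (4 * eta * (weight s)^-1)%:E)%E.
  by rewrite lee_fin mulr_ge0 ?mulr_ge0 ?invr_ge0// ltW.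
have t0 s : (0 <= (weight s * (D1 s - D2 s) ^+ 2)%:E)%E.
  by rewrite lee_fin mulr_ge0 ?sqr_ge0// ltW.
have mt : measurable_fun setT (fun s => (weight s * (D1 s - D2 s) ^+ 2)%:E).
  by apply: mf => //; apply: measurable_funX; exact: measurable_funB.
have e0 : (0 <= (4 / eta)%:E)%E by rewrite lee_fin divr_ge0// ltW.
have : (\int[mu]_s (((source phi s + 8) * D1 s)%:E + (8 * D2 s)%:E) <=
  \int[mu]_s ((((source phi s + 8) * D2 s)%:E + (8 * D1 s)%:E) +
    ((4 * eta * (weight s)^-1)%:E + (4 / eta)%:E * (weight s * (D1 s - D2 s) ^+ 2)%:E)))%E.
  apply: ge0_le_integral => //.
  - by move=> s _; apply: adde_ge0; [exact: p0|exact: q0].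
  - by apply: emeasurable_funD; exact: mf.
  - apply: emeasurable_funD; first by apply: emeasurable_funD; exact: mf.
    apply: emeasurable_funD; first exact: mf.
    by apply: emeasurable_funM.
  - by move=> s _; rewrite -!EFinM -!EFinD lee_fin pw.
rewrite ge0_integralD//; [|by move=> s _; exact: p0|exact: mf|by move=> s _; exact: q0|exact: mf].
rewrite ge0_integralD//; last 4 first.
- by move=> s _; apply: adde_ge0; [exact: p0|exact: q0].
- by apply: emeasurable_funD; exact: mf.
- by move=> s _; apply: adde_ge0 => //; exact: mule_ge0.
- apply: emeasurable_funD; first exact: mf.
  by apply: emeasurable_funM.
rewrite ge0_integralD//; [|by move=> s _; exact: p0|exact: mf|by move=> s _; exact: q0|exact: mf].
rewrite ge0_integralD//; [|exact: mf|by move=> s _; exact: mule_ge0|exact: emeasurable_funM].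
rewrite ge0_integralZl// I1 I2 J1 J2.
have W : (\int[mu]_s (4 * eta * (weight s)^-1)%:E <= (16 * eta)%:E)%E.
  under eq_integral do rewrite EFinM.
  rewrite ge0_integralZl//; last 3 first.
  - exact/measurable_EFinP.
  - by move=> s _; rewrite lee_fin invr_ge0 ltW.
  - by rewrite lee_fin mulr_ge0 ?ltW.
  apply: le_trans (lee_wpmul2l _ (@integral_inv_weight R)) _.
    by rewrite lee_fin mulr_ge0 ?ltW.
  by rewrite -EFinM lee_fin; lra.
have /= t1 : (0 <= \int[mu]_s (weight s * (D1 s - D2 s) ^+ 2)%:E)%E.
  by apply: integral_ge0 => s _; exact: t0.
have r1 : (0 <= \int[mu]_s (4 * eta * (weight s)^-1)%:E)%E by apply: integral_ge0.
(* The weighted energy [W2] may be infinite, in which case the bound is trivial. *)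
have gen (a b : R) (W1 W2 : \bar R) : (0 <= W1)%E -> (W1 <= (16 * eta)%:E)%E ->
    (0 <= W2)%E -> ((a + 8)%:E + 8%R%:E <= ((b + 8)%:E + 8%R%:E) + (W1 + (4 / eta)%:E * W2))%E ->
    ((a - b)%:E <= (16 * eta)%:E + (4 / eta)%:E * W2)%E.
  move=> W1_ge0 W1_le; case: W2 => [w2| |] // _; last first.
    by move=> _; rewrite mulry gtr0_sg ?divr_gt0// mul1e addey// leey.
  case: W1 W1_ge0 W1_le => [w1| |] // _.
  by rewrite -!EFinM -!EFinD !lee_fin; lra.
exact: gen r1 W t1.
Qed.

End representation.

(** * Fluctuations of the averaged kernel *)

Section fluctuation.
Context (R : realType) d (T : measurableType d) (P : probability T R).
Context (N : nat) (Z : 'I_N -> T -> R) (al : T -> R).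
Hypothesis mZ : forall i, measurable_fun setT (Z i).
Hypothesis mal : measurable_fun setT al.
Hypothesis indep : forall B : 'I_N -> set R, (forall i, measurable (B i)) ->
  P (\bigcap_i (Z i @^-1` B i)) = (\prod_(i < N) P (al @^-1` B i))%E.
Hypothesis al4 : P.-integrable setT (fun w => (al w ^+ 4)%:E).
Hypothesis al1 : (\int[P]_w (al w)%:E = 0)%E.
Hypothesis al2 : (\int[P]_w (al w ^+ 2)%:E = 1)%E.
Context d' (S : measurableType d') (U : probability S R) (e : 'I_N -> S -> R).
Hypothesis me : forall i, measurable_fun setT (e i).
Variable (c : R).
Local Notation mu := (@lebesgue_measure R).
Local Notation Zt := (coefs Z).

Definition lincomb (z : N.-tuple R) (x : S) : R := c * \sum_(i < N) tnth z i * e i x.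

Lemma lincomb_upd z i x v :
  lincomb (upd z i v) x = lincomb (upd z i 0) x + c * v * e i x.
Proof.
rewrite /lincomb !(bigD1 (P := xpredT) i)//= !tnth_upd eqxx mul0r add0r.
rewrite (eq_bigr (fun j => tnth (upd z i 0) j * e j x)); first by ring.
by move=> j ji; rewrite !tnth_upd (negbTE ji).
Qed.

Lemma lincombE z i x : lincomb z x = lincomb (upd z i 0) x + c * tnth z i * e i x.
Proof. by rewrite -lincomb_upd upd_tnth. Qed.

Lemma measurable_lincomb d1 (T1 : measurableType d1) (u : T1 -> N.-tuple R) (v : T1 -> S) :
  measurable_fun setT u -> measurable_fun setT v ->
  measurable_fun setT (fun t => lincomb (u t) (v t)).
Proof.
move=> mu_ mv; apply: measurable_funM => //.
apply: measurable_sum => i; apply: measurable_funM.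
  exact: (measurableT_comp (measurable_tnth i) mu_).
exact: (measurableT_comp (me i) mv).
Qed.

Lemma integrable_alX k : (k <= 4)%N -> P.-integrable setT (fun w => (al w ^+ k)%:E).
Proof.
move=> k4; apply: (@le_integrable _ _ _ _ _ _ _ (fun w => (1 + al w ^+ 4)%:E)) => //.
- by apply/measurable_EFinP; exact: measurable_funX.
- move=> w _; rewrite lee_fin [leRHS]ger0_norm; last first.
    by rewrite addr_ge0// (exprM _ 2 2) sqr_ge0.
  rewrite normrX (_ : al w ^+ 4 = `|al w| ^+ 4); last first.
    by rewrite !(exprM _ 2 2) real_normK ?num_real.
  have [a1|/ltW a1] := leP `|al w| 1.
    by rewrite (le_trans (exprn_ile1 k (normr_ge0 _) a1))// lerDl exprn_ge0.
  by rewrite (le_trans (ler_weXn2l a1 k4))// lerDr.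
- under eq_fun do rewrite EFinD.
  by apply: integrableD => //; exact: finite_measure_integrable_cst.
Qed.

Lemma Rint_al1 : \int[P]_w al w = 0.
Proof. by rewrite /Rintegral al1. Qed.

Lemma Rint_al2 : \int[P]_w (al w ^+ 2) = 1.
Proof. by rewrite /Rintegral al2. Qed.

Lemma integral_cst1 (r : R) : (\int[P]_w r%:E = r%:E)%E.
Proof. by rewrite integral_cst//= (probability_setT P) mule1. Qed.

Lemma integral_al_sqr (a b : R) :
  (\int[P]_w ((a + b * al w) ^+ 2)%:E = (a ^+ 2 + b ^+ 2)%:E)%E.
Proof.
have i1 : P.-integrable setT (fun w => (al w)%:E) by have := integrable_alX (isT : (1 <= 4)%N).
have i2 : P.-integrable setT (fun w => (al w ^+ 2)%:E) by exact: integrable_alX.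
have i3 : P.-integrable setT (fun w => (b ^+ 2)%:E * (al w ^+ 2)%:E)%E by exact: integrableZl.
have i4 : P.-integrable setT (fun w => (2 * a * b)%:E * (al w)%:E)%E by exact: integrableZl.
have i5 : P.-integrable setT (fun w => (a ^+ 2)%:E) by exact: finite_measure_integrable_cst.
transitivity (\int[P]_w ((a ^+ 2)%:E + ((2 * a * b)%:E * (al w)%:E +
    (b ^+ 2)%:E * (al w ^+ 2)%:E)))%E.
  by apply: eq_integral => w _; rewrite -!EFinM -!EFinD; congr EFin; ring.
rewrite integralD//; last exact: integrableD.
rewrite integralD// !integralZl// al1 al2 mule0 mule1 add0e.
by rewrite integral_cst1 EFinD.
Qed.

(** The head coefficient is resampled: with mean 0 and variance 1 it contributes (c e_i)^2 and no
    cross term. Uniqueness of the indices keeps the rest of the sum unaffected. *)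
Lemma second_moment_seq (l : seq 'I_N) x r : uniq l ->
  (\int[P]_w ((r + c * \sum_(i <- l) tnth (Zt w) i * e i x) ^+ 2)%:E =
   (r ^+ 2 + c ^+ 2 * \sum_(i <- l) e i x ^+ 2)%:E)%E.
Proof.
elim: l r => [r _|i l IH r /= /andP[il ul]].
  under eq_integral do rewrite big_nil mulr0 addr0.
  by rewrite integral_cst1 big_nil mulr0 addr0.
have mH (l' : seq 'I_N) : measurable_fun setT
    (fun z : N.-tuple R => r + c * \sum_(i <- l') tnth z i * e i x).
  apply: measurable_funD => //; apply: measurable_funM => //.
  apply: measurable_sum => j; apply: measurable_funM => //.
  exact: measurable_tnth.
rewrite (ge0_resample mZ mal indep i
  (H := fun z => ((r + c * \sum_(i <- (i :: l)) tnth z i * e i x) ^+ 2)%:E)); last 2 first.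
- by apply/measurable_EFinP; exact: measurable_funX.
- by move=> z; rewrite lee_fin sqr_ge0.
transitivity (\int[P]_w ((r + c * \sum_(i <- l) tnth (Zt w) i * e i x) ^+ 2 + (c * e i x) ^+ 2)%:E)%E.
  apply: eq_integral => w _; rewrite -integral_al_sqr; apply: eq_integral => w' _.
  congr EFin; rewrite big_cons tnth_upd eqxx.
  have -> : \sum_(j <- l) tnth (upd (Zt w) i (al w')) j * e j x =
      \sum_(j <- l) tnth (Zt w) j * e j x.
    apply: eq_big_seq => j jl; rewrite tnth_upd.
    by case: eqP => // ji; rewrite -ji jl in il.
  by ring.
under eq_integral do rewrite EFinD.
rewrite ge0_integralD//; last 3 first.
- by move=> w _; rewrite lee_fin sqr_ge0.
- apply/measurable_EFinP; apply: measurable_funX.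
  exact: (measurableT_comp (mH l) (measurable_coefs mZ)).
- by move=> w _; rewrite lee_fin sqr_ge0.
rewrite IH// integral_cst1 -EFinD big_cons; congr EFin.
by ring.
Qed.

Hypothesis ce : forall x, c ^+ 2 * (\sum_(i < N) e i x ^+ 2) = 1.

Lemma second_moment x r :
  (\int[P]_w ((r + lincomb (Zt w) x) ^+ 2)%:E = (r ^+ 2 + 1)%:E)%E.
Proof. by rewrite second_moment_seq ?index_enum_uniq// ce. Qed.

Lemma second_moment_upd i x r :
  (\int[P]_w ((r + lincomb (upd (Zt w) i 0) x) ^+ 2)%:E <= (r ^+ 2 + 1)%:E)%E.
Proof.
have -> : (\int[P]_w ((r + lincomb (upd (Zt w) i 0) x) ^+ 2)%:E =
    \int[P]_w ((r + c * \sum_(j <- rem i (index_enum 'I_N))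
      tnth (Zt w) j * e j x) ^+ 2)%:E)%E.
  apply: eq_integral => w _.
  congr (((_ + c * _) ^+ 2)%:E); rewrite (perm_big _ (perm_to_rem (mem_index_enum i))) /=.
  rewrite big_cons tnth_upd eqxx mul0r add0r; apply: eq_big_seq => j.
  by rewrite mem_rem_uniq ?index_enum_uniq// inE tnth_upd => /andP[/negbTE ->].
rewrite second_moment_seq ?rem_uniq ?index_enum_uniq// lee_fin lerD2l -(ce x).
rewrite ler_wpM2l ?sqr_ge0//.
rewrite [leRHS](perm_big _ (perm_to_rem (mem_index_enum i))) /= big_cons lerDr.
exact: sqr_ge0.
Qed.

End fluctuation.

(** * Polynomial bounds for one coefficient *)

Section remainder_polynomials.
Context (R : realType).
Implicit Types (ze ep y : R).

(** Here ze stands for c z_i, ep for e_i(x), and y for the sum without its i-th term. The Taylor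
    bound has degree six in ze, because [sqk2_mean] is itself quadratic in its step; beyond the
    threshold the plain increment, of degree four, takes over. *)
Definition rem_bound ze ep y : R :=
  if `|ze| <= 3 / 2 then (ze * ep) ^+ 4 / 3 * sqk2_mean y (ze * ep)
  else (ze * ep) ^+ 2 * sqk1_mean y (ze * ep).

(** Completing the square in y leaves a quantity whose mean needs only the second moment of a
    shifted sum. *)
Lemma sqk2_meanE y xi :
  sqk2_mean y xi = 3 / 16 * (xi / 2 + y) ^+ 2 + (3 / 16 * (1 + xi ^+ 2 / 12) + 7 / 64).
Proof. by rewrite /sqk2_mean; field. Qed.

Lemma sqk1_meanE y xi :
  sqk1_mean y xi = 16^-1 * (xi / 2 + 1 + y) ^+ 2 + (xi ^+ 2 / 192 + 13 / 64).
Proof. by rewrite /sqk1_mean; field. Qed.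

Lemma sqk2_mean_ge0 y xi : 0 <= sqk2_mean y xi.
Proof.
rewrite sqk2_meanE.
have := sqr_ge0 (xi / 2 + y); have := sqr_ge0 xi; lra.
Qed.

Lemma sqk1_mean_ge0 y xi : 0 <= sqk1_mean y xi.
Proof.
rewrite sqk1_meanE.
have := sqr_ge0 (xi / 2 + 1 + y); have := sqr_ge0 xi; lra.
Qed.

Lemma rem_bound_ge0 ze ep y : 0 <= rem_bound ze ep y.
Proof.
rewrite /rem_bound; case: ifP => _; rewrite mulr_ge0 ?sqk1_mean_ge0 ?sqk2_mean_ge0 ?sqr_ge0//.
by rewrite divr_ge0// (exprM _ 2 2) sqr_ge0.
Qed.

(* The threshold 3/2 balances the two regimes: both give the constant 5/24. *)
Lemma rem_bound_quad ze ep : `|ep| <= 1 -> exists a b r : R,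
  [/\ 0 <= a, 0 <= b, forall y, rem_bound ze ep y = a * (r + y) ^+ 2 + b
    & a * (r ^+ 2 + 1) + b <= 5 / 24 * ze ^+ 4 * ep ^+ 2].
Proof.
move=> ep1; rewrite /rem_bound.
have e2 : ep ^+ 2 <= 1 by rewrite -real_normK ?num_real// exprn_ile1.
have e0 : 0 <= ep ^+ 2 := sqr_ge0 _.
have z0 : 0 <= ze ^+ 2 := sqr_ge0 _.
have z4 : ze ^+ 4 = ze ^+ 2 * ze ^+ 2 by rewrite (exprM _ 2 2) expr2.
have E4 : (ze * ep) ^+ 4 = ze ^+ 2 * ze ^+ 2 * (ep ^+ 2 * ep ^+ 2) by ring.
have E2 : (ze * ep) ^+ 2 = ze ^+ 2 * ep ^+ 2 by ring.
have zz : 0 <= ze ^+ 2 * ze ^+ 2 by rewrite mulr_ge0.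
have ee : 0 <= ep ^+ 2 * ep ^+ 2 by rewrite mulr_ge0.
have ze0 : 0 <= ze ^+ 2 * ep ^+ 2 by rewrite mulr_ge0.
have E0 : 0 <= (ze * ep) ^+ 4 by rewrite E4 mulr_ge0.
case: (leP `|ze| (3 / 2)) => [zs|zl].
- have z2 : ze ^+ 2 <= 9 / 4.
    rewrite -real_normK ?num_real// (_ : 9 / 4 = (3 / 2) ^+ 2); last by field.
    by rewrite lerXn2r ?nnegrE//; lra.
  exists ((ze * ep) ^+ 4 / 16), ((ze * ep) ^+ 4 / 3 * (3 / 16 * (1 + (ze * ep) ^+ 2 / 12) + 7 / 64)),
    (ze * ep / 2); split.
  + by rewrite divr_ge0.
  + by rewrite E2 mulr_ge0 ?divr_ge0//; lra.
  + by move=> y; rewrite sqk2_meanE; field.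
  + have E2h : (ze * ep / 2) ^+ 2 = ze ^+ 2 * ep ^+ 2 / 4 by field.
    rewrite E2h E4 E2 z4; move: (ze ^+ 2) (ep ^+ 2) z0 z2 e0 e2 => p q p0 p2 q0 q1 {E0 ze0 zz ee}.
    have pq : p * q <= 9 / 4 by nra.
    have pq0 : 0 <= p * q by rewrite mulr_ge0.
    have h : p * p * (q * q) <= p * p * q by rewrite ler_wpM2l ?mulr_ge0//; nra.
    have h0 : 0 <= p * p * (q * q) by rewrite !mulr_ge0.
    have h2 : p * p * (q * q) * (p * q) <= p * p * (q * q) * (9 / 4) by rewrite ler_wpM2l.
    rewrite (_ : _ + _ = p * p * (q * q) * (p * q) * (1 / 64 + 1 / 192)
      + p * p * (q * q) * (1 / 16 + 1 / 16 + 7 / 192)); last by field.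
    (* With p q <= 9/4, the total coefficient of p^2 q is (9/4) (1/48) + 31/192 = 5/24. *)
    by lra.
- have z2 : 9 / 4 <= ze ^+ 2.
    rewrite -real_normK ?num_real// (_ : 9 / 4 = (3 / 2) ^+ 2); last by field.
    by rewrite lerXn2r ?nnegrE//; lra.
  have zep : ze * ep <= `|ze| by rewrite (le_trans (ler_norm _))// normrM ler_piMr.
  have az : `|ze| <= 2 / 3 * ze ^+ 2.
    by rewrite -[ze ^+ 2]real_normK ?num_real//; move: zl; move: `|ze| => q; nra.
  exists ((ze * ep) ^+ 2 / 16), ((ze * ep) ^+ 2 * ((ze * ep) ^+ 2 / 192 + 13 / 64)),
    (ze * ep / 2 + 1); split.
  + by rewrite E2 divr_ge0.
  + by rewrite E2 mulr_ge0//; lra.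
  + by move=> y; rewrite sqk1_meanE; field.
  + rewrite (_ : _ + _ = (ze * ep) ^+ 2 * ((ze * ep) ^+ 2 / 48 + ze * ep / 16 + 21 / 64)); last by field.
    rewrite z4 E2.
    have : ze ^+ 2 * ep ^+ 2 <= ze ^+ 2 by rewrite ler_piMr.
    move: (ze * ep) zep az => xi; move: `|ze| => q.
    move: (ze ^+ 2) (ep ^+ 2) z0 z2 e0 e2 => p r p0 p2 r0 r1 xq qp pr.
    rewrite (_ : 5 / 24 * (p * p) * r = p * r * (5 / 24 * p)); last by field.
    by rewrite ler_wpM2l ?mulr_ge0//; lra.
Qed.

(** The analogue of [rem_bound_quad] for the error made by [dker] when the i-th term is dropped from
    its argument. It is needed for every ze, and its degree in ze never exceeds four. *)
Lemma dker_bound_quad ze ep : `|ep| <= 1 -> exists a b r : R,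
  [/\ 0 <= a, 0 <= b, forall y, ep ^+ 2 * ((ze * ep) ^+ 2 * sqk2_mean y (ze * ep)) = a * (r + y) ^+ 2 + b
    & a * (r ^+ 2 + 1) + b <= (31 / 64 * ze ^+ 2 + ze ^+ 4 / 16) * ep ^+ 2].
Proof.
move=> ep1.
have e2 : ep ^+ 2 <= 1 by rewrite -real_normK ?num_real// exprn_ile1.
have e0 : 0 <= ep ^+ 2 := sqr_ge0 _.
have z0 : 0 <= ze ^+ 2 := sqr_ge0 _.
have z4 : ze ^+ 4 = ze ^+ 2 * ze ^+ 2 by rewrite (exprM _ 2 2) expr2.
have E2 : (ze * ep) ^+ 2 = ze ^+ 2 * ep ^+ 2 by ring.
exists (ep ^+ 2 * (ze * ep) ^+ 2 * (3 / 16)),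
  (ep ^+ 2 * (ze * ep) ^+ 2 * (3 / 16 * (1 + (ze * ep) ^+ 2 / 12) + 7 / 64)), (ze * ep / 2); split.
- by rewrite E2 mulr_ge0 ?divr_ge0// mulr_ge0// mulr_ge0.
- rewrite E2 mulr_ge0//; first by rewrite mulr_ge0// mulr_ge0.
  have : 0 <= ze ^+ 2 * ep ^+ 2 by rewrite mulr_ge0.
  by lra.
- by move=> y; rewrite sqk2_meanE; field.
- rewrite (_ : _ + _ = ep ^+ 2 * (ze * ep) ^+ 2 * ((ze * ep) ^+ 2 / 16 + 31 / 64)); last by field.
  rewrite E2 z4; move: (ze ^+ 2) (ep ^+ 2) z0 e0 e2 => p q p0 q0 q1.
  have h1 : p * q <= p by rewrite ler_piMr.
  have pq0 : 0 <= p * q by rewrite mulr_ge0.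
  rewrite (_ : (31 / 64 * p + p * p / 16) * q = q * (p * (p / 16 + 31 / 64))); last by field.
  rewrite -mulrA ler_wpM2l// ler_pM//; lra.
Qed.

End remainder_polynomials.

(** * Weighted variance of the averaged kernel *)

Section variance.
Context (R : realType) d (T : measurableType d) (P : probability T R).
Context (N : nat) (Z : 'I_N -> T -> R) (al : T -> R).
Hypothesis mZ : forall i, measurable_fun setT (Z i).
Hypothesis mal : measurable_fun setT al.
Hypothesis indep : forall B : 'I_N -> set R, (forall i, measurable (B i)) ->
  P (\bigcap_i (Z i @^-1` B i)) = (\prod_(i < N) P (al @^-1` B i))%E.
Hypothesis al4 : P.-integrable setT (fun w => (al w ^+ 4)%:E).
Hypothesis al1 : (\int[P]_w (al w)%:E = 0)%E.
Hypothesis al2 : (\int[P]_w (al w ^+ 2)%:E = 1)%E.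
Context d' (S : measurableType d') (U : probability S R) (e : 'I_N -> S -> R).
Hypothesis me : forall i, measurable_fun setT (e i).
Hypothesis e_le1 : forall i x, `|e i x| <= 1.
Variable (c : R).
Hypothesis ce : forall x, c ^+ 2 * (\sum_(i < N) e i x ^+ 2) = 1.
Local Notation mu := (@lebesgue_measure R).
Local Notation Zt := (coefs Z).
Local Notation lincomb := (lincomb e c).
Let m4 := \int[P]_w (al w ^+ 4).

Hypothesis orth : forall i j, \int[U]_x (e i x * e j x) = if i == j then 2^-1 else 0.

Let int_al4 : (\int[P]_w (al w ^+ 4)%:E = m4%:E)%E.
Proof. by rewrite /m4 /Rintegral fineK//; exact: integrable_fin_num. Qed.

(** After resampling, coefficient [i] and the sum without it are integrated separately. A bound a (r
    + y)^2 + b then has mean at most a (r^2 + 1) + b, since the shortened sum is centred with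
    variance at most 1. *)
Lemma resample_quad i x (B : R -> R -> R) (K : R -> R) :
  measurable_fun setT (fun p : R * R => B p.1 p.2) ->
  (forall ze, exists a b r : R, [/\ 0 <= a, 0 <= b,
     forall y, B ze y = a * (r + y) ^+ 2 + b & a * (r ^+ 2 + 1) + b <= K ze]) ->
  (\int[P]_w (B (c * tnth (Zt w) i) (lincomb (upd (Zt w) i 0) x))%:E <=
   \int[P]_w (K (c * al w))%:E)%E.
Proof.
move=> mB BK.
have B0 ze y : 0 <= B ze y.
  have [a [b [r [a0 b0 E _]]]] := BK ze; rewrite E.
  by rewrite addr_ge0// mulr_ge0// sqr_ge0.
have mlin d1 (T1 : measurableType d1) (u : T1 -> N.-tuple R) : measurable_fun setT u ->
    measurable_fun setT (fun t => lincomb (upd (u t) i 0) x).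
  by move=> mu_; apply: measurable_lincomb => //; exact: measurable_upd.
rewrite (ge0_resample mZ mal indep i
  (H := fun z => (B (c * tnth z i) (lincomb (upd z i 0) x))%:E)); last 2 first.
- apply/measurable_EFinP; apply: (measurableT_comp mB (g := fun z : N.-tuple R =>
    (c * tnth z i, lincomb (upd z i 0) x))).
  apply: measurable_fun_pair; last exact: mlin.
  by apply: measurable_funM => //; exact: measurable_tnth.
- by move=> z; rewrite lee_fin.
pose g (p : T * T) := B (c * al p.2) (lincomb (upd (Zt p.1) i 0) x).
apply: (@le_trans _ _ (\int[P]_w \int[P]_w' (g (w, w'))%:E)%E).
  rewrite le_eqVlt; apply/orP; left; apply/eqP.
  by apply: eq_integral => w _; apply: eq_integral => w' _; rewrite tnth_upd eqxx upd_upd.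
rewrite (ge0_swap P P) => [| |p]; last exact: B0.
  apply: ge0_le_integralT => [w'|w']; first by apply: integral_ge0 => w _; rewrite lee_fin B0.
  have [a [b [r [a0 b0 E le_K]]]] := BK (c * al w').
  under eq_integral do rewrite /g /= E EFinD EFinM.
  have mq : measurable_fun setT (fun w => ((r + lincomb (upd (Zt w) i 0) x) ^+ 2)%:E).
    apply/measurable_EFinP; apply: measurable_funX; apply: measurable_funD => //.
    by apply: mlin; exact: measurable_coefs.
  rewrite ge0_integralD//; last 2 first.
  - by move=> w _; rewrite -EFinM lee_fin mulr_ge0 ?sqr_ge0.
  - exact: emeasurable_funM.
  rewrite ge0_integralZl//; last by move=> w _; rewrite lee_fin sqr_ge0.
  rewrite integral_cst1; apply: le_trans (_ : _ <= (a * (r ^+ 2 + 1) + b)%:E)%E _; last first.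
    by rewrite lee_fin.
  rewrite [leRHS]EFinD EFinM; apply: leeD2r; apply: lee_wpmul2l; rewrite ?lee_fin//.
  exact: (second_moment_upd mZ mal indep al4 al1 al2 ce).
apply: (measurableT_comp mB (g := fun p : T * T =>
  (c * al p.2, lincomb (upd (Zt p.1) i 0) x))).
apply: measurable_fun_pair; last first.
  by apply: mlin; apply: (measurableT_comp (measurable_coefs mZ)).
by apply: measurable_funM => //; exact: (measurableT_comp mal).
Qed.

(* Coefficients above the threshold are not expanded to first order, so that
   fourth moments suffice. *)
Definition remainder i s z x : R :=
  ker (s - lincomb z x) - ker (s - lincomb (upd z i 0) x) +
  (if `|c * tnth z i| <= 3 / 2 then c * tnth z i * e i x else 0) *
    dker (s - lincomb (upd z i 0) x).

Definition avg_ker s z : R := \int[U]_x ker (s - lincomb z x).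
Definition avg_dker i s z : R := \int[U]_x (e i x * dker (s - lincomb (upd z i 0) x)).

Let shift_lincomb i s z x :
  s - lincomb z x = s - lincomb (upd z i 0) x - c * tnth z i * e i x.
Proof. by rewrite (lincombE _ _ z i x); ring. Qed.

Lemma remainder_weighted i z x :
  (\int[mu]_s (weight s * remainder i s z x ^+ 2)%:E <=
   (rem_bound (c * tnth z i) (e i x) (lincomb (upd z i 0) x))%:E)%E.
Proof.
rewrite /rem_bound /remainder; case: ifP => _.
- under eq_integral do rewrite (shift_lincomb i _ z x).
  exact: weighted_ker_taylor.
- under eq_integral do rewrite (shift_lincomb i _ z x) mul0r addr0.
  exact: weighted_ker_diff.
Qed.

Let bmf_e i : bmf (e i).
Proof. by split => //; exists 1. Qed.

Let bmf_shift (h : R -> R) z : bmf h -> bmf (fun p : R * S => h (p.1 - lincomb z p.2)).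
Proof.
move=> bh; apply: bmf_comp bh _; apply: measurable_funB => //.
exact: measurable_lincomb.
Qed.

Let bmf_remainder i z : bmf (fun p : R * S => remainder i p.1 z p.2).
Proof.
apply: bmfD; first by apply: bmfB; apply: bmf_shift; exact: bmf_ker.
apply: bmfM; last by apply: bmf_shift; exact: bmf_dker.
case: (`|c * tnth z i| <= 3 / 2); last exact: bmf_cst.
apply: bmfM; first exact: bmf_cst.
exact: (bmf_comp (bmf_e i) measurable_snd).
Qed.

Let bmf_edker i z : bmf (fun p : R * S => e i p.2 * dker (p.1 - lincomb (upd z i 0) p.2)).
Proof.
apply: bmfM; last by apply: bmf_shift; exact: bmf_dker.
exact: (bmf_comp (bmf_e i) measurable_snd).
Qed.

Lemma avg_ker_diff i s z :
  (avg_ker s z - avg_ker s (upd z i 0)) ^+ 2 <=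
  6 * (c * tnth z i) ^+ 2 * avg_dker i s z ^+ 2 +
  6 / 5 * \int[U]_x (remainder i s z x ^+ 2).
Proof.
pose sm := `|c * tnth z i| <= 3 / 2.
have bk z' := bmf_pair1 s (bmf_shift z' (@bmf_ker R)).
have br := bmf_pair1 s (bmf_remainder i z).
have be := bmf_pair1 s (bmf_edker i z).
have E : avg_ker s z - avg_ker s (upd z i 0) =
    \int[U]_x remainder i s z x - (if sm then c * tnth z i else 0) * avg_dker i s z.
  rewrite /avg_ker -ExB// /avg_dker -ExZ// -ExB//; last by apply: bmfM => //; exact: bmf_cst.
  apply: eq_Rintegral => x _; rewrite /remainder -/sm.
  by case: sm; ring.
have := Ex_sqr U br; rewrite E.
move: (\int[U]_x (_ ^+ 2)) (\int[U]_x _) (avg_dker _ _ _) => r2 r l rr2.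
(* Young's inequality, unbalanced in favour of the remainder: 6/5 turns the constant 5/24 into 1/4,
   the coefficient of the fourth moment in the final bound, while the factor 6 only affects the
   numerical constant. *)
have h (p q : R) : (p - q) ^+ 2 <= 6 / 5 * p ^+ 2 + 6 * q ^+ 2.
  have := sqr_ge0 (p + 5 * q); rewrite sqrrD exprMn => ?.
  by rewrite sqrrB; lra.
apply: le_trans (h _ _) _; rewrite addrC lerD// ?ler_wpM2l//.
rewrite exprMn mulrA {E}; case: sm => //.
by rewrite expr0n /= mulr0 mul0r mulr_ge0 ?sqr_ge0// mulr_ge0 ?sqr_ge0.
Qed.

Lemma bmf_avg_ker : bmf (fun p : R * N.-tuple R => avg_ker p.1 p.2).
Proof.
apply: (bmf_Ex2 U (f := fun q : (R * N.-tuple R) * S => ker (q.1.1 - lincomb q.1.2 q.2))).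
apply: bmf_comp; first exact: bmf_ker.
apply: measurable_funB; first exact: (measurableT_comp measurable_fst).
by apply: measurable_lincomb => //; exact: (measurableT_comp measurable_snd).
Qed.

Definition dker_energy i z : \bar R := (\int[mu]_s (weight s * avg_dker i s z ^+ 2)%:E)%E.

Let weight_ge0 (s : R) : 0 <= weight s. Proof. exact/ltW/weight_gt0. Qed.

Let measurable_rem_bound d1 (T1 : measurableType d1) (ze ep y : T1 -> R) :
  measurable_fun setT ze -> measurable_fun setT ep -> measurable_fun setT y ->
  measurable_fun setT (fun t => rem_bound (ze t) (ep t) (y t)).
Proof.
move=> mze mep my; rewrite /rem_bound /sqk1_mean /sqk2_mean.
have mx : measurable_fun setT (fun t => ze t * ep t) by exact: measurable_funM.
have m2 : measurable_fun setT (fun t => (ze t * ep t) ^+ 2 / 3).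
  by apply: measurable_funM => //; exact: measurable_funX.
have m1 : measurable_fun setT
    (fun t => 1 + y t ^+ 2 + y t * (ze t * ep t) + (ze t * ep t) ^+ 2 / 3).
  apply: measurable_funD => //; apply: measurable_funD; last exact: measurable_funM.
  by apply: measurable_funD => //; exact: measurable_funX.
apply: measurable_fun_ifT.
- by apply: measurable_fun_ler => //; exact: measurableT_comp.
- apply: measurable_funM; first by apply: measurable_funM => //; exact: measurable_funX.
  apply: measurable_funD => //; apply: measurable_funM => //.
  exact: measurable_funM.
- apply: measurable_funM; first exact: measurable_funX.
  apply: measurable_funD => //; apply: measurable_funM => //.
  apply: measurable_funD => //; apply: measurable_funD => //.
  exact: measurable_funM.
Qed.

Let measurable_upd_lincomb d1 (T1 : measurableType d1) i (u : T1 -> N.-tuple R) (v : T1 -> S) :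
  measurable_fun setT u -> measurable_fun setT v ->
  measurable_fun setT (fun t => lincomb (upd (u t) i 0) (v t)).
Proof. by move=> mu_ mv; apply: measurable_lincomb => //; exact: measurable_upd. Qed.

Let measurable_coef d1 (T1 : measurableType d1) i (u : T1 -> N.-tuple R) :
  measurable_fun setT u -> measurable_fun setT (fun t => c * tnth (u t) i).
Proof.
move=> mu_; apply: measurable_funM => //.
exact: (measurableT_comp (measurable_tnth i) mu_).
Qed.

Let mZt := measurable_coefs mZ.
Let mZt1 : measurable_fun setT (fun p : T * S => Zt p.1).
Proof. exact: (measurableT_comp mZt). Qed.
Let me2 i : measurable_fun setT (fun p : T * S => e i p.2).
Proof. exact: (measurableT_comp (me i)). Qed.

Lemma integral_rem_bound i :
  (\int[P]_w \int[U]_x (rem_bound (c * tnth (Zt w) i) (e i x)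
     (lincomb (upd (Zt w) i 0) x))%:E <=
   \int[U]_x (5 / 24 * (c ^+ 4 * m4) * e i x ^+ 2)%:E)%E.
Proof.
pose g (p : T * S) := rem_bound (c * tnth (Zt p.1) i) (e i p.2) (lincomb (upd (Zt p.1) i 0) p.2).
rewrite -[leLHS]/(\int[P]_w \int[U]_x (g (w, x))%:E)%E.
rewrite (ge0_swap P U) => [| |p]; last exact: rem_bound_ge0.
  apply: ge0_le_integralT => x.
    by apply: integral_ge0 => w _; rewrite lee_fin rem_bound_ge0.
  apply: le_trans (@resample_quad i x (fun ze y => rem_bound ze (e i x) y)
    (fun ze => 5 / 24 * ze ^+ 4 * e i x ^+ 2) _ _) _.
  - exact: measurable_rem_bound.
  - by move=> ze; exact: rem_bound_quad.
  - have E w : 5 / 24 * (c * al w) ^+ 4 * e i x ^+ 2 =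
        (5 / 24 * c ^+ 4 * e i x ^+ 2) * al w ^+ 4 by ring.
    under eq_integral do rewrite E EFinM.
    rewrite integralZl// int_al4 -EFinM lee_fin le_eqVlt; apply/orP; left.
    by apply/eqP; ring.
by apply: measurable_rem_bound => //; [exact: measurable_coef|exact: measurable_upd_lincomb].
Qed.

Let bmf_avg_dker i : bmf (fun p : R * N.-tuple R => avg_dker i p.1 p.2).
Proof.
apply: (bmf_Ex2 U (f := fun q : (R * N.-tuple R) * S =>
  e i q.2 * dker (q.1.1 - lincomb (upd q.1.2 i 0) q.2))).
apply: bmfM; first exact: (bmf_comp (bmf_e i) measurable_snd).
apply: bmf_comp; first exact: bmf_dker.
apply: measurable_funB; first exact: (measurableT_comp measurable_fst).
by apply: measurable_upd_lincomb => //; exact: (measurableT_comp measurable_snd).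
Qed.

Let measurable_weighted_sqr d1 (T1 : measurableType d1) (h : R * T1 -> R) :
  measurable_fun setT h -> measurable_fun setT (fun p : T1 * R => weight p.2 * h (p.2, p.1) ^+ 2).
Proof.
move=> mh; apply: measurable_funM.
  exact: (measurableT_comp (@measurable_weight R)).
apply: measurable_funX.
exact: (measurableT_comp mh (@measurable_swap _ _ _ _)).
Qed.

Let measurable_dker_energy i : measurable_fun setT (dker_energy i).
Proof.
apply: (measurable_ge0_integral mu
  (g := fun p : N.-tuple R * R => weight p.2 * avg_dker i p.2 p.1 ^+ 2)).
  exact: (measurable_weighted_sqr (bmf_measurable (bmf_avg_dker i))).
by move=> p; rewrite mulr_ge0 ?sqr_ge0.
Qed.

Let dker_energy_ge0 i z : (0 <= dker_energy i z)%E.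
Proof. by apply: integral_ge0 => s _; rewrite lee_fin mulr_ge0 ?sqr_ge0. Qed.

Let avg_dker_upd i s z v : avg_dker i s (upd z i v) = avg_dker i s z.
Proof. by apply: eq_Rintegral => x _; rewrite upd_upd. Qed.

Let dker_energy_upd i z v : dker_energy i (upd z i v) = dker_energy i z.
Proof. by apply: eq_integral => s _; rewrite avg_dker_upd. Qed.

(** [dker_energy i] does not see coefficient [i], so resampling factors out the square of that
    coefficient, whose mean is 1. *)
Lemma integral_coef_energy i :
  (\int[P]_w ((6 * (c * tnth (Zt w) i) ^+ 2)%:E * dker_energy i (Zt w)) =
   (6 * c ^+ 2)%:E * \int[P]_w dker_energy i (Zt w))%E.
Proof.
rewrite (ge0_resample mZ mal indep i
  (H := fun z => ((6 * (c * tnth z i) ^+ 2)%:E * dker_energy i z)%E)); last 2 first.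
- apply: emeasurable_funM => //; apply/measurable_EFinP; apply: measurable_funM => //.
  by apply: measurable_funX; exact: measurable_coef.
- by move=> z; rewrite mule_ge0// lee_fin mulr_ge0 ?sqr_ge0.
have mE : measurable_fun setT (fun w => dker_energy i (Zt w)).
  exact: (measurableT_comp (@measurable_dker_energy i) mZt).
rewrite -ge0_integralZl//; last by rewrite lee_fin mulr_ge0 ?sqr_ge0.
apply: eq_integral => w _.
under eq_integral do rewrite dker_energy_upd tnth_upd eqxx muleC.
rewrite ge0_integralZl//; last 2 first.
- apply/measurable_EFinP; apply: measurable_funM => //; apply: measurable_funX.
  exact: measurable_funM.
- by move=> w' _; rewrite lee_fin mulr_ge0 ?sqr_ge0.
rewrite muleC; congr (_ * _)%E.
transitivity (\int[P]_w' ((6 * c ^+ 2)%:E * (al w' ^+ 2)%:E))%E.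
  by apply: eq_integral => w' _; rewrite -EFinM; congr EFin; ring.
rewrite ge0_integralZl//; last 3 first.
- by apply/measurable_EFinP; exact: measurable_funX.
- by move=> w' _; rewrite lee_fin sqr_ge0.
- by rewrite lee_fin mulr_ge0 ?sqr_ge0.
by rewrite al2 mule1.
Qed.

(** With g the sum of a_i e_i, the integral of (h - 2 g)^2 is nonnegative; the factor 2 compensates
    the squared norm 1/2 of the e_i. *)
Lemma bessel (h : S -> R) : bmf h ->
  \sum_(i < N) (\int[U]_x (e i x * h x)) ^+ 2 <= 2^-1 * \int[U]_x (h x ^+ 2).
Proof.
move=> bh; pose a i := \int[U]_x (e i x * h x).
have beh i : bmf (fun x => e i x * h x) by exact: bmfM.
have bee i j : bmf (fun x => e i x * e j x) by exact: bmfM.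
pose g x := \sum_(i < N) a i * e i x.
have bg : bmf g by apply: bmf_sum => i; apply: bmfM => //; exact: bmf_cst.
have Igh : \int[U]_x (g x * h x) = \sum_i a i ^+ 2.
  transitivity (\int[U]_x (\sum_i a i * (e i x * h x))).
    by apply: eq_Rintegral => x _; rewrite mulr_suml; apply: eq_bigr => i _; rewrite mulrA.
  rewrite Ex_sum; last by move=> i; apply: bmfM => //; exact: bmf_cst.
  by apply: eq_bigr => i _; rewrite ExZ// expr2.
have Igg : \int[U]_x (g x ^+ 2) = 2^-1 * \sum_i a i ^+ 2.
  transitivity (\int[U]_x (\sum_i \sum_j (a i * a j) * (e i x * e j x))).
    apply: eq_Rintegral => x _; rewrite expr2 /g mulr_suml; apply: eq_bigr => i _.
    by rewrite mulr_sumr; apply: eq_bigr => j _; ring.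
  have baa i j : bmf (fun x => a i * a j * (e i x * e j x)).
    by apply: bmfM => //; exact: bmf_cst.
  rewrite Ex_sum; last by move=> i; exact: bmf_sum.
  rewrite mulr_sumr; apply: eq_bigr => i _.
  rewrite Ex_sum// (bigD1 i)//= big1 ?addr0 => [|j ji].
    by rewrite ExZ// orth eqxx; ring.
  by rewrite ExZ// orth eq_sym (negbTE ji) mulr0.
have : 0 <= \int[U]_x ((h x - 2 * g x) ^+ 2).
  by apply: Rintegral_ge0 => x _; exact: sqr_ge0.
have bgh := bmfM (bmf_cst _ 4) (bmfM bg bh).
have bg2 := bmfM (bmf_cst _ 4) (bmfX 2 bg).
have bh2 := bmfX 2 bh.
rewrite (_ : (fun x => (h x - 2 * g x) ^+ 2) =
    fun x => h x ^+ 2 - 4 * (g x * h x) + 4 * g x ^+ 2); last first.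
  by apply/funext => x; ring.
rewrite ExD// ?ExB// ?ExZ//; [|exact: bmfX|exact: bmfM|exact: bmfB].
by rewrite Igh Igg -/a; lra.
Qed.

Let weighted_swap (h : R * S -> R) : bmf h ->
  (\int[mu]_s (weight s * \int[U]_x (h (s, x) ^+ 2))%:E =
   \int[U]_x \int[mu]_s (weight s * h (s, x) ^+ 2)%:E)%E.
Proof.
move=> bh; pose g (p : R * S) := weight p.1 * h p ^+ 2.
rewrite -[RHS]/(\int[U]_x \int[mu]_s (g (s, x))%:E)%E -(ge0_swap mu U).
- apply: eq_integral => s _; rewrite /g /=.
  have bhs := bmfX 2 (bmf_pair1 s bh).
  by rewrite -ExZ// EFin_Ex//; apply: bmfM => //; exact: bmf_cst.
- apply: measurable_funM; first exact: (measurableT_comp (@measurable_weight R)).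
  by apply: measurable_funX; exact: bmf_measurable.
- by move=> p; rewrite mulr_ge0 ?sqr_ge0.
Qed.

(** Bessel's inequality needs the same function against every e_i, whereas the argument of [dker] in
    [avg_dker i] omits a term depending on i. This gap is the error of restoring the full sum. *)
Let dker_gap i s z x : R :=
  e i x * (dker (s - lincomb z x) - dker (s - lincomb (upd z i 0) x)).

Let bmf_dker_gap i z : bmf (fun p : R * S => dker_gap i p.1 z p.2).
Proof.
apply: bmfM; first exact: (bmf_comp (bmf_e i) measurable_snd).
by apply: bmfB; apply: bmf_shift; exact: bmf_dker.
Qed.

Lemma sum_avg_dker s z :
  \sum_(i < N) avg_dker i s z ^+ 2 <=
  \int[U]_x (dker (s - lincomb z x) ^+ 2) +
  \sum_(i < N) 2 * \int[U]_x (dker_gap i s z x ^+ 2).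
Proof.
have bd := bmf_pair1 s (bmf_shift z (@bmf_dker R)).
have B := bessel bd.
apply: (@le_trans _ _ (\sum_(i < N) (2 * (\int[U]_x (e i x * dker (s - lincomb z x))) ^+ 2 +
   2 * \int[U]_x (dker_gap i s z x ^+ 2)))); last first.
  by rewrite big_split /= -mulr_sumr lerD2r; lra.
apply: ler_sum => i _.
have bg := bmf_pair1 s (bmf_dker_gap i z).
have be : bmf (fun x => e i x * dker (s - lincomb z x)) by exact: bmfM.
have -> : avg_dker i s z = \int[U]_x (e i x * dker (s - lincomb z x)) -
    \int[U]_x dker_gap i s z x.
  by rewrite -ExB//; apply: eq_Rintegral => x _; rewrite /dker_gap; ring.
have h (p q r : R) : q ^+ 2 <= p -> (r - q) ^+ 2 <= 2 * r ^+ 2 + 2 * p.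
  by move=> qp; have := sqr_ge0 (r + q); rewrite sqrrD sqrrB; lra.
exact: h (Ex_sqr U bg).
Qed.

Let gap_bound i z x : R :=
  e i x ^+ 2 * ((c * tnth z i * e i x) ^+ 2 *
    sqk2_mean (lincomb (upd z i 0) x) (c * tnth z i * e i x)).

Let gap_bound_ge0 i z x : 0 <= gap_bound i z x.
Proof. by rewrite /gap_bound mulr_ge0 ?sqr_ge0// mulr_ge0 ?sqr_ge0// sqk2_mean_ge0. Qed.

(** The Bessel part is integrated in s exactly by [weighted_dker]; the gap is an increment of [dker]
    of step c z_i e_i(x), to which [weighted_dker_diff] applies. *)
Lemma sum_dker_energy z :
  (\sum_(i < N) dker_energy i z <=
   \int[U]_x (sqk1_mean (lincomb z x) 0)%:E +
   \sum_(i < N) 2%R%:E * \int[U]_x (gap_bound i z x)%:E)%E.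
Proof.
have md (h : R -> R) : measurable_fun setT h -> measurable_fun setT (fun s => (weight s * h s)%:E).
  move=> mh; apply/measurable_EFinP; apply: measurable_funM => //.
  exact: measurable_weight.
have m1 i : measurable_fun setT (fun s => (weight s * avg_dker i s z ^+ 2)%:E).
  apply: md; apply: measurable_funX.
  exact: bmf_measurable (bmf_pair2 z (bmf_avg_dker i)).
have bd := bmf_shift z (@bmf_dker R).
have m2 : measurable_fun setT (fun s => (weight s * \int[U]_x (dker (s - lincomb z x) ^+ 2))%:E).
  by apply: md; exact: bmf_measurable (bmf_Ex2 U (bmfX 2 bd)).
have m3 i : measurable_fun setT (fun s => (weight s * \int[U]_x (dker_gap i s z x ^+ 2))%:E).
  by apply: md; exact: bmf_measurable (bmf_Ex2 U (bmfX 2 (bmf_dker_gap i z))).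
have Q0 (h : S -> R) : 0 <= \int[U]_x (h x ^+ 2).
  by apply: Rintegral_ge0 => x _; exact: sqr_ge0.
rewrite -ge0_integral_sum//; last first.
  by move=> i s _; rewrite lee_fin mulr_ge0 ?sqr_ge0.
apply: (@le_trans _ _ (\int[mu]_s ((weight s * \int[U]_x (dker (s - lincomb z x) ^+ 2))%:E +
    \sum_(i < N) 2%R%:E * (weight s * \int[U]_x (dker_gap i s z x ^+ 2))%:E))%E).
  apply: ge0_le_integralT => s.
    by apply: sume_ge0 => i _; rewrite lee_fin mulr_ge0 ?sqr_ge0.
  have -> : (\sum_(i < N) 2%R%:E * (weight s * \int[U]_x (dker_gap i s z x ^+ 2))%:E =
      (weight s * \sum_(i < N) 2 * \int[U]_x (dker_gap i s z x ^+ 2))%:E)%E.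
    rewrite mulr_sumr -sumEFin; apply: eq_bigr => i _.
    by rewrite -EFinM mulrCA.
  rewrite sumEFin -EFinD lee_fin -mulr_sumr -mulrDr ler_wpM2l//.
  exact: sum_avg_dker.
rewrite ge0_integralD//; last 3 first.
- by move=> s _; rewrite lee_fin mulr_ge0.
- by move=> s _; apply: sume_ge0 => i _; rewrite -EFinM lee_fin mulr_ge0// mulr_ge0.
- by apply: emeasurable_sum => i; apply: emeasurable_funM; [exact: measurable_cst|exact: m3].
rewrite ge0_integral_sum//; last 2 first.
- by move=> i; apply: emeasurable_funM; [exact: measurable_cst|exact: m3].
- by move=> i s _; rewrite -EFinM lee_fin mulr_ge0// mulr_ge0.
apply: leeD.
  rewrite (weighted_swap bd); apply: ge0_le_integralT => x.
    by apply: integral_ge0 => s _; rewrite lee_fin mulr_ge0 ?sqr_ge0.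
  by rewrite /= weighted_dker.
apply: lee_sum => i _; rewrite (ge0_integralZl mu measurableT (m3 i)) ?lee_fin//; last first.
  by move=> s _; rewrite lee_fin mulr_ge0.
apply: lee_wpmul2l; first by rewrite lee_fin.
rewrite (weighted_swap (bmf_dker_gap i z)); apply: ge0_le_integralT => x.
  by apply: integral_ge0 => s _; rewrite lee_fin mulr_ge0 ?sqr_ge0.
have E s : weight s * dker_gap i s z x ^+ 2 = e i x ^+ 2 * (weight s *
    (dker (s - lincomb (upd z i 0) x - c * tnth z i * e i x) -
     dker (s - lincomb (upd z i 0) x)) ^+ 2).
  by rewrite /dker_gap (shift_lincomb i s z x); ring.
under eq_integral do rewrite E EFinM.
rewrite ge0_integralZl//; last 3 first.
- apply: md; apply: measurable_funX; apply: measurable_funB.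
    apply: (measurableT_comp (bmf_measurable (@bmf_dker R))).
    by apply: measurable_funB => //; exact: measurable_funB.
  by apply: (measurableT_comp (bmf_measurable (@bmf_dker R))); exact: measurable_funB.
- by move=> s _; rewrite lee_fin mulr_ge0 ?sqr_ge0.
- by rewrite lee_fin sqr_ge0.
rewrite /gap_bound [leRHS]EFinM; apply: lee_wpmul2l; first by rewrite lee_fin sqr_ge0.
exact: weighted_dker_diff.
Qed.

Let sum_e2 : (\sum_(i < N) \int[U]_x (c ^+ 2 * e i x ^+ 2)%:E = 1)%E.
Proof.
rewrite -ge0_integral_sum//.
- transitivity (\int[U]_x (1%R)%:E)%E; last by rewrite integral_cst1.
  by apply: eq_integral => x _; rewrite sumEFin -mulr_sumr ce.
- move=> i; apply/measurable_EFinP; apply: measurable_funM => //.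
  exact: measurable_funX.
- by move=> i x _; rewrite lee_fin mulr_ge0 ?sqr_ge0.
Qed.

Let sum_cst_e2 (k : R) : 0 <= k ->
  (\sum_(i < N) \int[U]_x (k * (c ^+ 2 * e i x ^+ 2))%:E = k%:E)%E.
Proof.
move=> k0; rewrite -[RHS]mule1 -sum_e2 ge0_sume_distrr; last first.
  by move=> i _; apply: integral_ge0 => x _; rewrite lee_fin mulr_ge0 ?sqr_ge0.
apply: eq_bigr => i _; rewrite -ge0_integralZl//.
- apply/measurable_EFinP; apply: measurable_funM => //.
  exact: measurable_funX.
- by move=> x _; rewrite lee_fin mulr_ge0 ?sqr_ge0.
Qed.

Let m4_ge0 : 0 <= m4.
Proof. by apply: Rintegral_ge0 => w _; rewrite (exprM _ 2 2) sqr_ge0. Qed.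

Lemma integral_gap_bound i :
  (\int[P]_w \int[U]_x (gap_bound i (Zt w) x)%:E <=
   \int[U]_x ((31 / 64 + c ^+ 2 * m4 / 16) * (c ^+ 2 * e i x ^+ 2))%:E)%E.
Proof.
pose g (p : T * S) := gap_bound i (Zt p.1) p.2.
rewrite -[leLHS]/(\int[P]_w \int[U]_x (g (w, x))%:E)%E.
rewrite (ge0_swap P U) => [| |p]; last exact: gap_bound_ge0.
  apply: ge0_le_integralT => x.
    by apply: integral_ge0 => w _; rewrite lee_fin gap_bound_ge0.
  pose B ze y := e i x ^+ 2 * ((ze * e i x) ^+ 2 * sqk2_mean y (ze * e i x)).
  apply: le_trans (@resample_quad i x B
    (fun ze => (31 / 64 * ze ^+ 2 + ze ^+ 4 / 16) * e i x ^+ 2) _ _) _.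
  - have mx : measurable_fun setT (fun p : R * R => p.1 * e i x).
      exact: measurable_funM.
    rewrite /B /sqk2_mean; apply: measurable_funM => //; apply: measurable_funM.
      exact: measurable_funX.
    apply: measurable_funD => //; apply: measurable_funM => //; apply: measurable_funM => //.
    apply: measurable_funD; last by apply: measurable_funM => //; exact: measurable_funX.
    apply: measurable_funD; last exact: measurable_funM.
    by apply: measurable_funD => //; exact: measurable_funX.
  - by move=> ze; exact: dker_bound_quad.
  - have -> : (\int[P]_w ((31 / 64 * (c * al w) ^+ 2 + (c * al w) ^+ 4 / 16) * e i x ^+ 2)%:E =
      \int[P]_w ((31 / 64 * c ^+ 2 * e i x ^+ 2)%:E * (al w ^+ 2)%:E +
      (c ^+ 4 / 16 * e i x ^+ 2)%:E * (al w ^+ 4)%:E))%E.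
      by apply: eq_integral => w _; rewrite -!EFinM -EFinD; congr EFin; field.
    have i2 : P.-integrable setT (fun w => (al w ^+ 2)%:E) := integrable_alX mal al4 (isT : (2 <= 4)%N).
    rewrite integralD//; [|exact: integrableZl|exact: integrableZl].
    rewrite !integralZl// al2 int_al4 mule1 -EFinM -EFinD lee_fin le_eqVlt.
    by apply/orP; left; apply/eqP; field.
have mY : measurable_fun setT (fun p : T * S => lincomb (upd (Zt p.1) i 0) p.2).
  exact: measurable_upd_lincomb.
have mx : measurable_fun setT (fun p : T * S => c * tnth (Zt p.1) i * e i p.2).
  by apply: measurable_funM => //; exact: measurable_coef.
rewrite /g /gap_bound /sqk2_mean; apply: measurable_funM; first exact: measurable_funX.
apply: measurable_funM; first exact: measurable_funX.
apply: measurable_funD => //; apply: measurable_funM => //; apply: measurable_funM => //.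
apply: measurable_funD; last by apply: measurable_funM => //; exact: measurable_funX.
apply: measurable_funD; last exact: measurable_funM.
by apply: measurable_funD => //; exact: measurable_funX.
Qed.

(** [sqk1_mean y 0] is (1 + y)^2 / 16 + 13/64, and (1 + Y)^2 has mean 2 for Y centred of variance 1:
    2/16 + 13/64 = 21/64. *)
Lemma integral_sqk1_lincomb :
  (\int[P]_w \int[U]_x (sqk1_mean (lincomb (Zt w) x) 0)%:E = (21 / 64)%:E)%E.
Proof.
pose g (p : T * S) := sqk1_mean (lincomb (Zt p.1) p.2) 0.
have ml : measurable_fun setT (fun p : T * S => lincomb (Zt p.1) p.2).
  exact: measurable_lincomb.
have mg : measurable_fun setT g.
  rewrite (_ : g = fun p => 16^-1 * (1 + lincomb (Zt p.1) p.2) ^+ 2 + 13 / 64); last first.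
    by apply/funext => p; rewrite /g sqk1_meanE; field.
  apply: measurable_funD => //; apply: measurable_funM => //; apply: measurable_funX.
  exact: measurable_funD.
rewrite -[LHS]/(\int[P]_w \int[U]_x (g (w, x))%:E)%E.
rewrite (ge0_swap P U) => [|//|p]; last exact: sqk1_mean_ge0.
transitivity (\int[U]_x (21 / 64)%:E)%E; last by rewrite integral_cst1.
apply: eq_integral => x _.
transitivity (\int[P]_w ((16^-1)%:E * ((1 + lincomb (Zt w) x) ^+ 2)%:E + (13 / 64)%:E))%E.
  by apply: eq_integral => w _; rewrite -EFinM -EFinD /g sqk1_meanE; congr EFin; field.
have m1 : measurable_fun setT (fun w => ((1 + lincomb (Zt w) x) ^+ 2)%:E).
  apply/measurable_EFinP; apply: measurable_funX; apply: measurable_funD => //.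
  exact: measurable_lincomb.
rewrite ge0_integralD//; last 2 first.
- by move=> w _; rewrite -EFinM lee_fin mulr_ge0 ?sqr_ge0.
- exact: emeasurable_funM.
rewrite ge0_integralZl//; last by move=> w _; rewrite lee_fin sqr_ge0.
rewrite (second_moment mZ mal indep al4 al1 al2 ce) integral_cst1 -EFinM -EFinD.
by congr EFin; field.
Qed.

(** 167/128 = 21/64 + 2 (31/64 + 1/256), the last fraction being c^2 [m4] / 16 under the smallness
    assumption. This is where that assumption enters the variance bound. *)
Lemma integral_sum_dker_energy : c ^+ 2 * m4 <= 16^-1 ->
  (\sum_(i < N) \int[P]_w dker_energy i (Zt w) <= (167 / 128)%:E)%E.
Proof.
move=> cm4.
have mE i : measurable_fun setT (fun w => dker_energy i (Zt w)).
  exact: (measurableT_comp (@measurable_dker_energy i) mZt).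
have mx i : measurable_fun setT (fun p : T * S => c * tnth (Zt p.1) i * e i p.2).
  by apply: measurable_funM => //; exact: measurable_coef.
have mY i : measurable_fun setT (fun p : T * S => lincomb (upd (Zt p.1) i 0) p.2).
  exact: measurable_upd_lincomb.
have mG i : measurable_fun setT (fun w => \int[U]_x (gap_bound i (Zt w) x)%:E)%E.
  apply: (measurable_ge0_integral U (g := fun p : T * S => gap_bound i (Zt p.1) p.2)).
    rewrite /gap_bound /sqk2_mean; apply: measurable_funM; first exact: measurable_funX.
    apply: measurable_funM; first exact: measurable_funX.
    apply: measurable_funD => //; apply: measurable_funM => //; apply: measurable_funM => //.
    apply: measurable_funD; last by apply: measurable_funM => //; exact: measurable_funX.
    apply: measurable_funD; last exact: measurable_funM.
    by apply: measurable_funD => //; exact: measurable_funX.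
  by move=> p; exact: gap_bound_ge0.
have mS : measurable_fun setT (fun w => \int[U]_x (sqk1_mean (lincomb (Zt w) x) 0)%:E)%E.
  apply: (measurable_ge0_integral U (g := fun p : T * S => sqk1_mean (lincomb (Zt p.1) p.2) 0)).
    have ml : measurable_fun setT (fun p : T * S => lincomb (Zt p.1) p.2).
      exact: measurable_lincomb.
    rewrite /sqk1_mean; apply: measurable_funD => //; apply: measurable_funM => //.
    apply: measurable_funD => //; apply: measurable_funD; last exact: measurable_funM.
    apply: measurable_funD => //; apply: measurable_funD; last exact: measurable_funM.
    by apply: measurable_funD => //; exact: measurable_funX.
  by move=> p; exact: sqk1_mean_ge0.
have G0 i w : (0 <= \int[U]_x (gap_bound i (Zt w) x)%:E)%E.
  by apply: integral_ge0 => x _; rewrite lee_fin gap_bound_ge0.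
rewrite -ge0_integral_sum//.
apply: (@le_trans _ _ (\int[P]_w (\int[U]_x (sqk1_mean (lincomb (Zt w) x) 0)%:E +
    \sum_(i < N) 2%R%:E * \int[U]_x (gap_bound i (Zt w) x)%:E))%E).
  by apply: ge0_le_integralT => w; [exact: sume_ge0|exact: sum_dker_energy].
rewrite ge0_integralD//; last 3 first.
- by move=> w _; apply: integral_ge0 => x _; rewrite lee_fin sqk1_mean_ge0.
- by move=> w _; apply: sume_ge0 => i _; rewrite mule_ge0 ?lee_fin.
- apply: emeasurable_sum => i; apply: emeasurable_funM; first exact: measurable_cst.
  exact: mG.
have K0 : 0 <= 31 / 64 + c ^+ 2 * m4 / 16.
  by rewrite addr_ge0// divr_ge0// mulr_ge0 ?sqr_ge0.
rewrite integral_sqk1_lincomb ge0_integral_sum//; last 2 first.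
- move=> i; apply: emeasurable_funM; first exact: measurable_cst.
  exact: mG.
- by move=> i w _; rewrite mule_ge0 ?lee_fin.
apply: (@le_trans _ _ ((21 / 64)%:E + 2%R%:E * (31 / 64 + c ^+ 2 * m4 / 16)%:E)%E); last first.
  by rewrite -EFinM -EFinD lee_fin; lra.
apply: leeD2l; rewrite -[X in (_ <= _ * X)%E]sum_cst_e2//.
rewrite ge0_sume_distrr; last first.
  by move=> i _; apply: integral_ge0 => x _; rewrite lee_fin mulr_ge0// mulr_ge0 ?sqr_ge0.
apply: lee_sum => i _; rewrite (ge0_integralZl P measurableT (mG i)) ?lee_fin//.
by apply: lee_wpmul2l; rewrite ?lee_fin//; exact: integral_gap_bound.
Qed.

Lemma weighted_increment i z :
  (\int[mu]_s (weight s * (avg_ker s z - avg_ker s (upd z i 0)) ^+ 2)%:E <=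
   (6 * (c * tnth z i) ^+ 2)%:E * dker_energy i z +
   (6 / 5)%:E * \int[U]_x (rem_bound (c * tnth z i) (e i x) (lincomb (upd z i 0) x))%:E)%E.
Proof.
have br := bmf_remainder i z.
have m1 : measurable_fun setT (fun s => (weight s * avg_dker i s z ^+ 2)%:E).
  apply/measurable_EFinP; apply: measurable_funM; first exact: measurable_weight.
  by apply: measurable_funX; exact: bmf_measurable (bmf_pair2 z (bmf_avg_dker i)).
have m2 : measurable_fun setT (fun s => (weight s * \int[U]_x (remainder i s z x ^+ 2))%:E).
  apply/measurable_EFinP; apply: measurable_funM; first exact: measurable_weight.
  exact: bmf_measurable (bmf_Ex2 U (bmfX 2 br)).
have Q0 s : 0 <= \int[U]_x (remainder i s z x ^+ 2).
  by apply: Rintegral_ge0 => x _; exact: sqr_ge0.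
have k1 : (0 <= (6 * (c * tnth z i) ^+ 2)%:E)%E by rewrite lee_fin mulr_ge0 ?sqr_ge0.
have k2 : (0 <= (6 / 5 : R)%:E)%E by rewrite lee_fin divr_ge0.
apply: (@le_trans _ _ (\int[mu]_s ((6 * (c * tnth z i) ^+ 2)%:E * (weight s * avg_dker i s z ^+ 2)%:E +
   (6 / 5)%:E * (weight s * \int[U]_x (remainder i s z x ^+ 2))%:E))%E).
  apply: ge0_le_integralT => s; first by rewrite lee_fin mulr_ge0 ?sqr_ge0.
  rewrite -!EFinM -EFinD lee_fin.
  apply: le_trans (ler_wpM2l (weight_ge0 s) (avg_ker_diff i s z)) _.
  by rewrite le_eqVlt; apply/orP; left; apply/eqP; ring.
rewrite ge0_integralD//; last 4 first.
- by move=> s _; rewrite mule_ge0// lee_fin mulr_ge0 ?sqr_ge0.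
- by apply: emeasurable_funM => //; exact: measurable_cst.
- by move=> s _; rewrite mule_ge0// lee_fin mulr_ge0.
- by apply: emeasurable_funM => //; exact: measurable_cst.
rewrite !ge0_integralZl//; last 2 first.
- by move=> s _; rewrite lee_fin mulr_ge0.
- by move=> s _; rewrite lee_fin mulr_ge0 ?sqr_ge0.
apply: leeD2l; apply: lee_wpmul2l => //.
rewrite (weighted_swap br); apply: ge0_le_integralT => x.
  by apply: integral_ge0 => s _; rewrite lee_fin mulr_ge0 ?sqr_ge0.
exact: remainder_weighted.
Qed.

Theorem weighted_variance : c ^+ 2 * m4 <= 16^-1 ->
  (\int[mu]_s (weight s * \int[P]_w ((avg_ker s (Zt w) - \int[P]_v avg_ker s (Zt v)) ^+ 2))%:E
   <= (c ^+ 2 * (m4 / 4 + 10))%:E)%E.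
Proof.
move=> cm4.
have bA i : bmf (fun p : R * N.-tuple R => avg_ker p.1 (upd p.2 i 0)).
  apply: (bmf_comp bmf_avg_ker (g := fun p : R * N.-tuple R => (p.1, upd p.2 i 0))).
  by apply: measurable_fun_pair => //; exact: measurable_upd.
pose g i (p : R * T) := weight p.1 * (avg_ker p.1 (Zt p.2) - avg_ker p.1 (upd (Zt p.2) i 0)) ^+ 2.
have bdiff i : bmf (fun p : R * T => avg_ker p.1 (Zt p.2) - avg_ker p.1 (upd (Zt p.2) i 0)).
  have mz : measurable_fun setT (fun p : R * T => (p.1, Zt p.2)).
    by apply: measurable_fun_pair => //; exact: (measurableT_comp mZt).
  by apply: bmfB; [exact: (bmf_comp bmf_avg_ker mz)|exact: (bmf_comp (bA i) mz)].
have mg i : measurable_fun setT (g i).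
  apply: measurable_funM; first exact: (measurableT_comp (@measurable_weight R)).
  by apply: measurable_funX; exact: bmf_measurable.
have g0 i p : 0 <= g i p by rewrite mulr_ge0 ?sqr_ge0.
apply: (@le_trans _ _ (\int[mu]_s \sum_(i < N) \int[P]_w (g i (s, w))%:E)%E).
  apply: ge0_le_integralT => s.
    by rewrite lee_fin mulr_ge0// Rintegral_ge0// => w _; exact: sqr_ge0.
  have H := efron_stein mZ mal indep (F := avg_ker s)
    (A := fun i z => avg_ker s (upd z i 0)) (bmf_pair1 s bmf_avg_ker)
    (fun i => bmf_pair1 s (bA i)) (fun i z x => congr1 (avg_ker s) (upd_upd z i x 0)).
  apply: le_trans (_ : _ <= (weight s * \sum_(i < N) \int[P]_w ((avg_ker s (Zt w) -
    avg_ker s (upd (Zt w) i 0)) ^+ 2))%:E)%E _.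
    by rewrite lee_fin ler_wpM2l.
  rewrite mulr_sumr -sumEFin; apply: lee_sum => i _.
  have bs := bmfX 2 (bmf_pair1 s (bdiff i)).
  by rewrite -ExZ// EFin_Ex//; apply: bmfM => //; exact: bmf_cst.
rewrite ge0_integral_sum//; last 2 first.
- by move=> i; exact: (measurable_ge0_integral P (mg i) (g0 i)).
- by move=> i s _; apply: integral_ge0 => w _; rewrite lee_fin.
have mE i : measurable_fun setT (fun w => dker_energy i (Zt w)).
  exact: (measurableT_comp (@measurable_dker_energy i) mZt).
have mR i : measurable_fun setT (fun w => \int[U]_x (rem_bound (c * tnth (Zt w) i) (e i x)
     (lincomb (upd (Zt w) i 0) x))%:E)%E.
  apply: (measurable_ge0_integral U (g := fun p : T * S => rem_bound (c * tnth (Zt p.1) i)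
    (e i p.2) (lincomb (upd (Zt p.1) i 0) p.2))).
    by apply: measurable_rem_bound => //; [exact: measurable_coef|exact: measurable_upd_lincomb].
  by move=> p; exact: rem_bound_ge0.
have R0 i w : (0 <= \int[U]_x (rem_bound (c * tnth (Zt w) i) (e i x)
     (lincomb (upd (Zt w) i 0) x))%:E)%E.
  by apply: integral_ge0 => x _; rewrite lee_fin rem_bound_ge0.
have mcE i : measurable_fun setT (fun w => (6 * (c * tnth (Zt w) i) ^+ 2)%:E * dker_energy i (Zt w))%E.
  apply: emeasurable_funM => //; apply/measurable_EFinP; apply: measurable_funM => //.
  by apply: measurable_funX; exact: measurable_coef.
have k6 : (0 <= (6 / 5 : R)%:E)%E by rewrite lee_fin divr_ge0.
have k1 : (0 <= (6 * c ^+ 2)%:E)%E by rewrite lee_fin mulr_ge0 ?sqr_ge0.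
apply: (@le_trans _ _ (\sum_(i < N) ((6 * c ^+ 2)%:E * \int[P]_w dker_energy i (Zt w) +
    \int[U]_x (c ^+ 2 * m4 / 4 * (c ^+ 2 * e i x ^+ 2))%:E))%E).
  apply: lee_sum => i _; rewrite (ge0_swap mu P (mg i) (g0 i)).
  apply: (@le_trans _ _ (\int[P]_w ((6 * (c * tnth (Zt w) i) ^+ 2)%:E * dker_energy i (Zt w) +
     (6 / 5)%:E * \int[U]_x (rem_bound (c * tnth (Zt w) i) (e i x)
     (lincomb (upd (Zt w) i 0) x))%:E))%E).
    apply: ge0_le_integralT => w.
      by apply: integral_ge0 => s _; rewrite lee_fin.
    rewrite /g /=.
    exact: (@weighted_increment i (Zt w)).
  rewrite ge0_integralD//; last 3 first.
  - by move=> w _; rewrite mule_ge0// lee_fin mulr_ge0 ?sqr_ge0.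
  - by move=> w _; rewrite mule_ge0.
  - by apply: emeasurable_funM => //; exact: measurable_cst.
  rewrite integral_coef_energy; apply: leeD2l.
  rewrite (ge0_integralZl P measurableT (mR i))//.
  apply: le_trans (lee_wpmul2l k6 (integral_rem_bound i)) _.
  rewrite -ge0_integralZl//; last 2 first.
  - apply/measurable_EFinP; apply: measurable_funM => //; exact: measurable_funX.
  - move=> x _; rewrite lee_fin mulr_ge0 ?sqr_ge0// mulr_ge0// mulr_ge0//.
    by rewrite (exprM _ 2 2) sqr_ge0.
  rewrite le_eqVlt; apply/orP; left; apply/eqP; apply: eq_integral => x _.
  by rewrite -EFinM; congr EFin; field.
rewrite big_split /= sum_cst_e2; last by rewrite divr_ge0// mulr_ge0 ?sqr_ge0.
rewrite -ge0_sume_distrr; last first.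
  by move=> i _; apply: integral_ge0.
apply: (@le_trans _ _ ((6 * c ^+ 2)%:E * (167 / 128)%:E + (c ^+ 2 * m4 / 4)%:E)%E).
  apply: leeD2r; apply: lee_wpmul2l => //.
  exact: integral_sum_dker_energy.
rewrite -EFinM -EFinD lee_fin.
(* 6 * 167 / 128 is below 8, so the constant 10 leaves room. *)
have := sqr_ge0 c; move: (c ^+ 2) => q q0; nra.
Qed.

End variance.

(** * The normal law *)

Section normal_law.
Context (R : realType).
Local Notation mu := (@lebesgue_measure R).

(** The Radon-Nikodym derivative and the explicit density have the same integral over every
    measurable set, hence agree almost everywhere. *)
Lemma ge0_integral_normal_prob (m s : R) (h : R -> \bar R) :
  measurable_fun setT h -> (forall x, 0 <= h x)%E ->
  (\int[normal_prob m s]_x h x = \int[mu]_x (h x * (normal_pdf m s x)%:E))%E.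
Proof.
move=> mh h0; have dom := normal_prob_dominates m s.
pose D := Radon_Nikodym_SigmaFinite.f (normal_prob m s) mu.
have ID : mu.-integrable setT D by exact: Radon_Nikodym_SigmaFinite.f_integrable.
have mq : measurable_fun setT (fun x => (normal_pdf m s x)%:E).
  by apply/measurable_EFinP; exact: measurable_normal_pdf.
rewrite -(Radon_Nikodym_SigmaFinite.change_of_variables dom)//.
apply: ae_eq_integral => //.
- by apply: emeasurable_funM => //; exact: (measurable_int mu).
- exact: emeasurable_funM.
- apply: ae_eqe_mul2l; apply: integral_ae_eq => // E _ mE.
  by rewrite -(Radon_Nikodym_SigmaFinite.f_integral dom).
Qed.

Lemma integral_normal_prob (m s : R) (h : R -> R) : measurable_fun setT h ->
  (\int[normal_prob m s]_x (h x)%:E = \int[mu]_x (h x * normal_pdf m s x)%:E)%E.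
Proof.
move=> mh; have mh' : measurable_fun setT (EFin \o h) by exact/measurable_EFinP.
rewrite [LHS]integralE [RHS]integralE; congr (_ - _)%E.
- rewrite ge0_integral_normal_prob//; last exact: measurable_funepos.
  apply: eq_integral => x _; rewrite !funeposE muleC maxe_pMr ?lee_fin ?normal_pdf_ge0//.
  by rewrite mule0 -EFinM mulrC.
- rewrite ge0_integral_normal_prob//; last exact: measurable_funeneg.
  apply: eq_integral => x _; rewrite !funenegE muleC maxe_pMr ?lee_fin ?normal_pdf_ge0//.
  by rewrite mule0 /= -EFinM mulrN mulrC.
Qed.

(** The integral over [-n, n] is G(n) - G(-n), which tends to 0, and the inverse weight serves as
    the dominating function. This is the boundary-free integration by parts behind the normal
    moments. *)
Lemma integral_is_derive_eq0 (G g : R -> R) (K : R) :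
  (forall x : R, is_derive x 1 G (g x)) -> continuous g ->
  (forall x, `|g x| <= K * (weight x)^-1) ->
  (forall x, `|G x| <= K * (weight x)^-1) ->
  (\int[mu]_x (g x)%:E = 0)%E.
Proof.
move=> dG cg gK GK.
have mg : measurable_fun setT (EFin \o g).
  by apply/measurable_EFinP; exact: continuous_measurable_fun.
have K0 : 0 <= K.
  rewrite -(pmulr_lge0 (x := (weight 0)^-1)) ?invr_gt0 ?weight_gt0//.
  exact: le_trans (normr_ge0 _) (gK 0).
have mw : measurable_fun setT (fun x : R => (weight x)^-1).
  apply: continuous_measurable_fun => x; apply: continuousV.
    by rewrite gt_eqF// weight_gt0.
  exact: continuous_weight.
have w0 (x : R) : 0 <= (weight x)^-1 by rewrite invr_ge0 ltW// weight_gt0.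
have wi : mu.-integrable setT (fun x => (K * (weight x)^-1)%:E).
  suff wi : mu.-integrable setT (fun x => ((weight x)^-1)%:E) by exact: (integrableZl measurableT K wi).
  apply/integrableP; split; first exact/measurable_EFinP.
  apply: le_lt_trans (_ : _ <= 4%R%:E)%E (ltry _).
  apply: le_trans (integral_inv_weight R); apply: ge0_le_integralT => // x.
  by rewrite gee0_abs ?lee_fin.
have mI n : measurable (`[- n%:R, n%:R] : set R) by [].
have ptw : {ae mu, forall x, setT x ->
    ((EFin \o g) \_ `[- n%:R, n%:R]) x @[n --> \oo] --> (EFin \o g) x}.
  apply/nearW => x _; apply: cvg_near_cst; near=> n.
  rewrite patchE ifT// inE /= in_itv /= -ler_norml.
  by near: n; exact: nbhs_infty_ger.
have dom : {ae mu, forall x (n : nat), setT x ->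
    (`|((EFin \o g) \_ `[(- n%:R)%R, n%:R%R]) x| <= (K * (weight x)^-1)%:E)%E}.
  apply/nearW => x n _; rewrite patchE; case: ifP => _ /=.
    by rewrite lee_fin.
  by rewrite normr0 lee_fin mulr_ge0.
have [_ _ H] := @dominated_convergence _ _ _ mu setT measurableT _ _ _
  (fun n => (measurable_restrictT _ (mI n)).1 (measurable_funTS mg)) mg ptw wi dom.
apply: (cvg_unique _ H) => //=.
rewrite (_ : (fun n => _) = EFin \o (fun n : nat => G n%:R - G (- n%:R))); last first.
  apply/funext => n; rewrite -integral_mkcond (is_derive_FTC2 _ dG cg)//.
  by rewrite lerNl (le_trans _ (ler0n _ n))// oppr_le0.
apply: cvg_EFin; first exact: nearW.
(* The weight at n and at -n is at least (n + 1) / 2, so each boundary value is at most 2 K / (n +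
   1). *)
apply: (@squeeze_cvgr _ _ _ _ (fun n => - (4 * K * harmonic n)) (fun n => 4 * K * harmonic n)).
- apply/nearW => n /=; rewrite -ler_norml.
  apply: le_trans (ler_normB _ _) _; apply: le_trans (lerD (GK _) (GK _)) _.
  rewrite -mulrDr [4 * K]mulrC -mulrA ler_wpM2l//.
  have n0 : 0 <= n%:R :> R by [].
  have wle (x : R) : (n.+1)%:R / 2 <= weight x -> (weight x)^-1 <= 2 * harmonic n.
    move=> h; rewrite /harmonic /= -[leLHS]mul1r ler_pdivrMr ?weight_gt0//.
    rewrite mulrAC ler_pdivlMr ?ltr0n//.
    by rewrite mul1r mulrC -ler_pdivrMr.
  have h1 : n.+1%:R / 2 <= weight (n%:R : R).
    by rewrite /weight -natr1; move: n%:R n0 => u u0; have := sqr_ge0 (u - 3 / 4); nra.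
  have h2 : n.+1%:R / 2 <= weight (- n%:R : R).
    by rewrite /weight -natr1; move: n%:R n0 => u u0; have := sqr_ge0 (u - 3 / 4); nra.
  by apply: le_trans (lerD (wle _ h1) (wle _ h2)) _; rewrite -mulrDl -natrD.
- rewrite -oppr0 -(mulr0 (4 * K)); apply: cvgN; apply: cvgM; first exact: cvg_cst.
  exact: cvg_harmonic.
- rewrite -(mulr0 (4 * K)); apply: cvgM; first exact: cvg_cst.
  exact: cvg_harmonic.
Unshelve. all: by end_near. Qed.

End normal_law.

Section normal_moments.
Context (R : realType).
Local Notation mu := (@lebesgue_measure R).
Variable s : R.
Hypothesis s0 : 0 < s.
Local Notation q := (normal_pdf 0 s).

Let q_E x : q x = normal_peak s * expR (- (x ^+ 2 / (s ^+ 2 *+ 2))).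
Proof. by rewrite normal_pdfE ?gt_eqF// /normal_fun subr0 mulNr. Qed.

(** One constant for all k <= 4: [|x| ^+ k <= 1 + x ^+ 4] and [weight x <= 2 * (1 + x ^+ 2)], so the
    product is a cubic in x^2, absorbed by e^t >= 1 + t^3 / 6. *)
Lemma normal_pdf_decay : exists K, forall k x, (k <= 4)%N ->
  `|x ^+ k * q x| <= K * (weight x)^-1.
Proof.
exists (6 * (1 + 48 * s ^+ 6) * normal_peak s) => k x k4.
have w0 := weight_gt0 x.
rewrite ler_pdivlMr// q_E normrM normrM (ger0_norm (normal_peak_ge0 s)).
rewrite (ger0_norm (expR_ge0 _)) normrX expRN.
set t := x ^+ 2 / _; have t0 : 0 <= t by rewrite divr_ge0 ?mulrn_wge0 ?sqr_ge0.
have xt : x ^+ 2 = 2 * s ^+ 2 * t.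
  by rewrite /t; field; rewrite gt_eqF.
have xk : `|x| ^+ k <= 1 + x ^+ 4.
  have [x1|x1] := leP `|x| 1.
    rewrite (@le_trans _ _ 1)// ?exprn_ile1//.
    by rewrite lerDl (exprM _ 2 2) sqr_ge0.
  rewrite (@le_trans _ _ (`|x| ^+ 4))//; first by rewrite ler_weXn2l// ltW.
  by rewrite -normrX ger0_norm ?lerDr// (exprM _ 2 2) sqr_ge0.
have wx : weight x <= 2 * (1 + x ^+ 2) by rewrite /weight; nra.
have et := expR_ge1Dxn 2 t0.
have H : `|x| ^+ k * weight x <= 6 * (1 + 48 * s ^+ 6) * expR t.
  apply: le_trans (ler_pM _ (ltW w0) xk wx) _; first by rewrite exprn_ge0.
  have s6 : s ^+ 6 = (s ^+ 2) ^+ 3 by rewrite -exprM.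
  have x4 : x ^+ 4 = (x ^+ 2) ^+ 2 by rewrite -exprM.
  rewrite x4 s6 xt.
  apply: (@le_trans _ _ (6 * (1 + 8 * (s ^+ 2) ^+ 3 * t ^+ 3))).
    have : 0 <= 2 * s ^+ 2 * t by rewrite mulr_ge0// mulr_ge0 ?sqr_ge0.
    rewrite (_ : 8 * _ * _ = (2 * s ^+ 2 * t) ^+ 3); last by ring.
    move: (2 * _ * t) => u u0.
    have : 0 <= (1 + u) * (1 - u) ^+ 2 by rewrite mulr_ge0 ?sqr_ge0// addr_ge0.
    have : 0 <= u ^+ 3 by rewrite exprn_ge0.
    by rewrite -subr_ge0; lra.
  have S0 : 0 <= (s ^+ 2) ^+ 3 by rewrite exprn_ge0 ?sqr_ge0.
  move: et S0; rewrite !factS fact0 /=; move: ((s ^+ 2) ^+ 3) (expR t) => S E et S0.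
  have T0 : 0 <= t ^+ 3 by rewrite exprn_ge0.
  move: (t ^+ 3) T0 et => T T0 et.
  have {}et : 1 + T / 6 <= E by apply: le_trans et; lra.
  nra.
rewrite [leRHS](_ : _ = normal_peak s * (6 * (1 + 48 * s ^+ 6))); last by ring.
rewrite [leLHS](_ : _ = normal_peak s * (`|x| ^+ k * weight x / expR t)); last by ring.
by rewrite ler_wpM2l ?normal_peak_ge0// ler_pdivrMr ?expR_gt0.
Qed.

Let is_derive_pdf (x : R) : is_derive x 1 q (- (x / s ^+ 2) * q x).
Proof.
rewrite (_ : q = fun x => normal_peak s * expR (- (x ^+ 2 / (s ^+ 2 *+ 2)))); last first.
  by apply/funext => y; exact: q_E.
have H2 : is_derive x 1 (fun y : R => expR (- (y ^+ 2 / (s ^+ 2 *+ 2))))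
    (- (x / s ^+ 2) * expR (- (x ^+ 2 / (s ^+ 2 *+ 2)))).
  apply: trigger_derive; rewrite /GRing.scale /=; field.
  by rewrite gt_eqF.
apply: is_derive_eq; rewrite /GRing.scale /=; ring.
Qed.

Let is_derive_Xpdf k (x : R) :
  is_derive x 1 (fun x => x ^+ k * q x) (k%:R * (x ^+ k.-1 * q x) - (x ^+ k.+1 * q x) / s ^+ 2).
Proof.
have Hx : is_derive x 1 (fun x : R => x ^+ k) (k%:R * x ^+ k.-1).
  rewrite (_ : (fun x => x ^+ k) = (id : R -> R) ^+ k); last by rewrite exprfctE.
  by apply: is_derive_eq; rewrite /GRing.scale /= mulr1.
apply: (is_derive_eq (is_deriveM Hx (is_derive_pdf x))).
by rewrite /GRing.scale /= (exprS x k); ring.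
Qed.

Let continuous_Xpdf k : continuous (fun x : R => x ^+ k * q x : R).
Proof. exact: is_derive_continuous (is_derive_Xpdf k). Qed.

Let mX k : measurable_fun setT (fun x : R => x ^+ k).
Proof. exact: exprn_measurable. Qed.

Lemma normal_integrableX k : (k <= 4)%N ->
  (normal_prob 0 s).-integrable setT (fun x => (x ^+ k)%:E).
Proof.
move=> k4; have [K HK] := normal_pdf_decay.
apply/integrableP; split; first exact/measurable_EFinP.
have K0 : 0 <= K.
  rewrite -(pmulr_lge0 (x := (weight 0)^-1)) ?invr_gt0 ?weight_gt0//.
  exact: le_trans (normr_ge0 _) (HK 0%N 0 isT).
rewrite ge0_integral_normal_prob//; last first.
  by apply: measurableT_comp => //; exact/measurable_EFinP.
have mw : measurable_fun setT (fun x : R => ((weight x)^-1)%:E).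
  apply/measurable_EFinP; apply: continuous_measurable_fun => x; apply: continuousV.
    by rewrite gt_eqF// weight_gt0.
  exact: continuous_weight.
have w0 (x : R) : (0 <= ((weight x)^-1)%:E)%E by rewrite lee_fin invr_ge0 ltW// weight_gt0.
apply: (@le_lt_trans _ _ (\int[mu]_x (K%:E * ((weight x)^-1)%:E))%E).
  apply: ge0_le_integralT => x.
    by rewrite -EFinM lee_fin mulr_ge0// normal_pdf_ge0.
  rewrite -!EFinM lee_fin -[X in _ * X]ger0_norm ?normal_pdf_ge0// -normrM.
  exact: HK.
rewrite ge0_integralZl//.
apply: (@le_lt_trans _ _ (K%:E * 4%R%:E)%E); last by rewrite -EFinM ltry.
by apply: lee_wpmul2l; rewrite ?lee_fin//; exact: integral_inv_weight.
Qed.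

(** Stein's identity: the derivative of x^k times the density has integral 0. For k = 0 the
    truncated exponent [k.-1] is harmless, being multiplied by 0. *)
Lemma normal_moment_rec k : (k <= 3)%N ->
  \int[normal_prob 0 s]_x (x ^+ k.+1) =
  s ^+ 2 * k%:R * \int[normal_prob 0 s]_x (x ^+ k.-1).
Proof.
move=> k3; have [K HK] := normal_pdf_decay.
have i1 := @normal_integrableX k.+1 k3.
have i2 := @normal_integrableX k.-1 (leq_trans (leq_pred _) (leqW k3)).
have K0 : 0 <= K.
  rewrite -(pmulr_lge0 (x := (weight 0)^-1)) ?invr_gt0 ?weight_gt0//.
  exact: le_trans (normr_ge0 _) (HK 0%N 0 isT).
have w0 (x : R) : 0 <= (weight x)^-1 by rewrite invr_ge0 ltW// weight_gt0.
pose g x := k%:R * (x ^+ k.-1 * q x) - (x ^+ k.+1 * q x) / s ^+ 2.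
have S0 : 0 <= (s ^+ 2)^-1 by rewrite invr_ge0 sqr_ge0.
have g0 : (\int[mu]_x (g x)%:E = 0)%E.
  apply: (@integral_is_derive_eq0 R (fun x => x ^+ k * q x) g ((1 + k%:R + (s ^+ 2)^-1) * K)).
  - exact: is_derive_Xpdf.
  - move=> x; apply: cvgB; apply: cvgM;
      [exact: cvg_cst|exact: continuous_Xpdf|exact: continuous_Xpdf|exact: cvg_cst].
  - move=> x; apply: le_trans (ler_normB _ _) _; rewrite !normrM normr_nat -[leRHS]mulrA.
    have := HK k.-1 x (leq_trans (leq_pred _) (leqW k3)).
    have := HK k.+1 x k3.
    rewrite !normrM (ger0_norm S0).
    have : 0 <= K * (weight x)^-1 by rewrite mulr_ge0.
    have k0 : 0 <= k%:R :> R by [].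
    move: (K * _) (`|x ^+ k.+1| * _) (`|x ^+ k.-1| * _) => A B C A0 BA CA.
    have : k%:R * C <= k%:R * A by rewrite ler_wpM2l.
    have : B * (s ^+ 2)^-1 <= A * (s ^+ 2)^-1 by rewrite ler_wpM2r.
    lra.
  - move=> x; apply: le_trans (HK k x (leqW k3)) _; rewrite -mulrA ler_peMl ?mulr_ge0//.
    by rewrite -addrA lerDl addr_ge0.
have E : (\int[normal_prob 0 s]_x (k%:R * x ^+ k.-1 - x ^+ k.+1 / s ^+ 2)%:E = 0)%E.
  rewrite integral_normal_prob; last first.
    apply: measurable_funB; apply: measurable_funM => //.
  rewrite -[RHS]g0; apply: eq_integral => x _; congr EFin; rewrite /g; ring.
have /eqP : \int[normal_prob 0 s]_x (k%:R * x ^+ k.-1 - x ^+ k.+1 / s ^+ 2) = 0.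
  by rewrite /Rintegral E.
rewrite RintegralB//; last 2 first.
- exact: (integrableZl measurableT (k%:R) i2).
- exact: (integrableZr measurableT ((s ^+ 2)^-1) i1).
rewrite RintegralZl// RintegralZr// subr_eq0 => /eqP H.
rewrite -mulrA H; field.
by rewrite gt_eqF.
Qed.

End normal_moments.

Section normal_moment_values.
Context (R : realType) (s : R).
Hypothesis s0 : 0 < s.
Local Notation N := (normal_prob 0 s).

Lemma normal_mean : \int[N]_x x = 0.
Proof. by rewrite (@normal_moment_rec R s s0 0)// mulr0 mul0r. Qed.

Lemma normal_variance : \int[N]_x (x ^+ 2) = s ^+ 2.
Proof.
rewrite (@normal_moment_rec R s s0 1)// mulr1 /= (@eq_Rintegral _ _ _ N setT (fun=> 1)) => [|x _].
  by rewrite Ex_cst mulr1.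
by rewrite expr0.
Qed.

Lemma normal_fourth_moment : \int[N]_x (x ^+ 4) = 3 * s ^+ 4.
Proof. by rewrite (@normal_moment_rec R s s0 3)//= normal_variance; ring. Qed.

(** |x|^3 <= s x^2 / 2 + x^4 / (2 s), an arithmetic-geometric mean; the moments s^2 and 3 s^4 give
    s^3 / 2 + 3 s^3 / 2. This is the origin of the 2 added to E|a_1|^3 in the Lindeberg bound. *)
Lemma normal_abs_third_moment : \int[N]_x (`|x| ^+ 3) <= 2 * s ^+ 3.
Proof.
have i2 := @normal_integrableX R s s0 2 isT.
have i4 := @normal_integrableX R s s0 4 isT.
have i3 : N.-integrable setT (fun x => (`|x| ^+ 3)%:E).
  apply: eq_integrable (integrable_abse (@normal_integrableX R s s0 3 isT)) => // x _.
  by rewrite /= normrX.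
have j2 : N.-integrable setT (fun x => (s / 2 * x ^+ 2)%:E) := integrableZl measurableT (s / 2) i2.
have j4 : N.-integrable setT (fun x => ((s * 2)^-1 * x ^+ 4)%:E) := integrableZl measurableT (s * 2)^-1 i4.
apply: (@le_trans _ _ (\int[N]_x (s / 2 * x ^+ 2 + (s * 2)^-1 * x ^+ 4))).
  apply: le_Rintegral => //; first exact: (integrableD measurableT j2 j4).
  move=> x _; have x2 : x ^+ 2 = `|x| ^+ 2 by rewrite real_normK ?num_real.
  rewrite (exprM x 2 2) x2.
  rewrite -subr_ge0 (_ : _ - _ = `|x| ^+ 2 * (s - `|x|) ^+ 2 / (s * 2)); last first.
    by field; rewrite gt_eqF.
  apply: divr_ge0; first by apply: mulr_ge0; exact: sqr_ge0.
  by apply: mulr_ge0 => //; exact: ltW.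
rewrite RintegralD// !RintegralZl// normal_variance normal_fourth_moment.
by rewrite le_eqVlt; apply/orP; left; apply/eqP; field; rewrite gt_eqF.
Qed.

End normal_moment_values.

(** * Convolution of centred normal laws *)

Section normal_convolution.
Context (R : realType) (c s : R).
Hypotheses (c0 : 0 < c) (s0 : 0 < s).
Local Notation mu := (@lebesgue_measure R).
Let r := Num.sqrt (c ^+ 2 + s ^+ 2).

Let r2 : r ^+ 2 = c ^+ 2 + s ^+ 2.
Proof. by rewrite sqr_sqrtr// addr_ge0 ?sqr_ge0. Qed.

Let r0 : 0 < r.
Proof. by rewrite sqrtr_gt0 ltr_wpDr ?sqr_ge0// exprn_gt0. Qed.

(** Completing the square in y: the joint density of a summand and the sum is the density of the sum
    u times the conditional density of the summand, normal with mean u c^2 / r^2 and deviation c s /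
    r. *)
Lemma normal_pdfM u y : normal_pdf 0 c y * normal_pdf 0 s (u - y) =
  normal_pdf 0 r u * normal_pdf (u * c ^+ 2 / r ^+ 2) (c * s / r) y.
Proof.
have cs0 : 0 < c * s / r by rewrite divr_gt0// mulr_gt0.
have pdfE m t x : t != 0 -> normal_pdf m t x = normal_peak t * normal_fun m t x :> R.
  by move=> t0; rewrite normal_pdfE.
rewrite !pdfE ?gt_eqF// mulrACA [RHS]mulrACA; congr (_ * _).
  rewrite -!invfM -!sqrtrM ?mulrn_wge0 ?mulr_ge0 ?sqr_ge0 ?pi_ge0 ?(ltW r0) ?(ltW c0)//.
  by congr (Num.sqrt _)^-1; field; exact: lt0r_neq0.
rewrite /normal_fun -!expRD; congr expR; rewrite expr_div_n r2; field.
by rewrite -r2 !expf_neq0 ?lt0r_neq0.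
Qed.

Lemma ge0_normal_convolution (phi : R -> R) : continuous phi -> (forall x, 0 <= phi x) ->
  (\int[normal_prob 0 c]_y \int[normal_prob 0 s]_x (phi (y + x))%:E =
   \int[normal_prob 0 r]_x (phi x)%:E)%E.
Proof.
move=> cphi phi0.
have mphi := continuous_measurable_fun cphi.
have mq m t D : measurable_fun D (@normal_pdf R m t).
  exact: measurable_funTS (measurable_normal_pdf m t).
have cq y : continuous (fun x => normal_pdf 0 s (x - y)).
  move=> x; apply: (@continuous_comp _ _ _ (fun x => x - y) (normal_pdf 0 s)).
    by apply: cvgB; [exact: cvg_id|exact: cvg_cst].
  by apply: continuous_normal_pdf; rewrite gt_eqF.
have m1 : measurable_fun setT (fun p : R * R => phi (p.1 + p.2)).
  by apply: (measurableT_comp mphi); exact: measurable_funD.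
rewrite ge0_integral_normal_prob; last 2 first.
- exact: (measurable_ge0_integral (normal_prob 0 s) m1).
- by move=> y; apply: integral_ge0 => x _; rewrite lee_fin.
pose g (p : R * R) := phi p.2 * (normal_pdf 0 r p.2 *
  normal_pdf (p.2 * c ^+ 2 / r ^+ 2) (c * s / r) p.1).
have gE y x : g (y, x) = phi x * normal_pdf 0 s (x - y) * normal_pdf 0 c y.
  by rewrite /g /= -normal_pdfM; ring.
have mg : measurable_fun setT g.
  rewrite (_ : g = fun p => phi p.2 * normal_pdf 0 s (p.2 - p.1) * normal_pdf 0 c p.1); last first.
    by apply/funext => -[y x]; rewrite gE.
  apply: measurable_funM.
    apply: measurable_funM; first exact: (measurableT_comp mphi).
    by apply: (measurableT_comp (mq _ _ _)); exact: measurable_funB.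
  exact: (measurableT_comp (mq _ _ _)).
have g0 p : 0 <= g p by rewrite !mulr_ge0 ?normal_pdf_ge0.
transitivity (\int[mu]_y \int[mu]_x (g (y, x))%:E)%E.
  apply: eq_integral => y _; rewrite ge0_integral_normal_prob; last 2 first.
  - by apply/measurable_EFinP; exact: (measurableT_comp m1 (measurable_pair1 _)).
  - by move=> x; rewrite lee_fin.
  have -> : (\int[mu]_x ((phi (y + x))%:E * (normal_pdf 0 s x)%:E) =
      \int[mu]_x (phi x * normal_pdf 0 s (x - y))%:E)%E.
    rewrite [RHS](@integral_translation _ _ y).
    - by apply: eq_integral => x _; rewrite addrK (addrC x).
    - by move=> x; apply: cvgM; [exact: cphi|exact: cq].
    - by move=> x; rewrite mulr_ge0 ?normal_pdf_ge0.
  rewrite -ge0_integralZr//.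
  - by apply: eq_integral => x _; rewrite gE.
  - apply/measurable_EFinP; apply: measurable_funM => //.
    exact: continuous_measurable_fun.
  - by move=> x _; rewrite lee_fin mulr_ge0 ?normal_pdf_ge0.
  - by rewrite lee_fin normal_pdf_ge0.
rewrite (ge0_swap mu mu mg g0) ge0_integral_normal_prob; last 2 first.
- exact/measurable_EFinP.
- by move=> x; rewrite lee_fin.
apply: eq_integral => x _.
transitivity (\int[mu]_y ((phi x * normal_pdf 0 r x)%:E *
    (normal_pdf (x * c ^+ 2 / r ^+ 2) (c * s / r) y)%:E))%E.
  by apply: eq_integral => y _; rewrite -EFinM /g /= mulrA.
rewrite ge0_integralZl//.
- by rewrite integral_normal_pdf mule1 EFinM.
- by apply/measurable_EFinP; exact: mq.
- by move=> y _; rewrite lee_fin normal_pdf_ge0.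
- by rewrite lee_fin mulr_ge0 ?normal_pdf_ge0.
Qed.

Lemma normal_convolution (phi : R -> R) : continuous phi -> bmf phi ->
  \int[normal_prob 0 c]_y \int[normal_prob 0 s]_x (phi (y + x)) =
  \int[normal_prob 0 r]_x phi x.
Proof.
move=> cphi bphi; have [_ [M HM]] := bphi.
have bM : bmf (fun x => phi x + M) by apply: bmfD => //; exact: bmf_cst.
have p0 x : 0 <= phi x + M.
  by have := HM x; rewrite ler_norml => /andP[H _]; rewrite -lerBlDr sub0r.
have cM : continuous (fun x => phi x + M).
  by move=> x; apply: cvgD; [exact: cphi|exact: cvg_cst].
have b2 : bmf (fun p : R * R => phi (p.1 + p.2)).
  by apply: (bmf_comp bphi); exact: measurable_funD.
have bM2 : bmf (fun p : R * R => phi (p.1 + p.2) + M).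
  by apply: bmfD => //; exact: bmf_cst.
have : \int[normal_prob 0 c]_y \int[normal_prob 0 s]_x (phi (y + x) + M) =
    \int[normal_prob 0 r]_x (phi x + M).
  apply: EFin_inj; apply: etrans _ (esym (EFin_Ex (normal_prob 0 r) bM)).
  have /= -> := EFin_Ex (normal_prob 0 c) (bmf_Ex2 (normal_prob 0 s) bM2).
  apply: etrans _ (ge0_normal_convolution cM p0); apply: eq_integral => y _.
  by have /= -> := EFin_Ex (normal_prob 0 s) (bmf_pair1 y bM2).
have bc : bmf (fun _ : R => M) by exact: bmf_cst.
have /= -> := ExD (normal_prob 0 r) bphi bc; rewrite Ex_cst.
have -> : \int[normal_prob 0 c]_y \int[normal_prob 0 s]_x (phi (y + x) + M) =
    \int[normal_prob 0 c]_y (\int[normal_prob 0 s]_x (phi (y + x)) + M).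
  apply: eq_Rintegral => y _.
  by have /= -> := ExD (normal_prob 0 s) (bmf_pair1 y b2) bc; rewrite Ex_cst.
have /= -> := ExD (normal_prob 0 c) (bmf_Ex2 (normal_prob 0 s) b2) bc.
by rewrite Ex_cst => /addIr.
Qed.

End normal_convolution.

(** * Lindeberg's method *)

Section third_order_taylor.
Context (R : realType).
Implicit Types F : R -> R.

(** A ladder of three monotonicity arguments: the bound minus the function vanishes at 0 at each
    order, and its derivative is the nonnegative difference one order higher. *)
Lemma taylor3_le F F1 F2 F3 (h : R) :
  (forall x : R, is_derive x 1 F (F1 x)) ->
  (forall x : R, is_derive x 1 F1 (F2 x)) ->
  (forall x : R, is_derive x 1 F2 (F3 x)) ->
  (forall x, F3 x <= 1) -> 0 <= h ->
  F h - F 0 - h * F1 0 - h ^+ 2 / 2 * F2 0 <= h ^+ 3 / 6.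
Proof.
move=> d0 d1 d2 F3le h0.
have A2 x : 0 <= x -> 0 <= F2 0 + x - F2 x.
  move=> x0; have := @is_derive_le R (fun x => F2 0 + x - F2 x) (fun x => 1 - F3 x) 0 x.
  rewrite addr0 subrr; apply => // [y|y _]; last by rewrite subr_ge0.
  by have := d2 y => H; apply: trigger_derive; rewrite /GRing.scale /=; ring.
have A1 x : 0 <= x -> 0 <= F1 0 + x * F2 0 + x ^+ 2 / 2 - F1 x.
  move=> x0; have := @is_derive_le R (fun x => F1 0 + x * F2 0 + x ^+ 2 / 2 - F1 x)
    (fun x => F2 0 + x - F2 x) 0 x.
  rewrite mul0r expr0n /= mul0r !addr0 subrr; apply => // [y|y /andP[y0 _]]; last exact: A2.
  by have := d1 y => H; apply: trigger_derive; rewrite /GRing.scale /=; field.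
have := @is_derive_le R (fun x => F 0 + x * F1 0 + x ^+ 2 / 2 * F2 0 + x ^+ 3 / 6 - F x)
    (fun x => F1 0 + x * F2 0 + x ^+ 2 / 2 - F1 x) 0 h.
rewrite mul0r !expr0n /= !mul0r !addr0 subrr => H.
suff : 0 <= F 0 + h * F1 0 + h ^+ 2 / 2 * F2 0 + h ^+ 3 / 6 - F h by lra.
apply: H => // [y|y /andP[y0 _]]; last exact: A1.
by have := d0 y => H; apply: trigger_derive; rewrite /GRing.scale /=; field.
Qed.

Lemma taylor3_norm F F1 F2 F3 (h : R) :
  (forall x : R, is_derive x 1 F (F1 x)) ->
  (forall x : R, is_derive x 1 F1 (F2 x)) ->
  (forall x : R, is_derive x 1 F2 (F3 x)) ->
  (forall x, `|F3 x| <= 1) -> 0 <= h ->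
  `|F h - F 0 - h * F1 0 - h ^+ 2 / 2 * F2 0| <= h ^+ 3 / 6.
Proof.
move=> d0 d1 d2 F3le h0; rewrite ler_norml lerNl; apply/andP; split.
  have n (G g : R -> R) : (forall x : R, is_derive x 1 G (g x)) ->
      forall x : R, is_derive x 1 (fun x => - G x) (- g x).
    by move=> H x; have := H x => {}H; apply: trigger_derive; rewrite /GRing.scale /=; ring.
  have F3ge x : - F3 x <= 1 by rewrite lerNl; have := F3le x; rewrite ler_norml => /andP[].
  have := taylor3_le (n _ _ d0) (n _ _ d1) (n _ _ d2) F3ge h0.
  by apply: le_trans; rewrite le_eqVlt; apply/orP; left; apply/eqP; ring.
apply: taylor3_le d0 d1 d2 _ h0 => x.
exact: le_trans (ler_norm _) (F3le x).
Qed.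

Lemma taylor3 F F1 F2 F3 (r h : R) :
  (forall x : R, is_derive x 1 F (F1 x)) ->
  (forall x : R, is_derive x 1 F1 (F2 x)) ->
  (forall x : R, is_derive x 1 F2 (F3 x)) ->
  (forall x, `|F3 x| <= 1) ->
  `|F (r + h) - F r - h * F1 r - h ^+ 2 / 2 * F2 r| <= `|h| ^+ 3 / 6.
Proof.
move=> d0 d1 d2 F3le.
have shift (G g : R -> R) : (forall x : R, is_derive x 1 G (g x)) ->
    forall x : R, is_derive x 1 (fun x => G (r + x)) (g (r + x)).
  move=> dG x; have dl : is_derive x 1 (fun x => r + x) 1.
    by apply: trigger_derive; rewrite /GRing.scale /=; ring.
  have := @is_derive1_comp R G (fun x => r + x) x _ _ (dG (r + x)) dl.
  by rewrite mulr1.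
have refl (G g : R -> R) : (forall x : R, is_derive x 1 G (g x)) ->
    forall x : R, is_derive x 1 (fun x => G (r - x)) (- g (r - x)).
  move=> dG x; have dl : is_derive x 1 (fun x => r - x) (-1).
    by apply: trigger_derive; rewrite /GRing.scale /=; ring.
  have := @is_derive1_comp R G (fun x => r - x) x _ _ (dG (r - x)) dl.
  by rewrite mulrN1.
(* For h < 0 the function is reflected at r; odd derivatives change sign, so [refl] and [reflN]
   alternate along the chain. *)
have reflN (G g : R -> R) : (forall x : R, is_derive x 1 G (g x)) ->
    forall x : R, is_derive x 1 (fun x => - G (r - x)) (g (r - x)).
  move=> dG x; have H := refl _ _ dG x.
  by apply: trigger_derive; rewrite /GRing.scale /=; ring.
have [h0|h0] := leP 0 h.
  have := taylor3_norm (shift _ _ d0) (shift _ _ d1) (shift _ _ d2) (fun x => F3le (r + x)) h0.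
  by rewrite addr0 (ger0_norm h0).
have F3N x : `|- F3 (r - x)| <= 1 by rewrite normrN.
have nh0 : 0 <= - h by rewrite oppr_ge0 ltW.
have := taylor3_norm (refl _ _ d0) (reflN _ _ d1) (refl _ _ d2) F3N nh0.
by rewrite opprK subr0 sqrrN mulrNN (ltr0_norm h0).
Qed.

Lemma C3_taylor (phi : R -> R) (r h : R) : C3_unit phi ->
  `|phi (r + h) - phi r - h * derive1n 1 phi r - h ^+ 2 / 2 * derive1n 2 phi r|
  <= `|h| ^+ 3 / 6.
Proof.
move=> H; have [_ [_ B]] := H.
exact: (taylor3 r h (fun x => @C3_is_derive R phi 0 x H isT)
  (fun x => @C3_is_derive R phi 1 x H isT) (fun x => @C3_is_derive R phi 2 x H isT) (B 3%N isT)).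
Qed.

Context d (S : measurableType d) (Q : probability S R).

Lemma C3_taylor_mean (phi : R -> R) (X : S -> R) (r : R) : C3_unit phi ->
  Q.-integrable setT (fun w => (X w)%:E) ->
  Q.-integrable setT (fun w => (X w ^+ 2)%:E) ->
  Q.-integrable setT (fun w => (`|X w| ^+ 3)%:E) ->
  \int[Q]_w X w = 0 ->
  `|\int[Q]_w phi (r + X w) - phi r - (\int[Q]_w (X w ^+ 2)) / 2 * derive1n 2 phi r|
  <= \int[Q]_w (`|X w| ^+ 3) / 6.
Proof.
move=> H i1 i2 i3 EX0.
have mX : measurable_fun setT X by apply/measurable_EFinP; exact: measurable_int i1.
have bp : bmf (fun w => phi (r + X w)).
  by apply: (bmf_comp (C3_bmf H)); exact: measurable_funD.
have ib := bmf_integrable Q bp.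
have ic : Q.-integrable setT (fun=> (phi r)%:E) := bmf_integrable Q (bmf_cst _ (phi r)).
have j1 : Q.-integrable setT (fun w => (X w * derive1n 1 phi r)%:E) :=
  integrableZr measurableT (derive1n 1 phi r) i1.
have j2 : Q.-integrable setT (fun w => (X w ^+ 2 * (derive1n 2 phi r / 2))%:E) :=
  integrableZr measurableT (derive1n 2 phi r / 2) i2.
have j3 : Q.-integrable setT (fun w => (`|X w| ^+ 3 * 6^-1)%:E) :=
  integrableZr measurableT 6^-1 i3.
have k1 : Q.-integrable setT (fun w => (phi (r + X w) - phi r)%:E) :=
  integrableB measurableT ib ic.
have k2 : Q.-integrable setT (fun w => (phi (r + X w) - phi r - X w * derive1n 1 phi r)%:E) :=
  integrableB measurableT k1 j1.
have k3 : Q.-integrable setT (fun w => (phi (r + X w) - phi r - X w * derive1n 1 phi r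
    - X w ^+ 2 * (derive1n 2 phi r / 2))%:E) := integrableB measurableT k2 j2.
have -> : \int[Q]_w phi (r + X w) - phi r - (\int[Q]_w (X w ^+ 2)) / 2 * derive1n 2 phi r =
    \int[Q]_w (phi (r + X w) - phi r - X w * derive1n 1 phi r
    - X w ^+ 2 * (derive1n 2 phi r / 2)).
  rewrite (RintegralB measurableT k2 j2) (RintegralB measurableT k1 j1).
  rewrite (RintegralB measurableT ib ic) Ex_cst (RintegralZr _ measurableT i1) EX0.
  by rewrite (RintegralZr _ measurableT i2) mul0r subr0; ring.
apply: le_trans (le_normr_Rintegral measurableT k3) _.
rewrite -(RintegralZr _ measurableT i3); apply: le_Rintegral => //.
  exact: integrable_abse k3.
move=> w _; have := C3_taylor r (X w) H; apply: le_trans.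
by rewrite le_eqVlt; apply/orP; left; apply/eqP; congr (`|_|); ring.
Qed.

End third_order_taylor.

Section lindeberg.
Context (R : realType) d (T : measurableType d) (P : probability T R).
Context (N : nat) (Z : 'I_N -> T -> R) (al : T -> R).
Hypothesis mZ : forall i, measurable_fun setT (Z i).
Hypothesis mal : measurable_fun setT al.
Hypothesis indep : forall B : 'I_N -> set R, (forall i, measurable (B i)) ->
  P (\bigcap_i (Z i @^-1` B i)) = (\prod_(i < N) P (al @^-1` B i))%E.
Hypothesis al4 : P.-integrable setT (fun w => (al w ^+ 4)%:E).
Hypothesis al1 : (\int[P]_w (al w)%:E = 0)%E.
Hypothesis al2 : (\int[P]_w (al w ^+ 2)%:E = 1)%E.
Variables (phi : R -> R) (c : 'I_N -> R).
Hypothesis C3phi : C3_unit phi.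
Local Notation Zt := (coefs Z).

(* The mean of [f (r + Y)] for [Y] normal with variance [v]; the case [v = 0] is
   separate because [normal_prob 0 0] is the uniform law on [0, 1]. *)
Definition smooth (f : R -> R) (v r : R) : R :=
  if v == 0 then f r else \int[normal_prob 0 (Num.sqrt v)]_x f (r + x).

Let m3 := \int[P]_w (`|al w| ^+ 3).

Let bphi : bmf phi := C3_bmf C3phi.

Let cphi : continuous phi := @C3_continuous R phi 0 C3phi isT.

Let bphiD : bmf (fun p : R * R => phi (p.1 + p.2)).
Proof. by apply: (bmf_comp bphi); exact: measurable_funD. Qed.

Let bmf_smooth v : bmf (smooth phi v).
Proof.
rewrite /smooth; case: (v == 0) => //.
exact: (bmf_Ex2 (normal_prob 0 (Num.sqrt v)) bphiD).
Qed.

Lemma smooth_add (v a r : R) : 0 <= v -> a != 0 ->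
  smooth phi (v + a ^+ 2) r =
  \int[normal_prob 0 `|a|]_x smooth phi v (r + x).
Proof.
move=> v0 a0; have a2 : 0 < a ^+ 2 by rewrite exprn_even_gt0.
have va : (v + a ^+ 2 == 0) = false by apply: gt_eqF; rewrite ltr_wpDl.
rewrite [LHS]/smooth va.
have [->|vn0] := eqVneq v 0.
  by rewrite add0r sqrtr_sqr; apply: eq_Rintegral => x _; rewrite /smooth eqxx.
have vp : 0 < v by rewrite lt_neqAle eq_sym vn0.
have sv : 0 < Num.sqrt v by rewrite sqrtr_gt0.
have na : 0 < `|a| by rewrite normr_gt0.
have Es : Num.sqrt (v + a ^+ 2) = Num.sqrt (`|a| ^+ 2 + Num.sqrt v ^+ 2).
  by rewrite sqr_sqrtr// real_normK ?num_real// addrC.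
rewrite Es.
have cr : continuous (fun x => phi (r + x)).
  move=> x; apply: (@continuous_comp _ _ _ (fun x => r + x) phi); last exact: cphi.
  by apply: cvgD; [exact: cvg_cst|exact: cvg_id].
have bcr : bmf (fun x => phi (r + x)) by exact: (bmf_pair1 r bphiD).
rewrite -(normal_convolution na sv cr bcr).
apply: eq_Rintegral => y _; rewrite /smooth (negbTE vn0).
by apply: eq_Rintegral => x _; rewrite addrA.
Qed.

(** a [al] and a centred normal variable of variance a^2 share their first two moments, so only
    third-order Taylor errors survive. The estimate is uniform in the base point, hence unaffected
    by the extra Gaussian smoothing, which is integrated last by Fubini. *)
Lemma smooth_step (v a r : R) : 0 <= v ->
  `|\int[P]_w smooth phi v (r + a * al w) - smooth phi (v + a ^+ 2) r|
  <= `|a| ^+ 3 * ((m3 + 2) / 6).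
Proof.
move=> v0; have [->|a0] := eqVneq a 0.
  rewrite expr0n /= addr0 (@eq_Rintegral _ _ _ P setT (fun=> smooth phi v r)); last first.
    by move=> w _; rewrite mul0r addr0.
  by rewrite Ex_cst subrr normr0 expr0n mul0r.
rewrite smooth_add//.
have na : 0 < `|a| by rewrite normr_gt0.
have i1 : P.-integrable setT (fun w => (al w)%:E) := integrable_alX mal al4 (isT : (1 <= 4)%N).
have i2 := integrable_alX mal al4 (isT : (2 <= 4)%N).
have i3 : P.-integrable setT (fun w => (`|al w| ^+ 3)%:E).
  apply: eq_integrable (integrable_abse (integrable_alX mal al4 (isT : (3 <= 4)%N))) => // w _.
  by rewrite /= normrX.
have step s : `|\int[P]_w phi (s + a * al w) - \int[normal_prob 0 `|a|]_x phi (s + x)|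
    <= `|a| ^+ 3 * ((m3 + 2) / 6).
  have ea : (fun w => (a * al w) ^+ 2) = (fun w => a ^+ 2 * al w ^+ 2).
    by apply/funext => w; rewrite exprMn.
  have eb : (fun w => `|a * al w| ^+ 3) = (fun w => `|a| ^+ 3 * `|al w| ^+ 3).
    by apply/funext => w; rewrite normrM exprMn.
  have j1 : P.-integrable setT (fun w => (a * al w)%:E) := integrableZl measurableT a i1.
  have j2 : P.-integrable setT (fun w => ((a * al w) ^+ 2)%:E).
    have := integrableZl measurableT (a ^+ 2) i2.
    by apply: eq_integrable => // w _; rewrite exprMn.
  have j3 : P.-integrable setT (fun w => (`|a * al w| ^+ 3)%:E).
    have := integrableZl measurableT (`|a| ^+ 3) i3.
    by apply: eq_integrable => // w _; rewrite normrM exprMn.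
  have m1 : \int[P]_w (a * al w) = 0 by rewrite RintegralZl// (Rint_al1 al1) mulr0.
  have n1 : (normal_prob 0 `|a|).-integrable setT (fun x : R => x%:E).
    exact: (@normal_integrableX R `|a| na 1 isT).
  have n2 := @normal_integrableX R `|a| na 2 isT.
  have n3 : (normal_prob 0 `|a|).-integrable setT (fun x : R => (`|x| ^+ 3)%:E).
    apply: eq_integrable (integrable_abse (@normal_integrableX R `|a| na 3 isT)) => // x _.
    by rewrite /= normrX.
  have := C3_taylor_mean s C3phi j1 j2 j3 m1.
  have := C3_taylor_mean s C3phi n1 n2 n3 (normal_mean na).
  rewrite ea eb (RintegralZl _ measurableT i2) (RintegralZl _ measurableT i3).
  rewrite (Rint_al2 al2) normal_variance// -/m3 mulr1 (real_normK (num_real a)).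
  have := normal_abs_third_moment na.
  move: (\int[_]_x _) (\int[_]_x _) (\int[_]_x _) => G3 A B.
  move: (a ^+ 2 / 2 * _) (phi s) (`|a| ^+ 3) => D F V G3le.
  rewrite !ler_norml => /andP[h1 h2] /andP[h3 h4]; apply/andP; split; lra.
rewrite /smooth; have [_|vn0] := eqVneq v 0.
  exact: step.
have sv : 0 < Num.sqrt v by rewrite sqrtr_gt0 lt_neqAle eq_sym vn0.
have b1 : bmf (fun p : T * R => phi (r + p.2 + a * al p.1)).
  apply: (bmf_comp bphi); apply: measurable_funD; first exact: measurable_funD.
  by apply: measurable_funM => //; exact: (measurableT_comp mal).
have b2 : bmf (fun p : R * R => phi (r + p.2 + p.1)).
  by apply: (bmf_comp bphi); apply: measurable_funD => //; exact: measurable_funD.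
have b1' : bmf (fun p : R * T => phi (r + p.1 + a * al p.2)).
  by apply: (bmf_comp b1 (g := fun p : R * T => (p.2, p.1))); apply: measurable_fun_pair.
have b2' : bmf (fun p : R * R => phi (r + p.1 + p.2)).
  by apply: (bmf_comp b2 (g := fun p : R * R => (p.2, p.1))); apply: measurable_fun_pair.
have E1 : \int[P]_w \int[normal_prob 0 (Num.sqrt v)]_x phi (r + a * al w + x) =
    \int[normal_prob 0 (Num.sqrt v)]_x \int[P]_w phi (r + x + a * al w).
  have /= <- := Ex_fubini P (normal_prob 0 (Num.sqrt v)) b1.
  by apply: eq_Rintegral => w _; apply: eq_Rintegral => x _; rewrite addrAC.
have E2 : \int[normal_prob 0 `|a|]_y \int[normal_prob 0 (Num.sqrt v)]_x phi (r + y + x) =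
    \int[normal_prob 0 (Num.sqrt v)]_x \int[normal_prob 0 `|a|]_y phi (r + x + y).
  have /= <- := Ex_fubini (normal_prob 0 `|a|) (normal_prob 0 (Num.sqrt v)) b2.
  by apply: eq_Rintegral => w _; apply: eq_Rintegral => x _; rewrite addrAC.
rewrite E1 E2.
have c1 := bmf_Ex2 P b1'; have c2 := bmf_Ex2 (normal_prob 0 `|a|) b2'.
have /= <- := ExB (normal_prob 0 (Num.sqrt v)) c1 c2.
by apply: Ex_norm => [|x]; [exact: bmfB|exact: step].
Qed.

(** The variance of the terms already replaced accumulates in [v]: the head of the list is exchanged
    first, then the induction runs with v + c_i^2. *)
Lemma smooth_sum (l : seq 'I_N) (v : R) : uniq l -> 0 <= v ->
  `|\int[P]_w smooth phi v (\sum_(i <- l) c i * tnth (Zt w) i)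
    - smooth phi (v + \sum_(i <- l) c i ^+ 2) 0|
  <= (\sum_(i <- l) `|c i| ^+ 3) * ((m3 + 2) / 6).
Proof.
elim: l v => [|i l IH] v.
  move=> _ v0; rewrite big_nil addr0 (@eq_Rintegral _ _ _ P setT (fun=> smooth phi v 0)); last first.
    by move=> w _; rewrite big_nil.
  by rewrite Ex_cst subrr normr0 big_nil mul0r.
rewrite /= => /andP[il ul] v0.
pose S (l : seq 'I_N) (z : N.-tuple R) := \sum_(j <- l) c j * tnth z j.
have mS l' : measurable_fun setT (S l').
  apply: measurable_sum => j; apply: measurable_funM => //.
  exact: measurable_tnth.
have SE z y : S (i :: l) (upd z i y) = S l z + c i * y.
  rewrite /S big_cons tnth_upd eqxx addrC; congr (_ + _).
  rewrite !big_seq; apply: eq_bigr => j jl; rewrite tnth_upd.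
  by case: eqP jl il => // -> ->.
have bS l' u : bmf (fun z => smooth phi u (S l' z)) by exact: (bmf_comp (bmf_smooth u) (mS l')).
have b2 : bmf (fun p : T * T => smooth phi v (S l (Zt p.1) + c i * al p.2)).
  apply: (bmf_comp (bmf_smooth v)); apply: measurable_funD.
    by apply: (measurableT_comp (mS l)); exact: (measurableT_comp (measurable_coefs mZ)).
  by apply: measurable_funM => //; exact: (measurableT_comp mal).
have v1 : 0 <= v + c i ^+ 2 by rewrite addr_ge0 ?sqr_ge0.
have := IH _ ul v1; rewrite -addrA !big_cons.
pose A := \int[P]_w smooth phi (v + c i ^+ 2) (S l (Zt w)).
move=> IHl.
have -> : \int[P]_w smooth phi v (\sum_(j <- i :: l) c j * tnth (Zt w) j) =
    \int[P]_w \int[P]_w' smooth phi v (S l (Zt w) + c i * al w').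
  have -> := bmf_resample mZ mal indep i (bS (i :: l) v).
  by apply: eq_Rintegral => w _; apply: eq_Rintegral => w' _; rewrite SE.
have bA : bmf (fun w => smooth phi (v + c i ^+ 2) (S l (Zt w))).
  exact: (bmf_comp (bS l _) (measurable_coefs mZ)).
apply: le_trans (ler_distD A _ _) _; rewrite mulrDl; apply: lerD; last exact: IHl.
have /= <- := ExB P (bmf_Ex2 P b2) bA.
apply: Ex_norm => [|w]; first exact: (bmfB (bmf_Ex2 P b2) bA).
exact: smooth_step.
Qed.

Theorem lindeberg : \sum_(i < N) c i ^+ 2 = 1 ->
  `|\int[P]_w phi (\sum_(i < N) c i * tnth (Zt w) i) - \int[normal_prob 0 1]_x phi x|
  <= (\sum_(i < N) `|c i| ^+ 3) * ((m3 + 2) / 6).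
Proof.
move=> c1; have := smooth_sum (index_enum_uniq _) (lexx 0).
rewrite c1 add0r /smooth eqxx oner_eq0 sqrtr1.
by under [in X in _ - X]eq_Rintegral do rewrite add0r.
Qed.

End lindeberg.

(** * The trigonometric system *)

Section uniform_angle.
Context (R : realType).
Local Notation mu := (@lebesgue_measure R).

Lemma pi2_gt0 : 0 < 2 * pi :> R.
Proof. by rewrite mulr_gt0// pi_gt0. Qed.

Definition angle : probability (measurableTypeR R) R := uniform_prob pi2_gt0.

Lemma integral_angle (h : R -> R) : bmf h ->
  (((2 * pi)^-1)%R%:E * \int[mu]_(x in `[0%R, (2 * pi)%R]) (h x)%:E =
   (\int[angle]_x h x)%:E)%E.
Proof.
move=> bh; have mh : measurable_fun setT (EFin \o h).
  by apply/measurable_EFinP; exact: bmf_measurable.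
have c0 : (0 <= ((2 * pi)^-1 : R)%:E)%E by rewrite lee_fin invr_ge0 ltW// pi2_gt0.
have [_ [M HM]] := bh.
have ih : mu.-integrable `[0%R, (2 * pi)%R] (EFin \o h).
  apply: measurable_bounded_integrable => //.
  - by have := @lebesgue_measure_itv R `[0, 2 * pi]; rewrite /= lte_fin pi2_gt0 -EFinB => ->; rewrite ltry.
  - by apply/measurable_EFinP; exact: measurable_funTS.
  - exists M; split; first by rewrite num_real.
    by move=> x Mx y _; exact: le_trans (HM y) (ltW Mx).
rewrite (EFin_Ex angle bh) [in RHS]integralE /angle.
rewrite (integral_uniform pi2_gt0 (measurable_funepos mh) (funepos_ge0 _)).
rewrite (integral_uniform pi2_gt0 (measurable_funeneg mh) (funeneg_ge0 _)).
rewrite subr0 [in LHS]integralE muleBr//.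
rewrite fin_num_adde_defr//. by apply: integrable_fin_num => //; exact: integrable_funepos ih.
Qed.

Lemma angleE (A : set R) : measurable A ->
  (angle A = ((2 * pi)^-1)%R%:E * mu (`[0%R, (2 * pi)%R] `&` A))%E.
Proof.
move=> mA; have mI : measurable_fun setT (EFin \o \1_A : R -> \bar R).
  by apply/measurable_EFinP; exact: measurable_indic.
have := integral_uniform pi2_gt0 mI (fun x => _).
rewrite integral_indic// setIT => -> //=; rewrite subr0 integral_indic//.
by rewrite setIC.
Qed.

(** Integer frequencies, recorded by the values of cosine and sine after one full turn. The property
    passes to sums and differences, which is all that the product-to-sum formulas require. *)
Definition period (k : R) := cos (k * (2 * pi)) = 1 /\ sin (k * (2 * pi)) = 0.

Lemma periodD k l : period k -> period l -> period (k + l).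
Proof.
by move=> [ck sk] [cl sl]; split; rewrite mulrDl ?cosD ?sinD ck sk cl sl; ring.
Qed.

Lemma periodN k : period k -> period (- k).
Proof. by move=> [ck sk]; split; rewrite mulNr ?cosN ?sinN ?ck ?sk ?oppr0. Qed.

Lemma period_nat n : period n%:R.
Proof.
elim: n => [|n IH]; first by split; rewrite mul0r ?cos0 ?sin0.
rewrite -natr1; apply: periodD => //.
by split; rewrite mul1r mulrC mulr_natr ?cos2pi ?sin2pi.
Qed.

Lemma bmf_cosM (k : R) : bmf (fun x : R => cos (k * x)).
Proof.
split; last by exists 1 => x; rewrite ler_norml cos_geN1 cos_le1.
apply: continuous_measurable_fun.
apply: (@is_derive_continuous _ _ (fun x => - k * sin (k * x))) => x.
by apply: trigger_derive; rewrite /GRing.scale /=; ring.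
Qed.

Lemma bmf_sinM (k : R) : bmf (fun x : R => sin (k * x)).
Proof.
split; last by exists 1 => x; rewrite ler_norml sin_geN1 sin_le1.
apply: continuous_measurable_fun.
apply: (@is_derive_continuous _ _ (fun x => k * cos (k * x))) => x.
by apply: trigger_derive; rewrite /GRing.scale /=; ring.
Qed.

Lemma Ex_cosM k : period k -> \int[angle]_x cos (k * x) = if k == 0 then 1 else 0.
Proof.
move=> [ck sk]; have [->|k0] := eqVneq k 0.
  rewrite (@eq_Rintegral _ _ _ angle setT (fun=> 1)); first by rewrite Ex_cst.
  by move=> x _; rewrite mul0r cos0.
have dF (x : R) : is_derive x 1 (fun x => sin (k * x) / k) (cos (k * x)).
  by apply: trigger_derive; rewrite /GRing.scale /=; field.
have cF : continuous (fun x => cos (k * x)).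
  apply: (@is_derive_continuous _ _ (fun x => - k * sin (k * x))) => x.
  by apply: trigger_derive; rewrite /GRing.scale /=; ring.
apply: EFin_inj; rewrite -(integral_angle (bmf_cosM k)).
rewrite (is_derive_FTC2 (ltW pi2_gt0) dF cF) sk mulr0 sin0 !mul0r subrr.
by rewrite mule0.
Qed.

Lemma Ex_sinM k : period k -> \int[angle]_x sin (k * x) = 0.
Proof.
move=> [ck sk]; have [->|k0] := eqVneq k 0.
  rewrite (@eq_Rintegral _ _ _ angle setT (fun=> 0)); first by rewrite Ex_cst.
  by move=> x _; rewrite mul0r sin0.
have dF (x : R) : is_derive x 1 (fun x => - cos (k * x) / k) (sin (k * x)).
  by apply: trigger_derive; rewrite /GRing.scale /=; field.
have cF : continuous (fun x => sin (k * x)).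
  apply: (@is_derive_continuous _ _ (fun x => k * cos (k * x))) => x.
  by apply: trigger_derive; rewrite /GRing.scale /=; ring.
apply: EFin_inj; rewrite -(integral_angle (bmf_sinM k)).
rewrite (is_derive_FTC2 (ltW pi2_gt0) dF cF) ck mulr0 cos0 subrr.
by rewrite mule0.
Qed.

Definition trig (s : bool) (k x : R) : R := if s then cos (k * x) else sin (k * x).

Lemma bmf_trig s k : bmf (trig s k).
Proof. by case: s; [exact: bmf_cosM|exact: bmf_sinM]. Qed.

Lemma trig_le1 s k x : `|trig s k x| <= 1.
Proof. by case: s; rewrite /= ler_norml ?cos_geN1 ?cos_le1 ?sin_geN1 ?sin_le1. Qed.

(** Product-to-sum formulas reduce the integrals to the frequencies k + l and k - l. The shift by
    one makes k + l nonzero, so only the cosine of frequency k - l can contribute. *)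
Lemma trig_orthogonal s t (p q : nat) :
  \int[angle]_x (trig s p.+1%:R x * trig t q.+1%:R x) =
  if (s == t) && (p == q) then 2^-1 else 0.
Proof.
have Pp := period_nat p.+1; have Pq := period_nat q.+1.
set k := p.+1%:R; set l := q.+1%:R.
have kl0 : k + l != 0 by rewrite /k /l -natrD pnatr_eq0.
have kl1 : (k - l == 0) = (p == q) by rewrite subr_eq0 eqr_nat eqSS.
have Pd := periodD Pp (periodN Pq); have Ps := periodD Pp Pq.
have h0 : 0 <= 2^-1 :> R by [].
case: s t => -[] /=.
- transitivity (\int[angle]_x (2^-1 * (cos ((k - l) * x) + cos ((k + l) * x)))).
    by apply: eq_Rintegral => x _; rewrite !mulrDl mulNr !cosD cosN sinN; field.
  rewrite ExZ; last by apply: bmfD; exact: bmf_cosM.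
  have /= -> := ExD angle (bmf_cosM (k - l)) (bmf_cosM (k + l)); rewrite !Ex_cosM// kl1 (negbTE kl0) addr0.
  by case: (p == q); rewrite ?mulr1 ?mulr0.
- transitivity (\int[angle]_x (2^-1 * (sin ((k + l) * x) - sin ((k - l) * x)))).
    by apply: eq_Rintegral => x _; rewrite !mulrDl mulNr !sinD cosN sinN; field.
  rewrite ExZ; last by apply: bmfB; exact: bmf_sinM.
  have /= -> := ExB angle (bmf_sinM (k + l)) (bmf_sinM (k - l)); by rewrite !Ex_sinM// subrr mulr0.
- transitivity (\int[angle]_x (2^-1 * (sin ((k + l) * x) + sin ((k - l) * x)))).
    by apply: eq_Rintegral => x _; rewrite !mulrDl mulNr !sinD cosN sinN; field.
  rewrite ExZ; last by apply: bmfD; exact: bmf_sinM.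
  have /= -> := ExD angle (bmf_sinM (k + l)) (bmf_sinM (k - l)); by rewrite !Ex_sinM// addr0 mulr0.
- transitivity (\int[angle]_x (2^-1 * (cos ((k - l) * x) - cos ((k + l) * x)))).
    by apply: eq_Rintegral => x _; rewrite !mulrDl mulNr !cosD cosN sinN; field.
  rewrite ExZ; last by apply: bmfB; exact: bmf_cosM.
  have /= -> := ExB angle (bmf_cosM (k - l)) (bmf_cosM (k + l)); rewrite !Ex_cosM// kl1 (negbTE kl0) subr0.
  by case: (p == q); rewrite ?mulr1 ?mulr0.
Qed.

End uniform_angle.

Section coefficient_index.
Variable n : nat.

(** The first n positions hold the cosine coefficients and the last n the sine coefficients, so that
    the polynomial is one linear form in 2 n independent variables. *)
Definition coef_index (i : 'I_(n + n)) : bool * nat :=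
  match fintype.split i with inl j => (true, val j) | inr j => (false, val j) end.

Definition coef_rank (p : bool * nat) : option 'I_(n + n) :=
  omap (fun j : 'I_n => if p.1 then lshift n j else rshift n j) (insub p.2).

Lemma coef_indexK : pcancel coef_index coef_rank.
Proof.
move=> i; rewrite /coef_index /coef_rank -[in RHS](fintype.splitK i).
by case: (fintype.split i) => j /=; rewrite (valK j : insub (nat_of_ord j) = Some j).
Qed.

Lemma coef_index_inj : injective coef_index.
Proof. exact: pcan_inj coef_indexK. Qed.

Lemma coef_index_lshift j : coef_index (lshift n j) = (true, val j).
Proof. by rewrite /coef_index (fintype.unsplitK (inl j)). Qed.

Lemma coef_index_rshift j : coef_index (rshift n j) = (false, val j).
Proof. by rewrite /coef_index (fintype.unsplitK (inr j)). Qed.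

End coefficient_index.

Section random_polynomial.
Context (R : realType) d (T : measurableType d) (P : probability T R).
Variables (a b : nat -> T -> R) (n : nat).

Definition coef (i : 'I_(n + n)) : T -> R := ab_family a b (coef_index i).

Definition wave (i : 'I_(n + n)) (x : R) : R :=
  trig (coef_index i).1 (coef_index i).2.+1%:R x.

Lemma fn_lincomb w x :
  fn a b n w x = lincomb wave (Num.sqrt n%:R)^-1 (coefs coef w) x.
Proof.
rewrite /fn /lincomb big_split_ord big_split /=; congr (_ * (_ + _)).
- by apply: eq_bigr => j _; rewrite tnth_mktuple /coef /wave coef_index_lshift.
- by apply: eq_bigr => j _; rewrite tnth_mktuple /coef /wave coef_index_rshift.
Qed.

Lemma sum_wave2 x : \sum_(i < n + n) wave i x ^+ 2 = n%:R.
Proof.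
transitivity (\sum_(j < n) (wave (lshift n j) x ^+ 2 + wave (rshift n j) x ^+ 2)).
  by rewrite big_split_ord big_split.
rewrite (eq_bigr (fun=> 1)); first by rewrite sumr_const card_ord.
move=> j _; rewrite /wave coef_index_lshift coef_index_rshift /=.
exact: cos2Dsin2.
Qed.

Lemma wave_orthogonal i j :
  \int[angle R]_x (wave i x * wave j x) = if i == j then 2^-1 else 0.
Proof.
rewrite /wave trig_orthogonal -(inj_eq (@coef_index_inj n)).
by case: (coef_index i) (coef_index j) => s p [t q].
Qed.

Lemma bmf_wave i : bmf (wave i). Proof. exact: bmf_trig. Qed.

Lemma wave_le1 i x : `|wave i x| <= 1. Proof. exact: trig_le1. Qed.

Hypothesis indep : mutually_independent P (ab_family a b).
Hypothesis law : forall k B, measurable B ->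
  P (a k @^-1` B) = P (a 0%N @^-1` B) /\ P (b k @^-1` B) = P (a 0%N @^-1` B).

Lemma coef_independent (B : 'I_(n + n) -> set R) : (forall i, measurable (B i)) ->
  P (\bigcap_i (coef i @^-1` B i)) = (\prod_(i < n + n) P (a 0%N @^-1` B i))%E.
Proof.
move=> mB; pose J := [seq coef_index i | i <- index_enum 'I_(n + n)].
(* Independence is stated for sets indexed by all coefficients; indices without a rank receive
   [setT]. *)
pose B' p := oapp B setT (@coef_rank n p).
have uJ : uniq J by rewrite (map_inj_uniq (@coef_index_inj n)); exact: index_enum_uniq.
have mB' p : measurable (B' p) by rewrite /B'; case: (coef_rank n p) => [i|] /=; [exact: mB|exact: measurableT].
have BE i : B' (coef_index i) = B i by rewrite /B' coef_indexK.
have := indep uJ mB'; rewrite big_map => E.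
transitivity (P (\bigcap_(p in [set` J]) (ab_family a b p @^-1` B' p))).
  congr (P _); apply/seteqP; split=> w H.
  - by move=> _ /mapP[i _ ->] /=; rewrite BE; exact: H.
  - move=> i _; have := H (coef_index i); rewrite /= BE; apply.
    by apply/mapP; exists i => //; rewrite mem_index_enum.
rewrite E; apply: eq_bigr => i _; rewrite BE.
by rewrite /ab_family; case: (coef_index i) => -[] k /=; case: (law k (mB i)).
Qed.

End random_polynomial.

Section gaussian_target.
Context (R : realType) (g : R -> R).
Local Notation mu := (@lebesgue_measure R).
Hypothesis mg : measurable_fun `[0, 2 * pi] g.
Hypothesis lawg : forall B, measurable B ->
  (((2 * pi)^-1)%R%:E * mu (`[0%R, (2 * pi)%R] `&` g @^-1` B))%E = normal_prob 0 1 B.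

Lemma EX_bmf (h : R -> R) : bmf h -> EX h = (\int[angle R]_x h x)%:E.
Proof. exact: integral_angle. Qed.

Lemma EX_gaussian (phi : R -> R) : bmf phi ->
  EX (phi \o g) = (\int[normal_prob 0 1]_x phi x)%:E.
Proof.
move=> bp; pose I : set R := `[0, 2 * pi]%classic.
(* [g] is measurable on the interval only; extending it by 0 makes it a random variable on the line,
   where the uniform law does not see the change. *)
pose g' : R -> R := g \_ I.
have mI : measurable I by exact: measurable_itv.
have mg' : measurable_fun setT g' := (measurable_restrictT g mI).1 mg.
have g'E x : x \in I -> g' x = g x by move=> xI; rewrite /g' patchE xI.
have -> : EX (phi \o g) = EX (phi \o g').
  congr (_ * _)%E; apply: eq_integral => x xI; by rewrite /= g'E.
have b' : bmf (phi \o g') by exact: (bmf_comp bp mg').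
rewrite (EX_bmf b'); apply: etrans (EFin_Ex (angle R) b') _.
apply: etrans _ (esym (EFin_Ex (normal_prob 0 1) bp)).
have mp : measurable_fun setT (EFin \o phi) by apply/measurable_EFinP; exact: bmf_measurable.
have mG : @measurable_fun _ _ (measurableTypeR R) (measurableTypeR R) setT g' := mg'.
pose G : {RV (angle R) >-> (measurableTypeR R)} :=
  HB.pack g' (isMeasurableFun.Build _ _ (measurableTypeR R) (measurableTypeR R) g' mG).
have iG : (angle R).-integrable setT ((EFin \o phi) \o G) := bmf_integrable (angle R) b'.
have D := integral_distribution (X := G) (f := EFin \o phi) mp iG.
transitivity (\int[angle R]_x ((EFin \o phi) \o G) x)%E; first by [].
rewrite -D.
apply: (eq_measure_integral (normal_prob 0 1)) => A mA _.
rewrite /distribution /=.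
rewrite /pushforward angleE; last by rewrite -[_ @^-1` _]setTI; exact: mg'.
rewrite -lawg//; congr (_ * mu _)%E; apply/seteqP; split=> x [xI /= H]; split=> //=.
- by rewrite -g'E ?inE.
- by rewrite g'E ?inE.
Qed.

End gaussian_target.

(** * Distance to the normal law *)

Lemma Ex_prod (R : realType) d1 d2 (T1 : measurableType d1) (T2 : measurableType d2)
    (Q1 : probability T1 R) (Q2 : probability T2 R) (f : T1 * T2 -> R) : bmf f ->
  \int[(Q1 \x Q2)%E]_p f p = \int[Q1]_x \int[Q2]_y f (x, y).
Proof.
move=> bf; rewrite {1}/Rintegral -(integral12_prod_meas1 (bmf_integrable2 Q1 Q2 bf)).
congr fine; apply: eq_integral => x _.
by rewrite /fubini_F (EFin_Ex Q2 (bmf_pair1 x bf)).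
Qed.

Section gaussian_distance.
Context (R : realType) d (T : measurableType d) (P : probability T R).
Context (N : nat) (Z : 'I_N -> T -> R) (al : T -> R).
Hypothesis mZ : forall i, measurable_fun setT (Z i).
Hypothesis mal : measurable_fun setT al.
Hypothesis indep : forall B : 'I_N -> set R, (forall i, measurable (B i)) ->
  P (\bigcap_i (Z i @^-1` B i)) = (\prod_(i < N) P (al @^-1` B i))%E.
Hypothesis al4 : P.-integrable setT (fun w => (al w ^+ 4)%:E).
Hypothesis al1 : (\int[P]_w (al w)%:E = 0)%E.
Hypothesis al2 : (\int[P]_w (al w ^+ 2)%:E = 1)%E.
Context d' (S : measurableType d') (U : probability S R) (e : 'I_N -> S -> R).
Hypothesis me : forall i, measurable_fun setT (e i).
Hypothesis e_le1 : forall i x, `|e i x| <= 1.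
Variable (c : R).
Hypothesis c_gt0 : 0 < c.
Hypothesis ce : forall x, c ^+ 2 * (\sum_(i < N) e i x ^+ 2) = 1.
Hypothesis orth : forall i j, \int[U]_x (e i x * e j x) = if i == j then 2^-1 else 0.
Local Notation mu := (@lebesgue_measure R).
Local Notation Zt := (coefs Z).
Local Notation lincomb := (lincomb e c).
Let m3 := \int[P]_w (`|al w| ^+ 3).
Let m4 := \int[P]_w (al w ^+ 4).

(** Each |c e_i(x)| is at most c and their squares sum to 1, so the sum of cubes in Lindeberg's
    bound is at most c. *)
Lemma Ex_lincomb_normal (phi : R -> R) x : C3_unit phi ->
  `|\int[P]_w phi (lincomb (Zt w) x) - \int[normal_prob 0 1]_y phi y| <= c * ((m3 + 2) / 6).
Proof.
move=> C3phi; have m30 : 0 <= m3 by apply: Rintegral_ge0 => w _; rewrite exprn_ge0.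
have H : \sum_(i < N) (c * e i x) ^+ 2 = 1.
  by rewrite -(ce x) mulr_sumr; apply: eq_bigr => i _; rewrite exprMn.
have := lindeberg mZ mal indep al4 al1 al2 C3phi H.
have -> : \int[P]_w phi (\sum_(i < N) c * e i x * tnth (Zt w) i) =
    \int[P]_w phi (lincomb (Zt w) x).
  apply: eq_Rintegral => w _; rewrite /lincomb mulr_sumr; congr (phi _).
  by apply: eq_bigr => i _; ring.
move=> /le_trans; apply; rewrite ler_wpM2r ?divr_ge0 ?addr_ge0//.
rewrite -[leRHS]mulr1 -H mulr_sumr; apply: ler_sum => i _.
rewrite exprS -[(c * e i x) ^+ 2]real_normK ?num_real// ler_wpM2r ?exprn_ge0//.
by rewrite normrM (gtr0_norm c_gt0) ler_piMr// ltW.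
Qed.

(** The averaged law is realized as that of the sum under [P \x U], so [Ex_diff_le] compares it with
    the law for fixed coefficients; Lindeberg's bound, integrated over the angle, does the rest. *)
Lemma Ex_normal_le (phi : R -> R) (eta : R) z : C3_unit phi -> 0 < eta ->
  ((\int[U]_x phi (lincomb z x) - \int[normal_prob 0 1]_y phi y)%:E <=
   (c * ((m3 + 2) / 6) + 16 * eta)%:E + (4 / eta)%:E *
   \int[mu]_s (weight s * (avg_ker U e c s z - \int[P]_v avg_ker U e c s (Zt v)) ^+ 2)%:E)%E.
Proof.
move=> C3phi eta0; have bphi := C3_bmf C3phi.
have mY1 : measurable_fun setT (lincomb z) by exact: measurable_lincomb.
have mY2 : measurable_fun setT (fun p : T * S => lincomb (Zt p.1) p.2).
  apply: measurable_lincomb => //.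
  exact: (measurableT_comp (measurable_coefs mZ)).
have b2 : bmf (fun p : T * S => phi (lincomb (Zt p.1) p.2)) by exact: (bmf_comp bphi).
have kE s : \int[(P \x U)%E]_p ker (s - lincomb (Zt p.1) p.2) =
    \int[P]_v avg_ker U e c s (Zt v).
  apply: (Ex_prod P U (f := fun p : T * S => ker (s - lincomb (Zt p.1) p.2))).
  by apply: (bmf_comp (@bmf_ker R)); exact: measurable_funB.
have := Ex_diff_le U (P \x U)%E mY1 mY2 eta0 C3phi.
under eq_integral do rewrite kE.
set I := (\int[mu]_s _)%E.
have -> : \int[(P \x U)%E]_p phi (lincomb (Zt p.1) p.2) =
    \int[U]_x \int[P]_w phi (lincomb (Zt w) x).
  by rewrite (Ex_prod P U b2) (Ex_fubini P U b2).
have b2' : bmf (fun p : S * T => phi (lincomb (Zt p.2) p.1)).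
  by apply: (bmf_comp b2 (g := fun p : S * T => (p.2, p.1))); apply: measurable_fun_pair.
have H : \int[U]_x \int[P]_w phi (lincomb (Zt w) x) - \int[normal_prob 0 1]_y phi y
    <= c * ((m3 + 2) / 6).
  rewrite -[X in _ - X](Ex_cst U).
  have /= <- := ExB U (bmf_Ex2 P b2') (bmf_cst S (\int[normal_prob 0 1]_y phi y)).
  apply: le_trans (ler_norm _) _; apply: Ex_norm => [|x]; last exact: Ex_lincomb_normal.
  exact: (bmfB (bmf_Ex2 P b2') (bmf_cst S _)).
move=> H2; rewrite [(_ + 16 * eta)%:E]EFinD -addeA.
have trans (x y t b : R) (K : \bar R) : y - t <= b -> ((x - y)%:E <= K ->
    (x - t)%:E <= b%:E + K)%E.
  move=> h1 h2; have -> : x - t = (y - t) + (x - y) by ring.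
  by rewrite EFinD; apply: leeD => //; rewrite lee_fin.
exact: trans H H2.
Qed.

Lemma integral_variance_le : c ^+ 2 * m4 <= 16^-1 ->
  (\int[P]_w \int[mu]_s (weight s *
     (avg_ker U e c s (Zt w) - \int[P]_v avg_ker U e c s (Zt v)) ^+ 2)%:E <=
   (c ^+ 2 * (m4 / 4 + 10))%:E)%E.
Proof.
move=> cm4; have bk := @bmf_avg_ker R N d' S U e me c.
have bA : bmf (fun p : R * T => avg_ker U e c p.1 (Zt p.2)).
  apply: (bmf_comp bk (g := fun p : R * T => (p.1, Zt p.2))).
  apply: measurable_fun_pair => //.
  exact: (measurableT_comp (measurable_coefs mZ)).
have bM := bmf_Ex2 P bA.
have bD : bmf (fun p : R * T => avg_ker U e c p.1 (Zt p.2) -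
    \int[P]_v avg_ker U e c p.1 (Zt v)).
  by apply: bmfB => //; exact: (bmf_comp bM).
pose g (p : R * T) := weight p.1 * (avg_ker U e c p.1 (Zt p.2) -
    \int[P]_v avg_ker U e c p.1 (Zt v)) ^+ 2.
have mg : measurable_fun setT g.
  apply: measurable_funM; first exact: (measurableT_comp (@measurable_weight R)).
  by apply: measurable_funX; exact: bmf_measurable.
have g0 p : 0 <= g p by rewrite mulr_ge0 ?sqr_ge0// ltW// weight_gt0.
have := ge0_swap mu P mg g0; rewrite /g /= => <-.
apply: le_trans (weighted_variance mZ mal indep al4 al1 al2 me e_le1 ce orth cm4).
rewrite le_eqVlt; apply/orP; left; apply/eqP; apply: eq_integral => s _.
have bs := bmfX 2 (bmf_pair1 s bD).
have /= <- := EFin_Ex P (bmfM (bmf_cst T (weight s)) bs).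
by congr EFin; have /= <- := ExZ P (weight s) bs.
Qed.

Lemma integral_normal_distance_le (D : T -> \bar R) (eta : R) :
  0 < eta -> c ^+ 2 * m4 <= 16^-1 -> (forall w, 0 <= D w)%E ->
  (forall w, D w <= (c * ((m3 + 2) / 6) + 16 * eta)%:E + (4 / eta)%:E *
   \int[mu]_s (weight s * (avg_ker U e c s (Zt w) -
     \int[P]_v avg_ker U e c s (Zt v)) ^+ 2)%:E)%E ->
  (\int[P]_w D w <=
   (c * ((m3 + 2) / 6) + 16 * eta + 4 / eta * (c ^+ 2 * (m4 / 4 + 10)))%:E)%E.
Proof.
move=> eta0 cm4 D0 DB; have bk := @bmf_avg_ker R N d' S U e me c.
have m30 : 0 <= m3 by apply: Rintegral_ge0 => w _; rewrite exprn_ge0.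
apply: (@le_trans _ _ (\int[P]_w ((c * ((m3 + 2) / 6) + 16 * eta)%:E + (4 / eta)%:E *
   \int[mu]_s (weight s * (avg_ker U e c s (Zt w) -
     \int[P]_v avg_ker U e c s (Zt v)) ^+ 2)%:E))%E).
  by apply: ge0_le_integralT => w; [exact: D0|exact: DB].
have b0 : 0 <= c * ((m3 + 2) / 6) + 16 * eta.
  by rewrite addr_ge0 ?mulr_ge0 ?divr_ge0 ?addr_ge0 ?(ltW c_gt0) ?(ltW eta0).
have bA : bmf (fun p : T * R => avg_ker U e c p.2 (Zt p.1)).
  apply: (bmf_comp bk (g := fun p : T * R => (p.2, Zt p.1))).
  apply: measurable_fun_pair => //.
  exact: (measurableT_comp (measurable_coefs mZ)).
have bA' : bmf (fun p : R * T => avg_ker U e c p.1 (Zt p.2)).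
  apply: (bmf_comp bk (g := fun p : R * T => (p.1, Zt p.2))).
  apply: measurable_fun_pair => //.
  exact: (measurableT_comp (measurable_coefs mZ)).
have bD : bmf (fun p : T * R => avg_ker U e c p.2 (Zt p.1) -
    \int[P]_v avg_ker U e c p.2 (Zt v)).
  by apply: bmfB => //; exact: (bmf_comp (bmf_Ex2 P bA')).
have mI : measurable_fun setT (fun w => \int[mu]_s (weight s * (avg_ker U e c s (Zt w) -
     \int[P]_v avg_ker U e c s (Zt v)) ^+ 2)%:E)%E.
  apply: (measurable_ge0_integral mu (g := fun p : T * R => weight p.2 *
    (avg_ker U e c p.2 (Zt p.1) - \int[P]_v avg_ker U e c p.2 (Zt v)) ^+ 2)).
    apply: measurable_funM; first exact: (measurableT_comp (@measurable_weight R)).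
    by apply: measurable_funX; exact: bmf_measurable.
  by move=> p; rewrite mulr_ge0 ?sqr_ge0// ltW// weight_gt0.
have I0 w : (0 <= \int[mu]_s (weight s * (avg_ker U e c s (Zt w) -
     \int[P]_v avg_ker U e c s (Zt v)) ^+ 2)%:E)%E.
  by apply: integral_ge0 => s _; rewrite lee_fin mulr_ge0 ?sqr_ge0// ltW// weight_gt0.
have e0 : (0 <= (4 / eta)%:E)%E by rewrite lee_fin divr_ge0// ltW.
rewrite ge0_integralD//; last 2 first.
- by move=> w _; rewrite mule_ge0.
- by apply: emeasurable_funM => //; exact: measurable_cst.
rewrite integral_cst1 (ge0_integralZl P measurableT mI)//.
rewrite [leRHS]EFinD; apply: leeD => //; rewrite [leRHS]EFinM.
by apply: lee_wpmul2l => //; exact: integral_variance_le.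
Qed.

End gaussian_distance.

Section smooth_distance.
Context (R : realType).

Lemma dXC3_ge0 (f g : R -> R) : (0 <= dXC3 f g)%E.
Proof.
apply: ereal_sup_ubound; exists (cst 0); first exact: C3_unit0.
have E0 (h : R -> R) : EX (cst 0 \o h) = 0%E.
  have -> : cst 0 \o h = (fun=> 0) by [].
  by rewrite (EX_bmf (bmf_cst _ 0)) Ex_cst.
by rewrite !E0 subee.
Qed.

Lemma dXC3_le (f g : R -> R) (x : \bar R) :
  (forall phi, C3_unit phi -> EX (phi \o f) - EX (phi \o g) <= x)%E -> (dXC3 f g <= x)%E.
Proof. by move=> H; apply: ge_ereal_sup => _ [phi C3phi <-]; exact: H. Qed.

End smooth_distance.

(** The chosen [eta] minimizes 16 eta + 4 c^2 K / eta, making both terms equal to 8 c sqrt K. Since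
    sqrt K <= sqrt m4 / 2 + 4, they add up to at most (8 sqrt m4 + 64) c; the 64 and the Lindeberg
    constant 1/3 are absorbed by 81 * 3. *)
Lemma constant_bound (R : realType) (m1 m3 m4 s3 c eta : R) :
  0 <= m1 -> 0 <= m3 -> 0 <= m4 -> 0 <= s3 -> 0 < c -> eta = Num.sqrt (m4 / 4 + 10) * c / 2 ->
  c * ((m3 + 2) / 6) + 16 * eta + 4 / eta * (c ^+ 2 * (m4 / 4 + 10)) <=
  (81 * Num.sqrt (13 + s3) + 8 * Num.sqrt m4 + Num.sqrt 2 + 8 * m3 + 24 * m1) * c.
Proof.
move=> m10 m30 m40 s30 c0 etaE; pose K := m4 / 4 + 10.
have K0 : 0 < K by rewrite ltr_wpDl// divr_ge0.
set r := Num.sqrt K in etaE *; have r0 : 0 < r by rewrite sqrtr_gt0.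
have Kr : K = r ^+ 2 by rewrite sqr_sqrtr// ltW.
have -> : 4 / eta * (c ^+ 2 * K) = 8 * r * c.
  by rewrite etaE Kr; field; rewrite !gt_eqF.
have rle : r <= Num.sqrt m4 / 2 + 4.
  have q0 : 0 <= Num.sqrt m4 / 2 + 4 by rewrite addr_ge0// divr_ge0// sqrtr_ge0.
  rewrite -(ger0_norm q0) -sqrtr_sqr ler_sqrt ?sqr_ge0// /K -{1}(sqr_sqrtr m40).
  have := sqrtr_ge0 m4; move: (Num.sqrt m4) => u u0; nra.
have s13 : 3 <= Num.sqrt (13 + s3).
  have q0 : 0 <= 3 :> R by [].
  by rewrite -(ger0_norm q0) -sqrtr_sqr ler_sqrt ?addr_ge0//; lra.
have s2 : 0 <= Num.sqrt 2 :> R by exact: sqrtr_ge0.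
rewrite etaE; have -> : c * ((m3 + 2) / 6) + 16 * (r * c / 2) + 8 * r * c =
  ((m3 + 2) / 6 + 16 * r) * c by field.
by rewrite ler_wpM2r ?(ltW c0)//; lra.
Qed.

Theorem theorem2 (R : realType) (d : measure_display) (T : measurableType d)
  (P : probability T R) (a b : nat -> T -> R) (g : R -> R) (n : nat) :
  (forall k, measurable_fun setT (a k)) ->
  (forall k, measurable_fun setT (b k)) ->
  mutually_independent P (ab_family a b) ->
  (forall k B, measurable B ->
     P (a k @^-1` B) = P (a 0%N @^-1` B) /\ P (b k @^-1` B) = P (a 0%N @^-1` B)) ->
  (\int[P]_w (a 0%N w)%:E = 0)%E ->
  (\int[P]_w ((a 0%N w) ^+ 2)%:E = 1)%E ->
  P.-integrable setT (fun w => ((a 0%N w) ^+ 4)%:E) ->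
  measurable_fun `[0, 2 * pi] g ->
  (forall B, measurable B ->
     (((2 * pi)^-1)%R%:E * lebesgue_measure (`[0%R, (2 * pi)%R] `&` g @^-1` B))%E
     = normal_prob 0 1 B) ->
  (0 < n)%N ->
  let Ca := 81 * Num.sqrt (13 + `|fine (\int[P]_w ((a 0%N w) ^+ 3)%:E)%E|)
            + 8 * Num.sqrt (fine (\int[P]_w ((a 0%N w) ^+ 4)%:E)%E)
            + Num.sqrt 2
            + 8 * fine (\int[P]_w (`|a 0%N w| ^+ 3)%:E)%E
            + 24 * fine (\int[P]_w (`|a 0%N w|)%:E)%E in
  (\int[P]_w dXC3 (fn a b n w) g <= (Ca / Num.sqrt n%:R)%:E)%E.
Proof.
move=> ma mb indep law al1 al2 al4 mg lawg n0; cbv zeta.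
set Ca := (X in (_ <= (X / _)%:E)%E).
pose c : R := (Num.sqrt n%:R)^-1.
have sn0 : 0 < Num.sqrt n%:R :> R by rewrite sqrtr_gt0 ltr0n.
have c0 : 0 < c by rewrite invr_gt0.
have cn : c ^+ 2 * n%:R = 1.
  by rewrite /c exprVn sqr_sqrtr// mulVf// pnatr_eq0 -lt0n.
pose Z : 'I_(n + n) -> T -> R := coef a b (n:=n).
have mZ i : measurable_fun setT (Z i).
  by rewrite /Z /coef /ab_family; case: (coef_index i) => -[] k; [exact: ma|exact: mb].
have indepZ := coef_independent indep law (n := n).
have me (i : 'I_(n + n)) : @measurable_fun _ _ (measurableTypeR R) R setT (wave i) :=
  bmf_measurable (bmf_wave R i).
have ce (x : R) : c ^+ 2 * (\sum_(i < n + n) wave i x ^+ 2) = 1 by rewrite sum_wave2.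
pose m1 := \int[P]_w `|a 0%N w|.
pose m3 := \int[P]_w (`|a 0%N w| ^+ 3).
pose m4 := \int[P]_w (a 0%N w ^+ 4).
pose s3 := `|\int[P]_w (a 0%N w ^+ 3)|.
have CaE : Ca = 81 * Num.sqrt (13 + s3) + 8 * Num.sqrt m4 + Num.sqrt 2 + 8 * m3 + 24 * m1 by [].
have m10 : 0 <= m1 by apply: Rintegral_ge0.
have m30 : 0 <= m3 by apply: Rintegral_ge0 => w _; rewrite exprn_ge0.
have m40 : 0 <= m4 by apply: Rintegral_ge0 => w _; rewrite (exprM _ 2 2) sqr_ge0.
rewrite -[Ca / _]/(Ca * c).
have mf w : measurable_fun setT (fn a b n w).
  rewrite (_ : fn a b n w = lincomb (@wave R n) c (coefs Z w)).
    exact: measurable_lincomb.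
  by apply/funext => x; exact: fn_lincomb.
have EXf w phi : C3_unit phi -> EX (phi \o fn a b n w) = (\int[angle R]_x phi (fn a b n w x))%:E.
  by move=> C3phi; exact: (EX_bmf (bmf_comp (C3_bmf C3phi) (mf w))).
have EXg phi : C3_unit phi -> EX (phi \o g) = (\int[normal_prob 0 1]_x phi x)%:E.
  by move=> C3phi; exact: (EX_gaussian mg lawg (C3_bmf C3phi)).
have [cm4|cm4] := leP (c ^+ 2 * m4) 16^-1; last first.
  apply: (@le_trans _ _ (\int[P]_w 2%R%:E)%E).
    apply: ge0_le_integralT => w; first exact: dXC3_ge0.
    apply: dXC3_le => phi C3phi; rewrite EXf// EXg// -EFinB lee_fin.
    have [_ [_ B]] := C3phi.
    have h1 := Ex_norm (angle R) (bmf_comp (C3_bmf C3phi) (mf w))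
      (fun x => B 0%N isT (fn a b n w x)).
    have h2 := Ex_norm (normal_prob 0 1) (C3_bmf C3phi) (B 0%N isT).
    move: h1 h2; rewrite !ler_norml => /andP[_ h1] /andP[h2 _]; lra.
  rewrite integral_cst1 lee_fin.
  have h : 2 <= 8 * Num.sqrt m4 * c.
    (* Square root of the negated smallness condition; multiplied by 8 it reaches the trivial bound
       2. *)
    have : 4^-1 <= Num.sqrt m4 * c.
      rewrite -(@ler_pXn2r _ 2)// ?nnegrE ?mulr_ge0 ?sqrtr_ge0 ?(ltW c0)//.
      rewrite exprMn sqr_sqrtr// mulrC exprVn (le_trans _ (ltW cm4))//.
      by rewrite lef_pV2 ?posrE//; lra.
    lra.
  apply: le_trans h _; rewrite ler_wpM2r ?(ltW c0)// CaE.
  have := sqrtr_ge0 (13 + s3).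
  have := sqrtr_ge0 (2 : R); lra.
pose eta := Num.sqrt (m4 / 4 + 10) * c / 2.
have eta0 : 0 < eta.
  by rewrite divr_gt0// mulr_gt0// sqrtr_gt0 ltr_wpDl// divr_ge0.
apply: (@le_trans _ _ (c * ((m3 + 2) / 6) + 16 * eta +
    4 / eta * (c ^+ 2 * (m4 / 4 + 10)))%:E); last first.
  by rewrite lee_fin CaE; exact: (constant_bound m10 m30 m40 (normr_ge0 _) c0 erefl).
have := (integral_normal_distance_le (D := fun w => dXC3 (fn a b n w) g) mZ (ma 0%N) indepZ
  al4 al1 al2 me (@wave_le1 R n) c0 ce (@wave_orthogonal R n) eta0 cm4); apply => w.
  exact: dXC3_ge0.
apply: dXC3_le => phi C3phi; rewrite EXf// EXg// -EFinB.
have -> : \int[angle R]_x phi (fn a b n w x) =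
    \int[angle R]_x phi (lincomb (@wave R n) c (coefs Z w) x).
  by apply: eq_Rintegral => x _; rewrite fn_lincomb.
exact: (Ex_normal_le mZ (ma 0%N) indepZ al4 al1 al2 (angle R) me (@wave_le1 R n)
  c0 ce (coefs Z w) C3phi eta0).
Qed.
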